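(* Let $n\in\mathbb{N}$, $0\le p\le n$, let $A_\lambda,B_\lambda$ be holomorphic functions of $\lambda\in\mathbb{C}$, and set $$C_\lambda:=(\lambda+p)A_\lambda-pB_\lambda,\qquad D_\lambda:=-(n-p)A_\lambda+(\lambda+n-p)B_\lambda .$$ Let $R^\lambda_{A_\lambda,B_\lambda}$ be the Riesz distribution for differential forms, acting on $p$-forms. The residue of $\mathcal{F}(R^\lambda_{A_\lambda,B_\lambda})(\xi)$ at $\lambda=-n-2k$, for $k\in\mathbb{N}_0$, is given by $$\operatorname{Res}_{\lambda=-n-2k}\big(\mathcal{F}(R^\lambda_{A_\lambda,B_\lambda})(\xi)\big)=\frac{(-1)^{k+1}\pi^{\frac n2}}{4^k\,k!\,\Gamma(\frac{n+2k+2}{2})}\Big[\frac{C_{-n-2k}}{C_{-n}}(i_\xi\varepsilon_\xi)^k+\frac{D_{-n-2k}}{D_{-n}}(\varepsilon_\xi i_\xi)^k\Big]R^0_{C_{-n},D_{-n}}(\xi).$$ Especially, in case $R^\lambda_{A_\lambda,B_\lambda}$ acts on $0$-forms, we have $$\operatorname{Res}_{\lambda=-n-2k}\big(\mathcal{F}(R^\lambda_{A_\lambda,B_\lambda})(\xi)\big)=\frac{(-1)^{k+1}\pi^{\frac n2}}{4^k\,k!\,\Gamma(\frac{n+2k+2}{2})}\,C_{-n-2k}\,r^{2k}(\xi).$$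
   Context: On $\mathbb{R}^n$ with standard orthonormal basis $e_1,\dots,e_n$ (vectors and covectors identified via the Euclidean scalar product), for $x\in\mathbb{R}^n$ and a $p$-form $\omega$ put $i_x\omega:=\sum_k x_k\, i_{e_k}\omega$ and $\varepsilon_x\omega:=\sum_k x_k\, e_k\wedge\omega$. Let $r^\lambda(x)=(x_1^2+\cdots+x_n^2)^{\lambda/2}$. For $\mu\in\mathbb{C}$ with $\Re(\mu)>-n$ and $a,b\in\mathbb{C}$ put $$R^{\mu}_{a,b}(x):=r^{\mu-2}(x)\,(a\, i_x\varepsilon_x+b\,\varepsilon_x i_x),$$ a tempered distribution with values in the endomorphisms of differential forms. The Riesz distribution for differential forms $R^\lambda_{A_\lambda,B_\lambda}$ is obtained with $\mu=\lambda$, $a=A_\lambda$, $b=B_\lambda$; it extends meromorphically to $\lambda\in\mathbb{C}$ with simple poles at $\lambda\in-n-2\mathbb{N}_0$. Fourier transform convention: $\mathcal{F}(f)(\xi)=\int_{\mathbb{R}^n}f(x)e^{i\langle x,\xi\rangle}dx$, acting on coefficients of forms and extended to tempered distributions, so that $\mathcal{F}(\delta_0)=1$ for the Dirac distribution $\delta_0$ at the origin.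
   Formalization: For k=0 the powers (i_ξ ε_ξ)^0 and (ε_ξ i_ξ)^0 are read as the projections |ξ|^{-2} i_ξ ε_ξ and |ξ|^{-2} ε_ξ i_ξ, since with the identity the formula is off by a factor 2; the general formula assumes C_{-n}, D_{-n} nonzero. *)

(* Defs.v *)
From HB Require Import structures.
From mathcomp Require Import all_boot all_order all_algebra.
From mathcomp Require Import complex.
From mathcomp Require Import all_classical all_reals all_analysis.

Set Implicit Arguments.
Unset Strict Implicit.
Unset Printing Implicit Defensive.

Import Order.TTheory GRing.Theory Num.Theory.
Import numFieldNormedType.Exports.

Local Open Scope classical_set_scope.
Local Open Scope complex_scope.
Local Open Scope ring_scope.

Section power_measure.
Context d (T : measurableType d) {R : realType}.
Variable mu : {sigma_finite_measure set T -> \bar R}.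

Section step.
Variables (n : nat) (m : {sigma_finite_measure set (n.-tuple T) -> \bar R}).

Definition tuple_cons (u : T * n.-tuple T) : n.+1.-tuple T :=
  [tuple of u.1 :: u.2].

Let measurable_tuple_cons : measurable_fun setT tuple_cons.
Proof. by apply: measurable_cons; [exact: measurable_fst|exact: measurable_snd]. Qed.

Definition power_measure_step : set (n.+1.-tuple T) -> \bar R :=
  pushforward (mu \x m)%E tuple_cons.

Let step0 : power_measure_step set0 = 0%E.
Proof. by rewrite /power_measure_step /pushforward preimage_set0 measure0. Qed.

Let step_ge0 A : (0 <= power_measure_step A)%E.
Proof. exact: measure_ge0. Qed.

Let step_sigma_additive : semi_sigma_additive power_measure_step.
Proof.
move=> F mF tF mUF; rewrite /power_measure_step /pushforward preimage_bigcup.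
apply: measure_semi_sigma_additive.
- by move=> i; rewrite -[X in measurable X]setTI; exact: measurable_tuple_cons.
- apply/trivIsetP => /= i j _ _ ij; rewrite -preimage_setI.
  by move/trivIsetP : tF => /(_ _ _ _ _ ij) ->//; rewrite preimage_set0.
- rewrite -preimage_bigcup -[X in measurable X]setTI.
  exact: measurable_tuple_cons.
Qed.

HB.instance Definition _ := isMeasure.Build _ _ _
  power_measure_step step0 step_ge0 step_sigma_additive.

Let step_sigma_finite : sigma_finite setT power_measure_step.
Proof.
have /sigma_finiteP[F1 [TF1 ndF1 Foo1]] := sigma_finiteT mu.
have /sigma_finiteP[F2 [TF2 ndF2 Foo2]] := sigma_finiteT m.
pose F i := F1 i `*` F2 i.
have FT : setT = \bigcup_i F i.
  rewrite -setXTT TF1 TF2; apply/seteqP; split=> -[x y].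
    move=> [/= [i _ xi] [k _ yk]]; exists (maxn i k) => //; split.
    - by move: x xi; exact/subsetPset/ndF1/leq_maxl.
    - by move: y yk; exact/subsetPset/ndF2/leq_maxr.
  by move=> [i _ []/= ? ?]; split; exists i.
have mF i : measurable (F i) /\ ((mu \x m) (F i) < +oo)%E.
  have [? ?] := Foo1 i; have [? ?] := Foo2 i.
  split; first exact: measurableX.
  by rewrite product_measure1E// lte_mul_pinfty// ge0_fin_numE.
pose uncons (t : n.+1.-tuple T) := (thead t, [tuple of behead t]).
have consK : cancel tuple_cons uncons.
  move=> [x t]; rewrite /uncons /tuple_cons /=; congr pair.
  exact: val_inj.
have muncons : measurable_fun setT uncons.
  apply: measurable_fun_pair; last exact: measurable_behead.
  exact: measurable_tnth.
exists (fun i => uncons @^-1` F i).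
  by rewrite -preimage_bigcup -FT preimage_setT.
move=> i; have [mFi Foo] := mF i; split.
  by rewrite -[X in measurable X]setTI; exact: muncons.
rewrite /power_measure_step /pushforward.
suff -> : tuple_cons @^-1` (uncons @^-1` F i) = F i by [].
by apply/seteqP; split=> u /=; rewrite consK.
Qed.

HB.instance Definition _ := @Measure_isSigmaFinite.Build _ _ _
  power_measure_step step_sigma_finite.

End step.

Fixpoint power_measure (n : nat) :
    {sigma_finite_measure set (n.-tuple T) -> \bar R} :=
  match n with
  | 0 => \d_[tuple]
  | n'.+1 => power_measure_step (power_measure n')
  end.

End power_measure.

Section integration.
Context {R : realType}.
Local Notation C := R[i].

Definition lebesgue_tuple (n : nat) := power_measure (@lebesgue_measure R) n.

Definition row_of_tuple n (t : n.-tuple R) : 'rV[R]_n := \row_i tnth t i.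

Definition cintegral n (f : 'rV[R]_n -> C) : C :=
  (\int[lebesgue_tuple n]_t complex.Re (f (row_of_tuple t))) +i*
  (\int[lebesgue_tuple n]_t complex.Im (f (row_of_tuple t))).

(* Euler's integral; only used for x > 0 *)
Definition Gamma (x : R) : R :=
  \int[lebesgue_measure]_(t in `]0, +oo[%classic) (t `^ (x - 1) * expR (- t)).

Definition cis (t : R) : C := cos t +i* sin t.

(* t ^ s for t > 0 *)
Definition cpow (t : R) (s : C) : C :=
  (t `^ complex.Re s)%:C * cis (complex.Im s * ln t).

Definition sqnorm n (x : 'rV[R]_n) : R := \sum_(i < n) x ord0 i ^+ 2.

Definition rpow n (lam : C) (x : 'rV[R]_n) : C := cpow (sqnorm x) (lam / 2%:R).

Definition dotp n (x y : 'rV[R]_n) : R := \sum_(i < n) x ord0 i * y ord0 i.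

End integration.

Section complex_analysis.
Context {R : realType}.
Local Notation C := R[i].

Definition holomorphic_at (f : C -> C) (z : C) : Prop :=
  \forall w \near (z : C^o), derivable (f : C^o -> C^o) w 1.

Definition entire (f : C -> C) : Prop := forall z, holomorphic_at f z.

(* f has at z0 at most a pole of order m, with principal part
   sum_(j < m) a j / (z - z0) ^ (j + 1) *)
Definition principal_part (f : C -> C) (z0 : C) (m : nat) (a : nat -> C) : Prop :=
  exists2 g : C -> C, holomorphic_at g z0 &
    \forall z \near (z0 : C^o)^', f z = g z + \sum_(j < m) a j / (z - z0) ^+ j.+1.

Definition is_residue (f : C -> C) (z0 c : C) : Prop :=
  exists m a, principal_part f z0 m.+1 a /\ a 0%N = c.

Definition at_most_simple_pole (f : C -> C) (z0 : C) : Prop :=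
  exists a, principal_part f z0 1 a.

End complex_analysis.

Section schwartz.
Context {R : realType} {n : nat}.
Local Notation C := R[i].
Implicit Types (f : 'rV[R]_n -> R) (phi : 'rV[R]_n -> C).

Definition partials (s : seq 'I_n) f : 'rV[R]_n -> R :=
  foldr (fun i g x => 'D_(delta_mx ord0 i) g x) f s.

Definition schwartz_bound (N : nat) (s : seq 'I_n) (K : R) f : Prop :=
  forall x, (1 + sqnorm x) ^+ N * `|partials s f x| <= K.

Definition real_schwartz f : Prop :=
  (forall s x, differentiable (partials s f) x) /\
  (forall N s, exists K, schwartz_bound N s K f).

Definition schwartz phi : Prop :=
  real_schwartz (fun x => complex.Re (phi x)) /\
  real_schwartz (fun x => complex.Im (phi x)).

Definition fourier phi : 'rV[R]_n -> C :=
  fun xi => cintegral (fun x => phi x * cis (dotp x xi)).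

End schwartz.

Section forms.
Context {R : realType} {n : nat}.
Local Notation C := R[i].

(* Complex alternating forms on R^n: w I is the coefficient of w along
   e_{i1} /\ ... /\ e_{ip}, where i1 < ... < ip are the elements of I. *)
Definition cform := {ffun {set 'I_n} -> C^o}.

Definition is_pform (p : nat) (w : cform) : Prop :=
  forall I : {set 'I_n}, #|I| != p -> w I = 0.

(* e_k /\ e_I = wedge_sign k I e_{k |: I} for k \notin I *)
Definition wedge_sign (k : 'I_n) (I : {set 'I_n}) : C :=
  (-1) ^+ #|[pred j in I | (j < k)%N]|.

Definition wedge_basis (k : 'I_n) (w : cform) : cform :=
  [ffun I : {set 'I_n} => if k \in I then wedge_sign k I * w (I :\ k)%SET else 0].

Definition contract_basis (k : 'I_n) (w : cform) : cform :=
  [ffun I : {set 'I_n} => if k \notin I then wedge_sign k I * w (k |: I)%SET else 0].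

Definition ext_mul (x : 'rV[R]_n) (w : cform) : cform :=
  \sum_(k < n) (x ord0 k)%:C *: wedge_basis k w.

Definition int_mul (x : 'rV[R]_n) (w : cform) : cform :=
  \sum_(k < n) (x ord0 k)%:C *: contract_basis k w.

Definition int_ext (x : 'rV[R]_n) (w : cform) : cform := int_mul x (ext_mul x w).
Definition ext_int (x : 'rV[R]_n) (w : cform) : cform := ext_mul x (int_mul x w).

(* k-th power of T x, for T one of int_ext and ext_int. Since
   T x \o T x = |x|^2 T x, T x is |x|^2 times the projection |x|^-2 T x. The
   0-th power is this projection and not the identity: so (ext_int x)^0 = 0 on
   0-forms, and (int_ext x)^0 + (ext_int x)^0 = id for x != 0. *)
Definition endo_pow (T : 'rV[R]_n -> cform -> cform) (k : nat)
    (x : 'rV[R]_n) (w : cform) : cform :=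
  if k is 0 then ((sqnorm x)^-1)%:C *: T x w else iter k (T x) w.

End forms.
Arguments cform : clear implicits.

Section distributions.
Context {R : realType} {n : nat}.
Local Notation C := R[i].
Local Notation cform := (cform R n).

(* Distributions with values in the endomorphisms of forms. Only the values at
   Schwartz functions are meaningful. *)
Definition form_dist := ('rV[R]_n -> C) -> cform -> cform.

Definition is_tempered (p : nat) (T : form_dist) : Prop :=
  [/\ forall phi w, schwartz phi -> is_pform p w -> is_pform p (T phi w),
      forall phi a w v, schwartz phi -> is_pform p w -> is_pform p v ->
        T phi (a *: w + v) = a *: T phi w + T phi v,
      forall a phi psi w, schwartz phi -> schwartz psi -> is_pform p w ->
        T (fun x => a * phi x + psi x) w = a *: T phi w + T psi w &
      forall w, is_pform p w -> exists N (M : R), forall phi (K : R),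
        schwartz phi ->
        (forall s : seq 'I_n, (size s <= N)%N ->
          schwartz_bound N s K (fun x => complex.Re (phi x)) /\
          schwartz_bound N s K (fun x => complex.Im (phi x))) ->
        forall I, `|T phi w I| <= (M * K)%:C].

Definition regular_dist (F : 'rV[R]_n -> cform -> cform) : form_dist :=
  fun phi w => [ffun I : {set 'I_n} =>
    cintegral (fun x => F x w I * phi x)].

Definition fourier_dist (T : form_dist) : form_dist :=
  fun phi => T (fourier phi).

Definition riesz_fun (mu a b : C) (x : 'rV[R]_n) (w : cform) : cform :=
  rpow (mu - 2%:R) x *: (a *: int_ext x w + b *: ext_int x w).

Definition riesz_pole (k : nat) : C := - n%:R - 2%:R * k%:R.

(* T is the meromorphic family, with at most simple poles at -n - 2N, of
   tempered distributions acting on p-forms which extends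
   riesz_fun lam (A lam) (B lam) from the half-plane Re lam > -n. The values of
   T at the poles are unconstrained. *)
Definition is_riesz_family (p : nat) (A B : C -> C) (T : C -> form_dist) : Prop :=
  [/\ forall lam, (forall k, lam <> riesz_pole k) -> is_tempered p (T lam),
      forall lam phi w, - n%:R < complex.Re lam -> schwartz phi -> is_pform p w ->
        T lam phi w = regular_dist (riesz_fun lam (A lam) (B lam)) phi w,
      forall phi w I lam, schwartz phi -> is_pform p w ->
        (forall k, lam <> riesz_pole k) ->
        holomorphic_at (fun z => T z phi w I) lam &
      forall phi w I k, schwartz phi -> is_pform p w ->
        at_most_simple_pole (fun z => T z phi w I) (riesz_pole k)].

(* On p-forms, U is the residue at z0 of the family T. *)
Definition is_dist_residue (p : nat) (T : C -> form_dist) (z0 : C)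
    (U : form_dist) : Prop :=
  forall phi w I, schwartz phi -> is_pform p w ->
    is_residue (fun z => T z phi w I) z0 (U phi w I).

End distributions.
Arguments form_dist : clear implicits.
Arguments riesz_pole : clear implicits.

Section coefficients.
Context {R : realType}.
Local Notation C := R[i].

Definition riesz_C (p : nat) (A B : C -> C) (lam : C) : C :=
  (lam + p%:R) * A lam - p%:R * B lam.

Definition riesz_D (n p : nat) (A B : C -> C) (lam : C) : C :=
  - (n%:R - p%:R) * A lam + (lam + n%:R - p%:R) * B lam.

Definition res_factor (n k : nat) : R :=
  (-1) ^+ k.+1 * pi `^ (n%:R / 2%:R) /
  (4%:R ^+ k * k`!%:R * Gamma ((n + 2 * k + 2)%N%:R / 2%:R)).

End coefficients.

(* Main.v *)
Require Import Defs.
From HB Require Import structures.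
From mathcomp Require Import all_boot all_order all_algebra.
From mathcomp Require Import complex.
From mathcomp Require Import all_classical all_reals all_analysis.
From mathcomp Require Import measurable_realfun.
From mathcomp Require Import ring lra.
Set Implicit Arguments.
Unset Strict Implicit.
Unset Printing Implicit Defensive.
Import Order.TTheory GRing.Theory Num.Theory.
Import numFieldNormedType.Exports.
Local Open Scope classical_set_scope.
Local Open Scope complex_scope.
Local Open Scope ring_scope.
Import Normc.

(* Fourier transform moves to the test function: with psi the transform of phi,
   the pairing at lambda is a combination of integrals of
   |x|^(lambda-2) x_i x_j psi(x), and x_i x_j psi is the transform of
   chi = - d_i d_j phi. Put s = 1 - lambda/2. Inserting
   Gamma(s) |x|^(-2s) = int_0^oo t^(s-1) exp(-t |x|^2) dt and transforming the
   Gaussian, Gamma(s) times such an integral becomes the Mellin transform of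
     t |-> (pi/t)^(n/2) int chi(x) exp(-|x|^2/4t) dx.
   The part t <= 1 is holomorphic for Re s > 0; on t > 1 the Taylor expansion of
   the exponential in 1/t yields simple poles in s with residues proportional to the moments
   int chi(x) |x|^(2m) dx. This continues the pairing beyond the half-plane
   Re lambda > -n, and it agrees with the given meromorphic family by the
   identity theorem. Two integrations by parts turn the moments of chi into
   integrals of phi against |x|^(2k) delta_ij and |x|^(2k-2) x_i x_j, and the
   anticommutation relations identify the resulting combination. *)

(** The obstacle is the passage from Re lambda > -n to lambda = -n - 2k across poles lying on the
    real axis. The difference of the two continuations is shown to vanish where Im lambda > 0; after
    multiplication by lambda - pole both are regular at the pole and are compared there by
    continuity from above. The complex analysis behind this is Goursat on rectangles, the mean value
    over circles and a maximum principle. For fixed w and I the I-coefficients of i_x eps_x w and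
    eps_x i_x w are quadratic forms in x, which reduces everything to scalar integrals. Their traces
    count the indices outside and inside I and give the n-p and p of C and D; the other moment term
    supplies the 2k by which the pole differs from -n. The splitting |x|^2 w = i_x eps_x w + eps_x
    i_x w merges both terms into C and D at the pole, while C and D at -n only cancel the
    coefficients of R^0. In the constant, 1/Gamma is carried over from the other side of the Mellin
    identity, (-1/4)^(k+1)/(k+1)! comes from the exponential series, 2(k+1) from the first
    integration by parts, and s = 1 - lambda/2 turns a pole coefficient c in s into the residue -2c
    in lambda. *)

Local Notation Re := complex.Re.
Local Notation Im := complex.Im.

(** * Complex numbers and complex-valued integrals *)

Section complex_numbers.
Context {R : realType}.
Local Notation C := R[i].
Implicit Types (x y z : C) (a b t : R).

Lemma complex_eq x y : Re x = Re y -> Im x = Im y -> x = y.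
Proof. by case: x => a b; case: y => c d /= -> ->. Qed.

Lemma ReD x y : Re (x + y) = Re x + Re y.
Proof. by case: x => a b; case: y => c d. Qed.

Lemma ImD x y : Im (x + y) = Im x + Im y.
Proof. by case: x => a b; case: y => c d. Qed.

Lemma ReN x : Re (- x) = - Re x.
Proof. by case: x. Qed.

Lemma ImN x : Im (- x) = - Im x.
Proof. by case: x. Qed.

Lemma ReM x y : Re (x * y) = Re x * Re y - Im x * Im y.
Proof. by case: x => a b; case: y => c d. Qed.

Lemma ImM x y : Im (x * y) = Re x * Im y + Im x * Re y.
Proof. by case: x => a b; case: y => c d /=. Qed.

Lemma ReB x y : Re (x - y) = Re x - Re y.
Proof. by rewrite ReD ReN. Qed.

Lemma ImB x y : Im (x - y) = Im x - Im y.
Proof. by rewrite ImD ImN. Qed.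

Lemma Re_sum (I : Type) (r : seq I) (P : pred I) (F : I -> C) :
  Re (\sum_(i <- r | P i) F i) = \sum_(i <- r | P i) Re (F i).
Proof. by elim/big_rec2: _ => // i a b _ <-; rewrite ReD. Qed.

Definition reim := (ReB, ImB, ReD, ImD, ReN, ImN, ReM, ImM).

Lemma natrC (k : nat) : (k%:R : C) = (k%:R : R)%:C.
Proof. by rewrite rmorph_nat. Qed.

Lemma Re_natr (k : nat) : Re (k%:R : C) = k%:R.
Proof. by rewrite natrC. Qed.

Lemma Im_natr (k : nat) : Im (k%:R : C) = 0.
Proof. by rewrite natrC. Qed.

Lemma normcD x y : normc (x + y) <= normc x + normc y.
Proof. exact: le_normcD. Qed.

Lemma normcB x y : normc (x - y) <= normc x + normc y.
Proof. by rewrite -[normc y]normcN; exact: normcD. Qed.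

Lemma normcBC x y : normc (x - y) = normc (y - x).
Proof. by rewrite -normcN opprB. Qed.

Lemma normc_triangle x y z : normc (x - z) <= normc (x - y) + normc (y - z).
Proof. by rewrite -[x - z](subrKA y); exact: normcD. Qed.

Lemma normc_ge0 z : 0 <= normc z.
Proof. by case: z => a b /=; exact: sqrtr_ge0. Qed.

Lemma normc_gt0 z : (0 < normc z) = (z != 0).
Proof.
rewrite lt_neqAle normc_ge0 andbT eq_sym; congr negb.
apply/eqP/eqP; first exact: eq0_normc.
by move=> ->; exact: normc0.
Qed.

Lemma normc_real a : normc a%:C = `|a|.
Proof. by rewrite /= expr0n addr0 sqrtr_sqr. Qed.

Lemma normcX z n : normc (z ^+ n) = normc z ^+ n.
Proof.
elim: n => [|n ih]; first exact: normc1.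
by rewrite !exprS normcM ih.
Qed.

Lemma normc_nat (n : nat) : normc (n%:R : C) = n%:R.
Proof. by rewrite natrC normc_real ger0_norm. Qed.

Lemma normcE z : `|z| = (normc z)%:C.
Proof. by case: z. Qed.

Lemma sqr_normcE z : normc z ^+ 2 = Re z ^+ 2 + Im z ^+ 2.
Proof. by case: z => a b /=; rewrite sqr_sqrtr// addr_ge0 ?sqr_ge0. Qed.

Lemma ler_Re_normc z : `|Re z| <= normc z.
Proof.
rewrite -(@ler_pXn2r _ 2)// ?nnegrE ?normr_ge0 ?normc_ge0//.
by rewrite sqr_normcE real_normK ?num_real// lerDl sqr_ge0.
Qed.

Lemma ler_Im_normc z : `|Im z| <= normc z.
Proof.
rewrite -(@ler_pXn2r _ 2)// ?nnegrE ?normr_ge0 ?normc_ge0//.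
by rewrite sqr_normcE real_normK ?num_real// lerDr sqr_ge0.
Qed.

Lemma normc_i a : normc (0 +i* a) = `|a|.
Proof. by rewrite /= expr0n add0r sqrtr_sqr. Qed.

Lemma complex_ReIm z : z = (Re z)%:C + (0 +i* Im z).
Proof. by apply: complex_eq; rewrite reim /= ?addr0 ?add0r. Qed.

Lemma ler_normc_ReIm z : normc z <= `|Re z| + `|Im z|.
Proof.
rewrite {1}(complex_ReIm z); apply: (le_trans (normcD _ _)).
by rewrite normc_real normc_i.
Qed.

(** Replaces passages to the limit: derivatives, circle means and Laplace transforms are identified
    below by bounding an error by a fixed multiple of every e > 0. *)
Lemma normc_le_ball z a : 0 <= a -> (forall e, 0 < e -> normc z <= a * e) -> z = 0.
Proof.
move=> a0 h; apply: eq0_normc; apply/eqP; rewrite eq_le normc_ge0 andbT.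
apply/ler_addgt0Pr => e e0; rewrite add0r.
have a1 : 0 < a + 1 by rewrite ltr_wpDl.
apply: (le_trans (h (e / (a + 1)) _)); first exact: divr_gt0.
by rewrite mulrA ler_pdivrMr//; nra.
Qed.

(** The endpoints come in either order because the Taylor estimates are needed on both sides of 0.
    The bound on |c - a| lets a first-order estimate at c be fed into a second-order one. *)
Lemma mean_value_any (f df : R -> R) a b : (forall t, is_derive t 1 f (df t)) ->
  exists c, [/\ `|c - a| <= `|b - a|, (a <= c <= b) || (b <= c <= a) &
    f b - f a = df c * (b - a)].
Proof.
move=> h; have cf u v : {within `[u, v], continuous f}.
  by apply: derivable_within_continuous => t _; have [] := h t.
have [ab|/ltW ba] := leP a b.
  have [c + E] := MVT_segment ab (fun t _ => h t) (cf a b).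
  rewrite in_itv /= => /andP[ac cb]; exists c; split => //; last by rewrite ac cb.
  by rewrite !ger0_norm ?subr_ge0// lerD2r.
have [c + E] := MVT_segment ba (fun t _ => h t) (cf b a).
rewrite in_itv /= => /andP[ac cb]; exists c; split.
- by rewrite !ler0_norm ?subr_le0// lerN2 lerD2r.
- by rewrite ac cb orbT.
by rewrite -[LHS]opprB E -mulrN opprB.
Qed.

Lemma ler_norm_sin t : `|sin t| <= `|t|.
Proof.
have [c [_ _]] := @mean_value_any sin cos 0 t (fun t => is_derive_sin t).
rewrite sin0 !subr0 => ->; rewrite normrM ler_piMl//.
by rewrite ler_norml cos_geN1 cos_le1.
Qed.

Lemma ler_norm_cosB1 t : `|cos t - 1| <= t ^+ 2.
Proof.
have [c [ct _]] := @mean_value_any cos (fun t => - sin t) 0 t (fun t => is_derive_cos t).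
rewrite cos0 => ->; move: ct; rewrite !subr0 => ct.
rewrite normrM normrN -(real_normK (num_real t)) expr2.
by rewrite ler_wpM2r// (le_trans (ler_norm_sin c)).
Qed.

Lemma ler_norm_cosB1_lin t : `|cos t - 1| <= `|t|.
Proof.
have [c [ct _]] := @mean_value_any cos (fun t => - sin t) 0 t (fun t => is_derive_cos t).
rewrite cos0 => ->; rewrite subr0 normrM normrN ler_piMl//.
by rewrite ler_norml sin_geN1 sin_le1.
Qed.

Lemma ler_norm_sinB t : `|sin t - t| <= t ^+ 2.
Proof.
have [c [ct _]] := @mean_value_any (sin \- id) (cos \- cst 1) 0 t
  (fun t => is_deriveB (is_derive_sin t) (is_derive_id t 1)).
rewrite /= sin0 !subr0 => ->; move: ct; rewrite !subr0 => ct.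
rewrite normrM -(real_normK (num_real t)) expr2.
by rewrite ler_wpM2r// (le_trans (ler_norm_cosB1_lin c)).
Qed.

Lemma expR_le_norm a b : `|a| <= `|b| -> expR a <= expR `|b|.
Proof. by move=> ab; rewrite ler_expR (le_trans (ler_norm a)). Qed.

Lemma ler_norm_expRB1 t : `|expR t - 1| <= `|t| * expR `|t|.
Proof.
have [c [ct _]] := @mean_value_any expR expR 0 t (fun t => is_derive_expR t).
rewrite expR0 => ->; move: ct; rewrite !subr0 => ct.
rewrite normrM mulrC ler_wpM2l// ger0_norm ?expR_ge0//.
exact: expR_le_norm.
Qed.

Lemma ler_norm_expRB2 t : `|expR t - 1 - t| <= t ^+ 2 * expR `|t|.
Proof.
have [c [ct _]] := @mean_value_any (expR \- id) (expR \- cst 1) 0 t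
  (fun t => is_deriveB (is_derive_expR t) (is_derive_id t 1)).
rewrite /= expR0 !subr0 => E; rewrite (_ : _ - _ - _ = expR t - t - 1); last lra.
rewrite E; move: ct; rewrite !subr0 => ct.
rewrite normrM -(real_normK (num_real t)) expr2 -mulrA mulrC ler_wpM2l//.
apply: (le_trans (ler_norm_expRB1 c)); rewrite ler_pM ?expR_ge0//.
by rewrite ler_expR.
Qed.

Lemma cisD a b : cis (a + b) = cis a * cis b :> C.
Proof.
apply: complex_eq; rewrite ?reim /=; first by rewrite cosD.
by rewrite sinD addrC mulrC [X in _ + X]mulrC mulrC; congr (_ + _); rewrite mulrC.
Qed.

Lemma cis0 : cis 0 = 1 :> C.
Proof. by rewrite /cis cos0 sin0. Qed.

Lemma normc_cis a : normc (cis a : C) = 1.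
Proof. by rewrite /= cos2Dsin2 sqrtr1. Qed.

Lemma normc_cisB2 a : normc (cis a - 1 - (0 +i* a) : C) <= 2 * a ^+ 2.
Proof.
apply: (le_trans (ler_normc_ReIm _)); rewrite !reim /= !subr0.
by rewrite mulr2n mulrDl mul1r lerD ?ler_norm_sinB ?ler_norm_cosB1.
Qed.

Definition cexp z : C := (expR (Re z))%:C * cis (Im z).

Lemma cexpD x y : cexp (x + y) = cexp x * cexp y.
Proof.
rewrite /cexp !reim expRD cisD rmorphM /=.
by rewrite -!mulrA; congr (_ * _); rewrite mulrCA.
Qed.

Lemma cexp0 : cexp 0 = 1.
Proof. by rewrite /cexp /= expR0 cis0 mulr1. Qed.

Lemma cexp_real a : cexp a%:C = (expR a)%:C.
Proof. by rewrite /cexp /= cis0 mulr1. Qed.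

Lemma normc_cexp z : normc (cexp z) = expR (Re z).
Proof. by rewrite /cexp normcM normc_cis mulr1 normc_real ger0_norm ?expR_ge0. Qed.

Lemma cexp_neq0 z : cexp z != 0.
Proof. by rewrite -normc_gt0 normc_cexp expR_gt0. Qed.

Lemma cexpN z : cexp (- z) = (cexp z)^-1.
Proof.
by apply: (mulfI (cexp_neq0 z)); rewrite -cexpD subrr cexp0 mulfV// cexp_neq0.
Qed.

(** With z = a + ib the remainder splits into exp(a) (cis b - 1 - ib), exp(a) - 1 - a and (exp(a) -
    1) ib; these contribute 2, 1 and 1 to the constant 4. *)
Lemma ler_cexpB2 z : normc (cexp z - 1 - z) <= 4 * normc z ^+ 2 * expR (normc z).
Proof.
set a := Re z; set b := Im z; set N := normc z.
have E : cexp z - 1 - z = (expR a)%:C * (cis b - 1 - (0 +i* b)) +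
    ((expR a - 1 - a)%:C + (expR a - 1)%:C * (0 +i* b)).
  rewrite /cexp {3}(complex_ReIm z) -/a -/b !rmorphB /= rmorph1; ring.
have aN : `|a| <= N by exact: ler_Re_normc.
have bN : `|b| <= N by exact: ler_Im_normc.
have N0 : 0 <= N by exact: normc_ge0.
have eN : expR `|a| <= expR N by rewrite ler_expR.
have eN0 : 0 <= expR N by exact: expR_ge0.
have sqN u : `|u| <= N -> u ^+ 2 <= N ^+ 2.
  by move=> uN; rewrite -(real_normK (num_real u)) ler_pXn2r.
rewrite E; apply: (le_trans (normcD _ _)).
rewrite (_ : 4 * N ^+ 2 * expR N = expR N * (2 * N ^+ 2) + (N ^+ 2 * expR N + N * expR N * N)); last ring.
apply: lerD.
  rewrite normcM normc_real ger0_norm ?expR_ge0// ler_pM ?normc_ge0 ?expR_ge0//.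
    by rewrite (le_trans _ eN)// ler_expR ler_norm.
  by apply: (le_trans (normc_cisB2 _)); rewrite ler_pM2l// sqN.
apply: (le_trans (normcD _ _)); apply: lerD.
  rewrite normc_real (le_trans (ler_norm_expRB2 _))// ler_pM ?sqr_ge0 ?expR_ge0//.
  exact: sqN.
rewrite normcM normc_real normc_i ler_pM//.
by rewrite (le_trans (ler_norm_expRB1 _))// ler_pM ?expR_ge0.
Qed.

End complex_numbers.

Section real_integral.
Context d (T : measurableType d) {R : realType}.
Variable mu : {measure set T -> \bar R}.
Implicit Types f g : T -> R.

Lemma integrable_dom f g : measurable_fun setT f ->
  mu.-integrable setT (EFin \o g) -> (forall x, `|f x| <= g x) ->
  mu.-integrable setT (EFin \o f).
Proof.
move=> mf ig fg; apply: (le_integrable measurableT _ _ ig).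
  exact/measurable_EFinP.
by move=> x _; rewrite /= lee_fin (le_trans (fg x))// ler_norm.
Qed.

Lemma EFin_Rintegral f : mu.-integrable setT (EFin \o f) ->
  (\int[mu]_x f x)%:E = (\int[mu]_x (f x)%:E)%E.
Proof. by move=> h; rewrite /Rintegral fineK//; exact: integrable_fin_num. Qed.

Lemma integrable_measurable f : mu.-integrable setT (EFin \o f) ->
  measurable_fun setT f.
Proof. by move=> /integrableP[/measurable_EFinP]. Qed.

End real_integral.

Section real_fubini.
Context d1 d2 (T1 : measurableType d1) (T2 : measurableType d2) {R : realType}.
Variables (m1 : {sigma_finite_measure set T1 -> \bar R})
  (m2 : {sigma_finite_measure set T2 -> \bar R}).
Variable f : T1 * T2 -> R.

(** Tonelli's criterion. The sections must be integrable for the bound by h to be informative, since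
    [Rintegral] takes the value 0 when the integral is infinite. *)
Lemma integrable_prod_dom h : measurable_fun setT f ->
  (forall x, m2.-integrable setT (fun y => (f (x, y))%:E)) ->
  (forall x, \int[m2]_y `|f (x, y)| <= h x) -> m1.-integrable setT (EFin \o h) ->
  (m1 \x m2)%E.-integrable setT (EFin \o f).
Proof.
move=> mf i2 fh ih; apply/integrable12ltyP; first exact/measurable_EFinP.
have mh := integrable_measurable ih.
have mn : measurable_fun setT (fun z => `|f z|%:E).
  by apply/measurable_EFinP; exact: measurableT_comp.
apply: (@le_lt_trans _ _ (\int[m1]_x (h x)%:E)%E); last first.
  by have := integrable_fin_num measurableT ih; rewrite fin_numE => /andP[_]; rewrite lt_neqAle leey => ->.
apply: ge0_le_integral => //=.
- by move=> x _; apply: integral_ge0 => y _; rewrite lee_fin.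
- apply: (@measurable_fun_fubini_tonelli_F _ _ _ _ _ m2 (fun z => `|f z|%:E)) => //.
- exact/measurable_EFinP.
- move=> x _; rewrite -[X in (X <= _)%E]fineK ?lee_fin; first exact: fh.
  by apply: integrable_fin_num => //; exact: (integrable_norm (i2 x)).
Qed.

Hypothesis fi : (m1 \x m2)%E.-integrable setT (EFin \o f).

Lemma measurable_Rintegral2 :
  measurable_fun setT (fun y => \int[m1]_x f (x, y)).
Proof. by apply: (measurableT_comp (f := fine)) => //; exact: (measurable_fubini_G fi). Qed.

Lemma Rintegral_prod1 : (forall x, m2.-integrable setT (fun y => (f (x, y))%:E)) ->
  \int[(m1 \x m2)%E]_z f z = \int[m1]_x \int[m2]_y f (x, y).
Proof.
move=> i2; rewrite {1}/Rintegral -(integral12_prod_meas1 fi) /Rintegral.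
congr fine; apply: eq_integral => x _.
by rewrite fineK//; apply: integrable_fin_num => //; exact: i2.
Qed.

Lemma Rintegral_prod2 : (forall y, m1.-integrable setT (fun x => (f (x, y))%:E)) ->
  \int[(m1 \x m2)%E]_z f z = \int[m2]_y \int[m1]_x f (x, y).
Proof.
move=> i1; rewrite {1}/Rintegral -(integral21_prod_meas1 fi) /Rintegral.
congr fine; apply: eq_integral => y _.
by rewrite fineK//; apply: integrable_fin_num => //; exact: i1.
Qed.

Lemma integrable_Rintegral1 : (forall x, m2.-integrable setT (fun y => (f (x, y))%:E)) ->
  m1.-integrable setT (EFin \o (fun x => \int[m2]_y f (x, y))).
Proof.
move=> i2; rewrite (_ : _ \o _ = fubini_F m2 (EFin \o f)).
  exact: (integrable_fubini_F fi).
by apply/funext => x; exact: EFin_Rintegral (i2 x).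
Qed.

End real_fubini.

Section complex_measurable.
Context d (T : measurableType d) {R : realType}.
Local Notation C := R[i].
Implicit Types f g : T -> C.

Definition cmeasurable f :=
  measurable_fun setT (fun x => Re (f x)) /\ measurable_fun setT (fun x => Im (f x)).

Lemma cmeasurable_cst c : cmeasurable (fun _ => c).
Proof. by split; exact: measurable_cst. Qed.

Lemma cmeasurableD f g : cmeasurable f -> cmeasurable g ->
  cmeasurable (fun x => f x + g x).
Proof.
move=> [f1 f2] [g1 g2]; split.
  by under eq_fun do rewrite ReD; exact: measurable_funD.
by under eq_fun do rewrite ImD; exact: measurable_funD.
Qed.

Lemma cmeasurableM f g : cmeasurable f -> cmeasurable g ->
  cmeasurable (fun x => f x * g x).
Proof.
move=> [f1 f2] [g1 g2]; split.
  under eq_fun do rewrite ReM.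
  by apply: measurable_funB; exact: measurable_funM.
under eq_fun do rewrite ImM.
by apply: measurable_funD; exact: measurable_funM.
Qed.

Lemma cmeasurableN f : cmeasurable f -> cmeasurable (fun x => - f x).
Proof.
move=> mf; under eq_fun do rewrite -mulN1r.
by apply: cmeasurableM => //; exact: cmeasurable_cst.
Qed.

Lemma cmeasurableB f g : cmeasurable f -> cmeasurable g ->
  cmeasurable (fun x => f x - g x).
Proof. by move=> mf mg; apply: cmeasurableD => //; exact: cmeasurableN. Qed.

Lemma cmeasurable_real (h : T -> R) : measurable_fun setT h ->
  cmeasurable (fun x => (h x)%:C).
Proof. by move=> mh; split => //=; exact: measurable_cst. Qed.

Lemma cmeasurable_cis (h : T -> R) : measurable_fun setT h ->
  cmeasurable (fun x => cis (h x)).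
Proof.
move=> mh; split => /=.
  apply: (measurableT_comp (f := cos)) => //; apply: continuous_measurable_fun.
  exact: continuous_cos.
apply: (measurableT_comp (f := sin)) => //; apply: continuous_measurable_fun.
exact: continuous_sin.
Qed.

Lemma cmeasurable_cexp f : cmeasurable f -> cmeasurable (fun x => cexp (f x)).
Proof.
move=> [f1 f2]; apply: cmeasurableM; last exact: cmeasurable_cis.
by apply: cmeasurable_real; apply: measurableT_comp => //; exact: measurable_expR.
Qed.

Lemma cmeasurable_sum (I : Type) (s : seq I) (F : I -> T -> C) :
  (forall i, cmeasurable (F i)) -> cmeasurable (fun x => \sum_(i <- s) F i x).
Proof.
move=> h; elim: s => [|i s ih].
  by under eq_fun do rewrite big_nil; exact: cmeasurable_cst.
by under eq_fun do rewrite big_cons; exact: cmeasurableD.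
Qed.

Lemma measurable_normc f : cmeasurable f -> measurable_fun setT (fun x => normc (f x)).
Proof.
move=> [f1 f2].
have -> : (fun x => normc (f x)) = fun x => Num.sqrt (Re (f x) ^+ 2 + Im (f x) ^+ 2).
  by apply/funext => x; case: (f x).
apply: (measurableT_comp (f := (@Num.sqrt R : R -> R))).
  by apply: continuous_measurable_fun; exact: sqrt_continuous.
by apply: measurable_funD; exact: measurable_funX.
Qed.

End complex_measurable.

Lemma cmeasurable_comp d1 d2 (T1 : measurableType d1) (T2 : measurableType d2)
  (R : realType) (f : T2 -> R[i]) (h : T1 -> T2) :
  cmeasurable f -> measurable_fun setT h -> cmeasurable (f \o h).
Proof. by move=> [f1 f2] mh; split; [exact: (measurableT_comp f1 mh)|exact: (measurableT_comp f2 mh)]. Qed.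

Section complex_integral.
Context d (T : measurableType d) {R : realType}.
Local Notation C := R[i].
Variable mu : {measure set T -> \bar R}.
Implicit Types f g : T -> C.

Definition cintegrable f :=
  mu.-integrable setT (fun x => (Re (f x))%:E) /\
  mu.-integrable setT (fun x => (Im (f x))%:E).

Definition cint f : C := (\int[mu]_x Re (f x)) +i* (\int[mu]_x Im (f x)).

Lemma cintegrable_measurable f : cintegrable f -> cmeasurable f.
Proof. by move=> [h1 h2]; split; exact: (integrable_measurable (mu := mu)). Qed.

Lemma cintegrable_dom f (g : T -> R) : cmeasurable f ->
  mu.-integrable setT (EFin \o g) -> (forall x, normc (f x) <= g x) -> cintegrable f.
Proof.
move=> [f1 f2] ig fg; split; apply: (integrable_dom _ ig) => // x.
  exact: (le_trans (ler_Re_normc _)).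
exact: (le_trans (ler_Im_normc _)).
Qed.

Lemma cintegrable_normc f : cintegrable f ->
  mu.-integrable setT (EFin \o (fun x => normc (f x))).
Proof.
move=> fi; have [f1 f2] := fi.
apply: (@integrable_dom _ _ _ _ _ (fun x => `|Re (f x)| + `|Im (f x)|)).
- exact: measurable_normc (cintegrable_measurable fi).
- rewrite (_ : _ \o _ = (fun x => (`|(Re (f x))%:E| + `|(Im (f x))%:E|)%E)).
    by apply: integrableD => //; exact: integrable_norm.
  by apply/funext => x /=; rewrite EFinD.
- by move=> x; rewrite ger0_norm ?normc_ge0//; exact: ler_normc_ReIm.
Qed.

Lemma cintegrableD f g : cintegrable f -> cintegrable g ->
  cintegrable (fun x => f x + g x).
Proof.
move=> [f1 f2] [g1 g2]; split.
  by under eq_fun do rewrite ReD EFinD; exact: integrableD.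
by under eq_fun do rewrite ImD EFinD; exact: integrableD.
Qed.

Lemma cintD f g : cintegrable f -> cintegrable g ->
  cint (fun x => f x + g x) = cint f + cint g.
Proof.
move=> [f1 f2] [g1 g2]; apply: complex_eq => /=.
  rewrite -RintegralD//; apply: eq_Rintegral => x _; exact: ReD.
rewrite -RintegralD//; apply: eq_Rintegral => x _; exact: ImD.
Qed.

Lemma cintegrableZ c f : cintegrable f -> cintegrable (fun x => c * f x).
Proof.
move=> fi; have mf := cintegrable_measurable fi.
apply: (@cintegrable_dom _ (fun x => normc c * normc (f x))).
- by apply: cmeasurableM => //; exact: cmeasurable_cst.
- rewrite (_ : _ \o _ = (fun x => (normc c)%:E * (normc (f x))%:E)%E).
    by apply: integrableZl => //; exact: cintegrable_normc.
  by apply/funext => x /=; rewrite EFinM.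
- by move=> x; rewrite normcM.
Qed.

Lemma cintZ c f : cintegrable f -> cint (fun x => c * f x) = c * cint f.
Proof.
move=> [f1 f2].
have iZ a (h : T -> R) : mu.-integrable setT (EFin \o h) ->
    mu.-integrable setT (EFin \o (fun x => a * h x)).
  move=> ih; rewrite (_ : _ \o _ = (fun x => a%:E * (h x)%:E)%E).
    exact: integrableZl.
  by apply/funext => x /=; rewrite EFinM.
apply: complex_eq; rewrite reim /=.
  rewrite -!RintegralZl// -RintegralB//; [|exact: iZ..].
  by apply: eq_Rintegral => x _; rewrite ReM.
rewrite -!RintegralZl// -RintegralD//; [|exact: iZ..].
by apply: eq_Rintegral => x _; rewrite ImM.
Qed.

Lemma cintegrableN f : cintegrable f -> cintegrable (fun x => - f x).
Proof. by move=> fi; under eq_fun do rewrite -mulN1r; exact: cintegrableZ. Qed.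

Lemma cintegrableB f g : cintegrable f -> cintegrable g ->
  cintegrable (fun x => f x - g x).
Proof. by move=> fi gi; apply: cintegrableD => //; exact: cintegrableN. Qed.

Lemma cintN f : cintegrable f -> cint (fun x => - f x) = - cint f.
Proof.
by move=> fi; rewrite -mulN1r -cintZ//; congr cint; apply/funext => x; rewrite mulN1r.
Qed.

Lemma cintB f g : cintegrable f -> cintegrable g ->
  cint (fun x => f x - g x) = cint f - cint g.
Proof. by move=> fi gi; rewrite cintD ?cintN//; exact: cintegrableN. Qed.

Lemma eq_cint f g : f =1 g -> cint f = cint g.
Proof. by move=> /funext ->. Qed.

Lemma cint0 : cint (fun=> 0) = 0.
Proof. by rewrite /cint /= /Rintegral integral0. Qed.

Lemma cintegrable0 : cintegrable (fun=> 0).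
Proof. by split; exact: integrable0. Qed.

Lemma cintegrable_sum (I : Type) (s : seq I) (F : I -> T -> C) :
  (forall i, cintegrable (F i)) -> cintegrable (fun x => \sum_(i <- s) F i x).
Proof.
move=> h; elim: s => [|i s ih].
  by under eq_fun do rewrite big_nil; exact: cintegrable0.
by under eq_fun do rewrite big_cons; exact: cintegrableD.
Qed.

Lemma cint_sum (I : Type) (s : seq I) (F : I -> T -> C) :
  (forall i, cintegrable (F i)) ->
  cint (fun x => \sum_(i <- s) F i x) = \sum_(i <- s) cint (F i).
Proof.
move=> h; elim: s => [|i s ih].
  by rewrite big_nil (eq_cint (g := fun=> 0)) ?cint0// => x; rewrite big_nil.
rewrite big_cons -ih -cintD//; last exact: cintegrable_sum.
by apply: eq_cint => x; rewrite big_cons.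
Qed.

Lemma cint_real (h : T -> R) : cint (fun x => (h x)%:C) = (\int[mu]_x h x)%:C.
Proof. by apply: complex_eq => //=; rewrite /Rintegral integral0. Qed.

Lemma cintegrable_real (h : T -> R) : mu.-integrable setT (EFin \o h) ->
  cintegrable (fun x => (h x)%:C).
Proof. by move=> ih; split => //=; exact: integrable0. Qed.

(* Estimating the real and imaginary parts separately costs the factor 2. *)
Lemma normc_cint_le f (g : T -> R) : cintegrable f ->
  mu.-integrable setT (EFin \o g) -> (forall x, normc (f x) <= g x) ->
  normc (cint f) <= 2 * \int[mu]_x g x.
Proof.
move=> [f1 f2] ig fg; apply: (le_trans (ler_normc_ReIm _)).
rewrite mulr2n mulrDl mul1r /=; apply: lerD.
  apply: (le_trans (le_normr_Rintegral _ f1)) => //; apply: le_Rintegral => //.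
    exact: (integrable_norm f1).
  by move=> x _; exact: (le_trans (ler_Re_normc _)).
apply: (le_trans (le_normr_Rintegral _ f2)) => //; apply: le_Rintegral => //.
  exact: (integrable_norm f2).
by move=> x _; exact: (le_trans (ler_Im_normc _)).
Qed.

End complex_integral.

Section complex_fubini.
Context d1 d2 (T1 : measurableType d1) (T2 : measurableType d2) {R : realType}.
Variables (m1 : {sigma_finite_measure set T1 -> \bar R})
  (m2 : {sigma_finite_measure set T2 -> \bar R}).
Variable f : T1 * T2 -> R[i].

Lemma cintegrable_prod_dom h : cmeasurable f ->
  (forall x, cintegrable m2 (fun y => f (x, y))) ->
  (forall x, \int[m2]_y normc (f (x, y)) <= h x) -> m1.-integrable setT (EFin \o h) ->
  cintegrable (m1 \x m2)%E f.
Proof.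
move=> mf i2 fh ih.
apply: (@cintegrable_dom _ _ _ _ _ (fun z => normc (f z))) => //.
apply: (@integrable_prod_dom _ _ _ _ _ _ _ _ h) => //.
- exact: measurable_normc.
- by move=> x; exact: (cintegrable_normc (i2 x)).
- move=> x; apply: le_trans (fh x).
  apply: le_Rintegral => //.
  + exact: (integrable_norm (cintegrable_normc (i2 x))).
  + exact: (cintegrable_normc (i2 x)).
  + by move=> y _; rewrite ger0_norm ?normc_ge0.
Qed.

Hypothesis fi : cintegrable (m1 \x m2)%E f.

Lemma cint_prod1 : (forall x, cintegrable m2 (fun y => f (x, y))) ->
  cint (m1 \x m2)%E f = cint m1 (fun x => cint m2 (fun y => f (x, y))).
Proof.
have [f1 f2] := fi; move=> i2; apply: complex_eq => /=.
  by rewrite (Rintegral_prod1 f1) // => x; have [] := i2 x.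
by rewrite (Rintegral_prod1 f2) // => x; have [] := i2 x.
Qed.

Lemma cint_prod2 : (forall y, cintegrable m1 (fun x => f (x, y))) ->
  cint (m1 \x m2)%E f = cint m2 (fun y => cint m1 (fun x => f (x, y))).
Proof.
have [f1 f2] := fi; move=> i2; apply: complex_eq => /=.
  by rewrite (Rintegral_prod2 f1) // => x; have [] := i2 x.
by rewrite (Rintegral_prod2 f2) // => x; have [] := i2 x.
Qed.

Lemma cintegrable_cint1 : (forall x, cintegrable m2 (fun y => f (x, y))) ->
  cintegrable m1 (fun x => cint m2 (fun y => f (x, y))).
Proof.
have [f1 f2] := fi; move=> i2; split => /=.
  by apply: (integrable_Rintegral1 f1) => x; have [] := i2 x.
by apply: (integrable_Rintegral1 f2) => x; have [] := i2 x.
Qed.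

Lemma cint_fubini : (forall x, cintegrable m2 (fun y => f (x, y))) ->
  (forall y, cintegrable m1 (fun x => f (x, y))) ->
  cint m1 (fun x => cint m2 (fun y => f (x, y))) =
  cint m2 (fun y => cint m1 (fun x => f (x, y))).
Proof. by move=> i2 i1; rewrite -cint_prod1// cint_prod2. Qed.

End complex_fubini.

Lemma cint_mul d1 d2 (T1 : measurableType d1) (T2 : measurableType d2)
    (R : realType) (m1 : {sigma_finite_measure set T1 -> \bar R})
    (m2 : {sigma_finite_measure set T2 -> \bar R}) (f : T1 -> R[i]) (g : T2 -> R[i]) :
  cintegrable m1 f -> cintegrable m2 g ->
  cintegrable (m1 \x m2)%E (fun z => f z.1 * g z.2) /\
  cint (m1 \x m2)%E (fun z => f z.1 * g z.2) = cint m1 f * cint m2 g.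
Proof.
move=> fi gi.
have mfg : cmeasurable (fun z : T1 * T2 => f z.1 * g z.2).
  apply: cmeasurableM.
    exact: (cmeasurable_comp (cintegrable_measurable fi) measurable_fst).
  exact: (cmeasurable_comp (cintegrable_measurable gi) measurable_snd).
have sec x : cintegrable m2 (fun y => f x * g y) by exact: cintegrableZ.
have nf := cintegrable_normc fi; have ng := cintegrable_normc gi.
have pi : cintegrable (m1 \x m2)%E (fun z => f z.1 * g z.2).
  apply: (@cintegrable_prod_dom _ _ _ _ _ _ _ _
    (fun x => (\int[m2]_y normc (g y)) * normc (f x))) => //=.
    move=> x; under eq_Rintegral do rewrite normcM.
    by rewrite RintegralZl// mulrC.
  rewrite (_ : _ \o _ = (fun x => (\int[m2]_y normc (g y))%:E * (normc (f x))%:E)%E).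
    exact: integrableZl.
  by apply/funext => x /=; rewrite EFinM.
split => //; rewrite cint_prod1//=.
under eq_cint do rewrite cintZ// mulrC.
by rewrite cintZ// mulrC.
Qed.

(** * The product measure on tuples *)

Section measure_preserving.
Context d1 d2 (T1 : measurableType d1) (T2 : measurableType d2) {R : realType}.
Variables (m1 : {measure set T1 -> \bar R}) (m2 : {measure set T2 -> \bar R}).
Variable tau : T1 -> T2.
Hypothesis mtau : measurable_fun setT tau.
Hypothesis tauE : forall A, measurable A -> m2 A = m1 (tau @^-1` A).

Lemma integrable_preserving (f : T2 -> \bar R) : measurable_fun setT f ->
  m1.-integrable setT (f \o tau) -> m2.-integrable setT f.
Proof.
move=> mf fi; have := @integrable_pushforward _ _ _ _ _ _ mtau m1 setT f mf.
rewrite preimage_setT => /(_ fi measurableT) /integrableP[_ h].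
apply/integrableP; split => //; apply: le_lt_trans h.
rewrite le_eqVlt; apply/orP; left; apply/eqP.
by apply: eq_measure_integral => A mA _; exact: tauE.
Qed.

Lemma integral_preserving (f : T2 -> \bar R) : measurable_fun setT f ->
  m1.-integrable setT (f \o tau) ->
  (\int[m2]_y f y = \int[m1]_x f (tau x))%E.
Proof.
move=> mf fi; have := @integral_pushforward _ _ _ _ _ _ mtau m1 setT f mf.
rewrite preimage_setT => /(_ fi measurableT) <-.
by apply: eq_measure_integral => A mA _; exact: tauE.
Qed.

Lemma cintegrable_preserving (f : T2 -> R[i]) : cmeasurable f ->
  cintegrable m1 (f \o tau) -> cintegrable m2 f.
Proof.
move=> [f1 f2] [i1 i2]; split; apply: integrable_preserving => //;
  exact/measurable_EFinP.
Qed.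

Lemma cint_preserving (f : T2 -> R[i]) : cmeasurable f ->
  cintegrable m1 (f \o tau) -> cint m2 f = cint m1 (f \o tau).
Proof.
move=> [f1 f2] [i1 i2]; rewrite /cint /Rintegral.
by rewrite !integral_preserving//; exact/measurable_EFinP.
Qed.

End measure_preserving.

Section lebesgue_translation.
Context {R : realType}.
Local Notation lambda := (@lebesgue_measure R).

Lemma measurable_shiftr (a : R) : measurable_fun setT (fun x : R => x + a).
Proof. by apply: measurable_funD => //; exact: measurable_cst. Qed.

(** Lebesgue measure is determined by its values on half-open intervals, whose length a translation
    preserves. *)
Lemma lebesgue_measure_shift (a : R) A : measurable A ->
  lambda A = lambda ((fun x => x + a) @^-1` A).
Proof.
move=> mA.
suff -> : lambda A = pushforward lambda ((fun x => x + a) : _ -> measurableTypeR R) A by [].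
apply: lebesgue_measure_unique => //= [|mp _ [[x y] /= xy <-]].
  exact: measurable_shiftr.
rewrite /pushforward [X in _ = lambda X](_ : _ = `]x - a, y - a]%classic); last first.
  by apply/seteqP; split => z /=; rewrite !in_itv /= ltrBlDr lerBrDr.
rewrite !lebesgue_measure_itv /= !lte_fin ltrD2r.
by case: ifP => // _; rewrite -!EFinB; congr (_%:E); ring.
Qed.

Lemma cint_shift (a : R) (f : R -> R[i]) : cintegrable lambda f ->
  cintegrable lambda (fun x => f (x + a)) /\
  cint lambda (fun x => f (x + a)) = cint lambda f.
Proof.
move=> fi; have mf := cintegrable_measurable fi.
have ia : cintegrable lambda (fun x => f (x + a)).
  apply: (@cintegrable_preserving _ _ _ _ _ lambda lambda (fun x : R => x - a)).
  - exact: measurable_shiftr.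
  - exact: lebesgue_measure_shift.
  - exact: (cmeasurable_comp mf (measurable_shiftr a)).
  - by rewrite /comp; under eq_fun do rewrite subrK.
split=> //; apply/esym; apply: (@cint_preserving _ _ _ _ _ lambda lambda (fun x : R => x + a)) => //.
  exact: measurable_shiftr.
exact: lebesgue_measure_shift.
Qed.

End lebesgue_translation.

Section tuple_measure.
Context {R : realType}.
Local Notation lambda := (@lebesgue_measure R).
Local Notation mu := (@lebesgue_tuple R).

Lemma measurable_tuple_cons n : measurable_fun setT (@tuple_cons _ R n).
Proof. by apply: measurable_cons; [exact: measurable_fst|exact: measurable_snd]. Qed.

Lemma lebesgue_tupleS n A : measurable A ->
  mu n.+1 A = (lambda \x mu n)%E (@tuple_cons _ _ n @^-1` A).
Proof. by []. Qed.

Lemma tnth_tuple_cons n (x : R) (t : n.-tuple R) (i : 'I_n.+1) :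
  tnth (tuple_cons (x, t)) i = if unlift ord0 i is Some j then tnth t j else x.
Proof.
case: unliftP => [j ->|->]; first by rewrite tnthS.
by rewrite tnth0.
Qed.

Lemma cint_tupleS n (f : n.+1.-tuple R -> R[i]) : cmeasurable f ->
  cintegrable (lambda \x mu n)%E (fun z => f (tuple_cons z)) ->
  cintegrable (mu n.+1) f /\
  cint (mu n.+1) f = cint (lambda \x mu n)%E (fun z => f (tuple_cons z)).
Proof.
move=> mf fi; split.
  by apply: (cintegrable_preserving (m1 := (lambda \x mu n)%E) (m2 := mu n.+1)
    (@measurable_tuple_cons n) (@lebesgue_tupleS n)).
by apply: (cint_preserving (m1 := (lambda \x mu n)%E) (m2 := mu n.+1)
  (@measurable_tuple_cons n) (@lebesgue_tupleS n)).
Qed.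

Lemma cmeasurable_prod n (f : 'I_n -> R -> R[i]) : (forall i, cmeasurable (f i)) ->
  cmeasurable (fun t : n.-tuple R => \prod_(i < n) f i (tnth t i)).
Proof.
move=> mf; elim: (index_enum _) => [|i s ih].
  by under eq_fun do rewrite big_nil; exact: cmeasurable_cst.
under eq_fun do rewrite big_cons; apply: cmeasurableM => //.
exact: (cmeasurable_comp (mf i) (measurable_tnth i)).
Qed.

Lemma cint_prod n (f : 'I_n -> R -> R[i]) : (forall i, cintegrable lambda (f i)) ->
  cintegrable (mu n) (fun t => \prod_(i < n) f i (tnth t i)) /\
  cint (mu n) (fun t => \prod_(i < n) f i (tnth t i)) = \prod_(i < n) cint lambda (f i).
Proof.
elim: n f => [|n ih] f fi.
  (* In dimension 0 the measure is the Dirac mass at the empty tuple and the product is 1. *)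
  under eq_fun do rewrite big_ord0; rewrite big_ord0; split.
    apply: (@cintegrable_dom _ _ _ _ _ (cst 1)).
    - exact: cmeasurable_cst.
    - by apply: finite_measure_integrable_cst.
    - by move=> x; rewrite normc1.
  rewrite (@cint_real _ _ _ _ (cst 1)) Rintegral_cst//= mul1r.
  by rewrite indicT.
have [i1 e1] := ih (fun i => f (lift ord0 i)) (fun i => fi (lift ord0 i)).
have [i2 e2] := cint_mul (fi ord0) i1.
have E z : \prod_(i < n.+1) f i (tnth (tuple_cons z) i) =
    f ord0 z.1 * \prod_(i < n) f (lift ord0 i) (tnth z.2 i).
  case: z => x t; rewrite big_ord_recl tnth0; congr (_ * _).
  by apply: eq_bigr => i _; rewrite tnthS.
have [] := @cint_tupleS n (fun t => \prod_(i < n.+1) f i (tnth t i)).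
- by apply: cmeasurable_prod => i; exact: cintegrable_measurable (fi i).
- by under eq_fun do rewrite E.
move=> ? ->; split => //; rewrite big_ord_recl -e1 -e2.
by apply: eq_cint => z; rewrite E.
Qed.

Definition tuple_add n (v t : n.-tuple R) : n.-tuple R :=
  [tuple tnth t i + tnth v i | i < n].

Lemma measurable_tuple_add n (v : n.-tuple R) : measurable_fun setT (tuple_add v).
Proof.
apply/measurable_fun_tnthP => i.
rewrite (_ : _ \o _ = fun t => tnth t i + tnth v i).
  by apply: measurable_funD; [exact: measurable_tnth|exact: measurable_cst].
by apply/funext => t /=; rewrite tnth_mktuple.
Qed.

(** By induction on n: under [tuple_cons] the translation becomes a translation of the head times
    one of the tail, and a product measure is determined by its values on rectangles. *)
Lemma lebesgue_tuple_shift n (v : n.-tuple R) A : measurable A ->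
  mu n A = mu n (tuple_add v @^-1` A).
Proof.
elim: n v A => [|n ih] v A mA.
  congr (mu 0 _); apply/seteqP; split => t /=.
    by rewrite (tuple0 t) (tuple0 (tuple_add _ _)).
  by rewrite (tuple0 t) (tuple0 (tuple_add _ _)).
have mA' : measurable (tuple_add v @^-1` A).
  by rewrite -[X in measurable X]setTI; exact: measurable_tuple_add.
rewrite !lebesgue_tupleS//.
pose v' : n.-tuple R := [tuple tnth v (lift ord0 i) | i < n].
pose tau (z : R * n.-tuple R) := (z.1 + tnth v ord0, tuple_add v' z.2).
have mtau : measurable_fun setT tau.
  apply: measurable_fun_pair.
    exact: (measurableT_comp (measurable_shiftr _) measurable_fst).
  exact: (measurableT_comp (measurable_tuple_add _) measurable_snd).
have -> : @tuple_cons _ _ n @^-1` (tuple_add v @^-1` A) =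
    tau @^-1` (@tuple_cons _ _ n @^-1` A).
  have E z : tuple_add v (tuple_cons z) = tuple_cons (tau z).
    case: z => x t; apply: eq_from_tnth => i; rewrite tnth_mktuple !tnth_tuple_cons.
    by case: unliftP => [j ->|->] //=; rewrite tnth_mktuple /v' tnth_mktuple.
  by apply/seteqP; split => z /=; rewrite E.
have mB : measurable (@tuple_cons _ R n @^-1` A).
  by rewrite -[X in measurable X]setTI; exact: measurable_tuple_cons.
move: (@tuple_cons _ R n @^-1` A) mB => B mB.
suff -> : (lambda \x mu n)%E B = pushforward (lambda \x mu n)%E tau B by [].
pose M := @measure_function_pushforward__canonical__measure_function_Measure _ _
  (measurableTypeR R * n.-tuple (measurableTypeR R))%type
  (measurableTypeR R * n.-tuple (measurableTypeR R))%type R (lambda \x mu n)%E tau mtau.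
apply: (@product_measure_unique _ _ _ _ _ lambda (mu n) M) => //.
move=> X Y mX mY; rewrite /= /pushforward.
rewrite (_ : tau @^-1` _ =
  ((fun x => x + tnth v ord0) @^-1` X) `*` (tuple_add v' @^-1` Y)); last first.
  by apply/seteqP; split => z.
rewrite product_measure1E; last 2 first.
- by rewrite -[X in measurable X]setTI; exact: measurable_shiftr.
- by rewrite -[X in measurable X]setTI; exact: measurable_tuple_add.
by rewrite [in RHS](lebesgue_measure_shift (tnth v ord0) mX) (ih v' _ mY).
Qed.

Lemma cint_tuple_shift n (v : n.-tuple R) (f : n.-tuple R -> R[i]) :
  cmeasurable f -> cintegrable (mu n) (fun t => f (tuple_add v t)) ->
  cint (mu n) (fun t => f (tuple_add v t)) = cint (mu n) f.
Proof.
move=> mf fi; apply/esym.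
exact: (cint_preserving (m1 := mu n) (m2 := mu n) (measurable_tuple_add v) (lebesgue_tuple_shift v)).
Qed.

(** A hyperplane is null. This is what finally allows the origin to be discarded from integrals over
    R^n. *)
Lemma lebesgue_tuple_thead n (a : R) : mu n.+1 [set t | thead t = a] = 0%E.
Proof.
rewrite /= /power_measure_step /pushforward.
rewrite (_ : _ @^-1` _ = [set a] `*` [set: n.-tuple R]).
  rewrite product_measure1E//.
  by rewrite [X in (X * _)%E](lebesgue_measure_set1 a) mul0e.
by apply/seteqP; split => [[x t]|[x t] []] //=.
Qed.

Lemma measurable_thead_set1 n (a : R) : measurable [set t : n.+1.-tuple R | thead t = a].
Proof.
rewrite (_ : [set t | _] = (fun t : n.+1.-tuple R => tnth t ord0) @^-1` [set a]) //.
by rewrite -[X in measurable X]setTI; exact: measurable_tnth.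
Qed.

End tuple_measure.

Section continuous_measurable.
Context {R : realType}.

(** Measurability on tuples is tested by coordinates, so an open set is written as a countable union
    of boxes with rational centres and radii 1/(m+1). *)
Lemma continuous_measurable_tuple n (f : 'rV[R]_n -> R) : continuous f ->
  measurable_fun setT (f \o @row_of_tuple R n).
Proof.
move=> /continuousP cf.
apply: (measurability _ (RGenOpens.measurableE R)) => _ [_ [a [b ->] <-]].
rewrite setTI comp_preimage.
have oV : open (f @^-1` `]a, b[%classic) by exact/cf/interval_open.
move: (f @^-1` _) oV => V oV.
pose box (qk : n.-tuple rat * nat) : set 'rV[R]_n :=
  [set x | forall i, `|ratr (tnth qk.1 i) - x ord0 i| < qk.2.+1%:R^-1].
rewrite (_ : _ @^-1` V = \bigcup_(qk in [set qk | box qk `<=` V])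
   (@row_of_tuple R n @^-1` box qk)); last first.
  apply/seteqP; split => [t Vt|t [qk qkV]]; last exact: qkV.
  have /nbhs_ballP[e /= e0 eV] : nbhs (row_of_tuple t) V by exact: open_nbhs_nbhs.
  pose k := Num.bound (2 / e).
  have k0 : 0 < k.+1%:R :> R by rewrite ltr0n.
  (* The radius is used twice: from the given tuple to the rational centre, and from the centre to a
     point of the box. *)
  have ke : k.+1%:R^-1 < e / 2.
    rewrite -[e / 2]invrK ltf_pV2 ?posrE// ?invr_gt0 ?divr_gt0// invf_div.
    apply: (lt_trans (archi_boundP _)); first by rewrite divr_ge0// ltW.
    by rewrite ltr_nat.
  have /choice[q hq] : forall i, exists q : rat, `|ratr q - tnth t i| < k.+1%:R^-1 :> R.
    move=> i; have [] := @rat_in_itvoo R (tnth t i - k.+1%:R^-1) (tnth t i + k.+1%:R^-1).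
      by rewrite ltrBlDr -addrA ltrDl addr_gt0// invr_gt0.
    by move=> q; rewrite in_itv /= => /andP[? ?]; exists q; rewrite ltr_distl; apply/andP.
  exists ([tuple q i | i < n], k) => /=.
    move=> x /= h; apply: eV; split=> // j i.
    rewrite (ord1 j) /ball /= mxE; apply: (le_lt_trans (ler_distD (ratr (q i)) _ _)).
    move: (h i) (hq i); rewrite /= tnth_mktuple distrC [in X in X -> _]distrC => hi hqi.
    rewrite (splitr e); apply: ltrD; first exact: lt_trans hqi ke.
    by rewrite distrC; exact: lt_trans hi ke.
  by move=> i; rewrite tnth_mktuple mxE.
rewrite bigcup_mkcond; apply: countable_bigcupT_measurable => [|qk].
  exact: countableP.
case: ifP => // _.
rewrite (_ : _ @^-1` _ = \bigcap_(i in [set: 'I_n]) ((fun t : n.-tuple R => tnth t i) @^-1`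
    `](ratr (tnth qk.1 i) - qk.2.+1%:R^-1), (ratr (tnth qk.1 i) + qk.2.+1%:R^-1)[%classic)).
  apply: fin_bigcap_measurable => // i _; rewrite -[X in measurable X]setTI.
  exact: measurable_tnth.
apply/seteqP; split => [t h i _|t h i].
  by move: (h i); rewrite mxE /= in_itv /= distrC ltr_distl.
by move: (h i I); rewrite mxE /= in_itv /= distrC ltr_distl.
Qed.

End continuous_measurable.

(** * Holomorphic functions *)

Section complex_derivative.
Context {R : realType}.
Local Notation C := R[i].
Implicit Types (f g : C -> C) (z w d : C).

(** Stated with real e and r and the real-valued [normc], in which all later estimates are made;
    [derivable_cdiff] links it to derivability over [C^o]. *)
Definition cderive f z d := forall e : R, 0 < e -> exists2 r : R, 0 < r &
  forall h, normc h < r -> normc (f (z + h) - f z - d * h) <= e * normc h.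

Definition cdiff f z := exists d, cderive f z d.

Lemma gtc0_real (e : C) : 0 < e -> e = (Re e)%:C /\ 0 < Re e.
Proof.
by case: e => a b; rewrite ltcE /= => /andP[/eqP b0 a0]; rewrite b0.
Qed.

Lemma near_normcP (z : C) (P : C -> Prop) :
  (\forall w \near (z : C^o), P w) <->
  exists2 r : R, 0 < r & forall w, normc (w - z) < r -> P w.
Proof.
split => [/nbhs_ballP[e /= e0 h]|[r r0 h]].
  have [eE e1] := gtc0_real e0; exists (Re e) => // w wr; apply: h.
  by rewrite /ball /= eE -normrN opprB normcE ltcR.
apply/nbhs_ballP; exists r%:C => /=; first by rewrite ltcR.
by move=> w; rewrite /ball /= -normrN opprB normcE ltcR => /h.
Qed.

Lemma dnear_normcP (z : C) (P : C -> Prop) :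
  (\forall w \near (z : C^o)^', P w) <->
  exists2 r : R, 0 < r & forall w, w != z -> normc (w - z) < r -> P w.
Proof.
rewrite /dnbhs /within /=; split.
  by move=> /near_normcP[r r0 h]; exists r => // w wz wr; exact: h.
by move=> [r r0 h]; apply/near_normcP; exists r => // w wr wz; exact: h.
Qed.

Lemma derivable_cdiff f z : derivable (f : C^o -> C^o) z 1 <-> cdiff f z.
Proof.
split.
  move=> /cvg_ex[/= d /cvgrPdist_le fd]; exists d => e e0.
  have e0' : 0 < e%:C by rewrite ltcR.
  have /dnear_normcP[r r0 h] := fd e%:C e0'.
  exists r => // k kr; have [->|k0] := eqVneq k 0.
    by rewrite addr0 subrr mulr0 subr0 normc0 mulr0.
  have := h k k0; rewrite subr0 => /(_ kr).
  rewrite normcE lecR => {}h.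
  have -> : f (z + k) - f z - d * k = - (k * (d - k^-1 *: (f (k *: (1 : C^o) + z) - f z))).
    rewrite /GRing.scale /= mulr1 (addrC z) mulrBr mulrA mulfV// mul1r; ring.
  by rewrite normcN normcM mulrC ler_wpM2r ?normc_ge0.
move=> [d fd]; apply/cvg_ex; exists d; apply/cvgrPdist_le => /= e /gtc0_real[-> e0].
have [r r0 h] := fd _ e0; apply/dnear_normcP; exists r => // k k0; rewrite subr0 => kr.
rewrite normcE lecR.
have nk : 0 < normc k by rewrite normc_gt0.
rewrite -(ler_pM2r nk) -normcM; apply: le_trans (h k kr).
rewrite (_ : (_ - _) * k = - (f (z + k) - f z - d * k)) ?normcN//.
by rewrite /GRing.scale /= mulr1 (addrC z) mulrBl mulrAC mulVf// mul1r !opprB.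
Qed.

Lemma cdiff_cst c z : cdiff (fun=> c) z.
Proof. by apply/derivable_cdiff; exact: derivable_cst. Qed.

Lemma cdiff_id z : cdiff id z.
Proof. by apply/derivable_cdiff; exact: derivable_id. Qed.

Lemma cdiffD f g z : cdiff f z -> cdiff g z -> cdiff (fun x => f x + g x) z.
Proof.
move=> /derivable_cdiff df /derivable_cdiff dg; apply/derivable_cdiff.
exact: (derivableD df dg).
Qed.

Lemma cdiffN f z : cdiff f z -> cdiff (fun x => - f x) z.
Proof. by move=> /derivable_cdiff df; apply/derivable_cdiff; exact: (derivableN df). Qed.

Lemma cdiffB f g z : cdiff f z -> cdiff g z -> cdiff (fun x => f x - g x) z.
Proof. by move=> df dg; apply: cdiffD => //; exact: cdiffN. Qed.

Lemma cdiffM f g z : cdiff f z -> cdiff g z -> cdiff (fun x => f x * g x) z.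
Proof.
move=> /derivable_cdiff df /derivable_cdiff dg; apply/derivable_cdiff.
exact: (derivableM df dg).
Qed.

Lemma cdiffV f z : f z != 0 -> cdiff f z -> cdiff (fun x => (f x)^-1) z.
Proof.
move=> fz /derivable_cdiff df; apply/derivable_cdiff.
exact: (@derivableV _ _ (f : C^o -> C) z 1 fz df).
Qed.

Lemma cdiffX f n z : cdiff f z -> cdiff (fun x => f x ^+ n) z.
Proof.
move=> df; elim: n => [|n ih]; first exact: cdiff_cst.
by under eq_fun do rewrite exprS; exact: cdiffM.
Qed.

Lemma cdiff_sum (I : Type) (s : seq I) (F : I -> C -> C) z :
  (forall i, cdiff (F i) z) -> cdiff (fun x => \sum_(i <- s) F i x) z.
Proof.
move=> h; elim: s => [|i s ih].
  by under eq_fun do rewrite big_nil; exact: cdiff_cst.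
by under eq_fun do rewrite big_cons; exact: cdiffD.
Qed.

Lemma cdiff_continuous f z : cdiff f z -> forall e : R, 0 < e ->
  exists2 r : R, 0 < r & forall w, normc (w - z) < r -> normc (f w - f z) < e.
Proof.
move=> [d fd] e e0; have [r r0 h] := fd 1 ltr01.
have nd : 0 < normc d + 1 by rewrite ltr_wpDl ?normc_ge0.
exists (Num.min r (e / (normc d + 1))) => [|w].
  by rewrite lt_min r0 divr_gt0.
rewrite lt_min => /andP[wr we].
have := h _ wr; rewrite mul1r (addrC z) subrK => hw.
apply: (le_lt_trans (y := (normc d + 1) * normc (w - z))); last first.
  by rewrite mulrC -ltr_pdivlMr.
rewrite -[f w - f z](subrK (d * (w - z))) mulrDl mul1r addrC.
by apply: (le_trans (normcD _ _)); rewrite normcM lerD2l.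
Qed.

Lemma cdiff_near f g z : (exists2 r : R, 0 < r & forall w, normc (w - z) < r -> f w = g w) ->
  cdiff f z -> cdiff g z.
Proof.
move=> [r r0 fg] [d fd]; exists d => e e0; have [s s0 h] := fd e e0.
exists (Num.min r s) => [|k]; first by rewrite lt_min r0.
rewrite lt_min => /andP[kr ks].
by rewrite -!fg ?h// ?subrr ?normc0// addrAC subrr add0r.
Qed.

Lemma cdiff_comp f g z : cdiff f z -> cdiff g (f z) -> cdiff (fun x => g (f x)) z.
Proof.
move=> df; have [d fd] := df; move=> [d' gd]; exists (d' * d) => e e0.
set A := normc d + 1; set B := normc d' + 1.
have A0 : 0 < A by rewrite ltr_wpDl ?normc_ge0.
have B0 : 0 < B by rewrite ltr_wpDl ?normc_ge0.
have [r r0 hg] := gd _ (divr_gt0 (divr_gt0 e0 A0) (ltr0n R 2)).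
have [s s0 hf] := fd _ (divr_gt0 (divr_gt0 e0 B0) (ltr0n R 2)).
have [s' s'0 hf'] := fd 1 ltr01.
have [q q0 hc] := cdiff_continuous df r0.
exists (Num.min (Num.min s s') q) => [|k]; first by rewrite !lt_min s0 s'0.
rewrite !lt_min => /andP[/andP[ks ks'] kq].
have fk : normc (f (z + k) - f z) <= A * normc k.
  rewrite -[f _ - f _](subrK (d * k)) /A mulrDl mul1r addrC.
  apply: (le_trans (normcD _ _)); rewrite normcM lerD2l.
  by have := hf' k ks'; rewrite mul1r.
have kq' : normc (z + k - z) < q by rewrite addrAC subrr add0r.
have := hg _ (hc _ kq'); rewrite (addrC (f z)) subrK => {}hg.
have {}hf := hf k ks.
set u := g _ - g _ in hg; set v := f _ - f _ in hg hf fk.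
rewrite (_ : u - _ = (u - d' * v) + d' * (v - d * k)); last ring.
apply: (le_trans (normcD _ _)); rewrite (splitr e) mulrDl; apply: lerD.
  apply: (le_trans hg); apply: (le_trans (y := e / A / 2 * (A * normc k))).
    by rewrite ler_wpM2l// ltW// !divr_gt0.
  have -> : e / A / 2 * (A * normc k) = e / 2 * normc k by field; exact: lt0r_neq0.
  by [].
rewrite normcM; apply: (le_trans (y := B * (e / B / 2 * normc k))).
  apply: ler_pM; rewrite ?normc_ge0//.
  by rewrite /B lerDl.
have -> : B * (e / B / 2 * normc k) = e / 2 * normc k by field; exact: lt0r_neq0.
by [].
Qed.

Lemma cderive_cexp z : cderive cexp z (cexp z).
Proof.
move=> e e0.
have K0 : 0 < normc (cexp z) * 4 * expR 1 + 1.
  by rewrite ltr_wpDl// !mulr_ge0 ?normc_ge0 ?expR_ge0.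
exists (Num.min 1 (e / (normc (cexp z) * 4 * expR 1 + 1))) => [|h].
  by rewrite lt_min ltr01 divr_gt0.
rewrite lt_min => /andP[h1 he].
rewrite cexpD (_ : _ - _ - _ = cexp z * (cexp h - 1 - h)); last ring.
rewrite normcM.
apply: (le_trans (y := normc (cexp z) * (4 * normc h ^+ 2 * expR 1))).
  rewrite ler_wpM2l ?normc_ge0//; apply: (le_trans (ler_cexpB2 h)).
  apply: ler_wpM2l; last by rewrite ler_expR ltW.
  by apply: mulr_ge0 => //; exact: sqr_ge0.
move: he; rewrite ltr_pdivlMr// => he.
have n0 := normc_ge0 h; have := expR_ge0 (1 : R); have := normc_ge0 (cexp z).
move=> c0 E0.
rewrite (_ : _ * _ = (normc h * (normc (cexp z) * 4 * expR 1)) * normc h); last ring.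
rewrite ler_wpM2r// (le_trans _ (ltW he))// ler_wpM2l// lerDl ler01//.
Qed.

Lemma cdiff_cexp z : cdiff cexp z.
Proof. by exists (cexp z); exact: cderive_cexp. Qed.

End complex_derivative.

(** * Integrals along segments and Goursat's theorem for rectangles *)

Section segment_integral.
Context {R : realType}.
Local Notation C := R[i].
Local Notation mu := (@lebesgue_measure R).
Implicit Types (phi psi : R -> C) (a b c x y : R).

Definition ccontinuous_at phi x := forall e : R, 0 < e ->
  exists2 r : R, 0 < r & forall y, `|y - x| < r -> normc (phi y - phi x) < e.

(** Continuity at the endpoints is two-sided: the integrands are restrictions of functions that are
    differentiable, as functions on the plane, at every point of the closed segment. *)
Definition ccontinuous_on phi a b := forall x, a <= x <= b -> ccontinuous_at phi x.

Definition segint phi a b : C :=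
  (\int[mu]_(x in `[a, b]) Re (phi x)) +i* (\int[mu]_(x in `[a, b]) Im (phi x)).

Lemma ccontinuous_on_integrable phi a b : ccontinuous_on phi a b ->
  mu.-integrable `[a, b] (EFin \o (fun x => Re (phi x))) /\
  mu.-integrable `[a, b] (EFin \o (fun x => Im (phi x))).
Proof.
move=> cphi; split; apply: continuous_compact_integrable;
  try exact: segment_compact; apply: continuous_in_subspaceT => x;
  rewrite inE /= in_itv /= => /cphi h; apply/cvgrPdist_lt => e /h[r r0 hr];
  apply/nbhs_ballP; exists r => //= y; rewrite /ball /= distrC => /hr yx;
  rewrite distrC; apply: le_lt_trans yx.
  by rewrite -ReB ler_Re_normc.
by rewrite -ImB ler_Im_normc.
Qed.

Lemma ccontinuous_onD phi psi a b : ccontinuous_on phi a b -> ccontinuous_on psi a b ->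
  ccontinuous_on (fun x => phi x + psi x) a b.
Proof.
move=> h1 h2 x xab e e0.
have [r r0 k1] := h1 x xab _ (divr_gt0 e0 (ltr0n R 2)).
have [s s0 k2] := h2 x xab _ (divr_gt0 e0 (ltr0n R 2)).
exists (Num.min r s) => [|y]; first by rewrite lt_min r0.
rewrite lt_min => /andP[/k1 y1 /k2 y2].
rewrite (_ : _ - _ = (phi y - phi x) + (psi y - psi x)); last ring.
by rewrite (splitr e); apply: (le_lt_trans (normcD _ _)); exact: ltrD.
Qed.

Lemma ccontinuous_onZ k phi a b : ccontinuous_on phi a b ->
  ccontinuous_on (fun x => k * phi x) a b.
Proof.
move=> h1 x xab e e0.
have k0 : 0 < normc k + 1 by rewrite ltr_wpDl ?normc_ge0.
have [r r0 k1] := h1 x xab _ (divr_gt0 e0 k0).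
exists r => // y /k1 hy; rewrite -mulrBr normcM.
apply: (le_lt_trans (y := (normc k + 1) * normc (phi y - phi x))).
  by rewrite ler_wpM2r ?normc_ge0// lerDl.
by rewrite mulrC -ltr_pdivlMr.
Qed.

Lemma ccontinuous_onN phi a b : ccontinuous_on phi a b ->
  ccontinuous_on (fun x => - phi x) a b.
Proof. by move=> h; under eq_fun do rewrite -mulN1r; exact: ccontinuous_onZ. Qed.

Lemma ccontinuous_onB phi psi a b : ccontinuous_on phi a b -> ccontinuous_on psi a b ->
  ccontinuous_on (fun x => phi x - psi x) a b.
Proof. by move=> h1 h2; apply: ccontinuous_onD => //; exact: ccontinuous_onN. Qed.

Lemma ccontinuous_on_cst k a b : ccontinuous_on (fun=> k) a b.
Proof. by move=> x _ e e0; exists 1 => // y _; rewrite subrr normc0. Qed.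

Lemma segintB phi psi a b : ccontinuous_on phi a b -> ccontinuous_on psi a b ->
  segint (fun x => phi x - psi x) a b = segint phi a b - segint psi a b.
Proof.
move=> /ccontinuous_on_integrable[i1 i2] /ccontinuous_on_integrable[j1 j2].
apply: complex_eq; rewrite reim /=.
  by rewrite -RintegralB//; apply: eq_Rintegral => x _; rewrite ReB.
by rewrite -RintegralB//; apply: eq_Rintegral => x _; rewrite ImB.
Qed.

Lemma segint_cst k a b : a <= b -> segint (fun=> k) a b = (b - a)%:C * k.
Proof.
move=> ab; apply: complex_eq; rewrite reim /= mul0r ?subr0 ?addr0 Rintegral_cst//=;
  rewrite lebesgue_measure_itv /= lte_fin;
  move: ab; rewrite le_eqVlt => /orP[/eqP ->|->] /=;
  by rewrite ?ltxx ?subrr ?mul0r ?mulr0// mulrC.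
Qed.

Lemma eq_segint phi psi a b : (forall x, a <= x <= b -> phi x = psi x) ->
  segint phi a b = segint psi a b.
Proof.
move=> h; apply: complex_eq => /=; apply: eq_Rintegral => x;
  by rewrite inE /= in_itv /= => /h ->.
Qed.

Lemma segint_add phi a b c : ccontinuous_on phi a c -> a <= b -> b <= c ->
  segint phi a c = segint phi a b + segint phi b c.
Proof.
move=> /ccontinuous_on_integrable[i1 i2] ab bc.
have sub (f : R -> R) : mu.-integrable `[a, c] (EFin \o f) ->
    \int[mu]_(x in `[a, c]) f x = \int[mu]_(x in `[a, b]) f x + \int[mu]_(x in `[b, c]) f x.
  move=> fi; have := @Rintegral_itvB _ f (BLeft a) (BRight c) b fi.
  rewrite !bnd_simp => /(_ ab bc); rewrite Rintegral_itv_obnd_cbnd; last first.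
    by apply: integrableS fi => // x /=; rewrite !in_itv /= => /andP[/ltW bx ->];
    rewrite (le_trans ab).
  by move=> <-; rewrite addrC subrK.
by apply: complex_eq; rewrite reim /= sub.
Qed.

Lemma normc_segint_le phi a b (M : R) : ccontinuous_on phi a b -> a <= b ->
  (forall x, a <= x <= b -> normc (phi x) <= M) ->
  normc (segint phi a b) <= 2 * ((b - a) * M).
Proof.
move=> /ccontinuous_on_integrable[i1 i2] ab h; apply: (le_trans (ler_normc_ReIm _)).
have key (f : R -> R) : mu.-integrable `[a, b] (EFin \o f) ->
    (forall x, a <= x <= b -> `|f x| <= M) ->
    `|\int[mu]_(x in `[a, b]) f x| <= (b - a) * M.
  move=> fi hf; apply: (le_trans (le_normr_Rintegral _ fi)) => //.
  have -> : (b - a) * M = \int[mu]_(x in `[a, b]) M.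
    rewrite Rintegral_cst//= lebesgue_measure_itv /= lte_fin.
    by move: ab; rewrite le_eqVlt => /orP[/eqP ->|->];
      rewrite ?ltxx ?subrr ?mul0r ?mulr0// mulrC.
  apply: le_Rintegral => //.
  - exact: (integrable_norm fi).
  - apply: continuous_compact_integrable; first exact: segment_compact.
    by apply: continuous_subspaceT => x; exact: cvg_cst.
rewrite mulr_natl mulr2n; apply: lerD; apply: key => // x /h;
  by apply: le_trans; rewrite ?ler_Re_normc ?ler_Im_normc.
Qed.

Lemma Re_segint_le phi a b (M : R) : ccontinuous_on phi a b -> a <= b ->
  (forall x, a <= x <= b -> Re (phi x) <= M) ->
  Re (segint phi a b) <= (b - a) * M.
Proof.
move=> /ccontinuous_on_integrable[i1 i2] ab h /=.
have -> : (b - a) * M = \int[mu]_(x in `[a, b]) M.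
  rewrite Rintegral_cst//= lebesgue_measure_itv /= lte_fin.
  by move: ab; rewrite le_eqVlt => /orP[/eqP ->|->];
    rewrite ?ltxx ?subrr ?mul0r ?mulr0// mulrC.
apply: le_Rintegral => //.
- apply: continuous_compact_integrable; first exact: segment_compact.
  by apply: continuous_subspaceT => x; exact: cvg_cst.
Qed.

Lemma cdiff_ccontinuous (g : C -> C) (p q : C) x : cdiff g (p + x%:C * q) ->
  ccontinuous_at (fun t => g (p + t%:C * q)) x.
Proof.
move=> /cdiff_continuous h e /h[r r0 hr].
have q0 : 0 < normc q + 1 by rewrite ltr_wpDl ?normc_ge0.
exists (r / (normc q + 1)); first exact: divr_gt0.
move=> y yr; apply: hr.
rewrite (_ : _ - _ = (y - x)%:C * q); last by rewrite rmorphB /=; ring.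
rewrite normcM normc_real; apply: (le_lt_trans (y := `|y - x| * (normc q + 1))).
  by rewrite ler_wpM2l// lerDl.
by rewrite -ltr_pdivlMr.
Qed.

End segment_integral.

Section goursat.
Context {R : realType}.
Local Notation C := R[i].
Variable g : C -> C.

(** The contour integral of g, counterclockwise, around the rectangle with sides [a, b] and [c, d],
    opposite sides being paired. *)
Definition rectint (a b c d : R) : C :=
  segint (fun x => g (x +i* c) - g (x +i* d)) a b +
  'i%C * segint (fun y => g (b +i* y) - g (a +i* y)) c d.

Definition cdiff_rect (a b c d : R) :=
  forall x y, a <= x <= b -> c <= y <= d -> cdiff g (x +i* y).

Lemma cdiff_horizontal a b c : (forall x, a <= x <= b -> cdiff g (x +i* c)) ->
  ccontinuous_on (fun x => g (x +i* c)) a b.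
Proof.
move=> h x xab.
have E t : (t +i* c) = (0 +i* c) + t%:C * 1 :> C.
  by apply: complex_eq; rewrite !reim /=; ring.
under eq_fun do rewrite E; apply: cdiff_ccontinuous; rewrite -E; exact: h.
Qed.

Lemma cdiff_vertical a c d : (forall y, c <= y <= d -> cdiff g (a +i* y)) ->
  ccontinuous_on (fun y => g (a +i* y)) c d.
Proof.
move=> h y ycd.
have E t : (a +i* t) = a%:C + t%:C * 'i%C :> C.
  by apply: complex_eq; rewrite !reim /=; ring.
under eq_fun do rewrite E; apply: cdiff_ccontinuous; rewrite -E; exact: h.
Qed.

Lemma rectint_splitx a m b c d : cdiff_rect a b c d -> a <= m -> m <= b -> c <= d ->
  rectint a b c d = rectint a m c d + rectint m b c d.
Proof.
move=> dg am mb cd; have ab := le_trans am mb.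
have H y : c <= y <= d -> ccontinuous_on (fun x => g (x +i* y)) a b.
  by move=> ycd; apply: cdiff_horizontal => x xab; exact: dg.
have V x : a <= x <= b -> ccontinuous_on (fun y => g (x +i* y)) c d.
  by move=> xab; apply: cdiff_vertical => y ycd; exact: dg.
have Hc := H c; have Hd := H d.
have Va := V a; have Vm := V m; have Vb := V b.
rewrite !lexx !am !mb !ab !cd in Hc Hd Va Vm Vb.
rewrite /rectint (@segint_add _ _ a m b)//; last by apply: ccontinuous_onB; auto.
rewrite !(@segintB _ _ _ c d); auto.
by move: 'i%C => I; ring.
Qed.

Lemma rectint_splity a b c m d : cdiff_rect a b c d -> a <= b -> c <= m -> m <= d ->
  rectint a b c d = rectint a b c m + rectint a b m d.
Proof.
move=> dg ab cm md; have cd := le_trans cm md.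
have H y : c <= y <= d -> ccontinuous_on (fun x => g (x +i* y)) a b.
  by move=> ycd; apply: cdiff_horizontal => x xab; exact: dg.
have V x : a <= x <= b -> ccontinuous_on (fun y => g (x +i* y)) c d.
  by move=> xab; apply: cdiff_vertical => y ycd; exact: dg.
have Hc := H c; have Hd := H d; have Hm := H m.
have Va := V a; have Vb := V b.
rewrite !lexx !cm !md !ab !cd in Hc Hd Hm Va Vb.
rewrite /rectint [X in _ + 'i%C * X](@segint_add _ _ c m d)//; last by apply: ccontinuous_onB; auto.
rewrite !(@segintB _ _ _ a b); auto.
by move: 'i%C => I; ring.
Qed.

(** The contour integral is the sum of those around the four quarters, so by the triangle inequality
    one of them has at least a quarter of its modulus. *)
Lemma rectint_quarter a b c d (e : R) : cdiff_rect a b c d -> a <= b -> c <= d ->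
  e <= normc (rectint a b c d) ->
  exists a' c', [/\ a <= a', a' + (b - a) / 2 <= b, c <= c', c' + (d - c) / 2 <= d &
    e / 4 <= normc (rectint a' (a' + (b - a) / 2) c' (c' + (d - c) / 2))].
Proof.
move=> dg ab cd he.
pose m := a + (b - a) / 2; pose k := c + (d - c) / 2.
have am : a <= m by rewrite /m; lra.
have mb : m <= b by rewrite /m; lra.
have ck : c <= k by rewrite /k; lra.
have kd : k <= d by rewrite /k; lra.
have mE : m + (b - a) / 2 = b by rewrite /m; lra.
have kE : k + (d - c) / 2 = d by rewrite /k; lra.
have d1 : cdiff_rect a m c d.
  by move=> x y /andP[? ?] ycd; apply: dg => //; apply/andP; split => //; lra.
have d2 : cdiff_rect m b c d.
  by move=> x y /andP[? ?] ycd; apply: dg => //; apply/andP; split => //; lra.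
move: he; rewrite (rectint_splitx dg am mb cd).
rewrite (rectint_splity d1 am ck kd) (rectint_splity d2 mb ck kd).
set A := rectint a m c k; set B := rectint a m k d.
set A' := rectint m b c k; set B' := rectint m b k d.
move=> he.
have : e <= normc A + normc B + (normc A' + normc B').
  apply: (le_trans he); apply: (le_trans (normcD _ _)).
  by apply: lerD; exact: normcD.
move=> {}he.
have [hA|hA] := leP (e / 4) (normc A).
  by exists a, c; split => //; lra.
have [hB|hB] := leP (e / 4) (normc B).
  by exists a, k; split => //; rewrite ?kE; lra.
have [hA'|hA'] := leP (e / 4) (normc A').
  by exists m, c; split => //; rewrite ?mE; lra.
exists m, k; split => //; rewrite ?mE ?kE//.
by move: hA hB hA' he; rewrite -/B'; lra.
Qed.

(** An affine function integrates to zero around a rectangle, so only the remainder, at most e along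
    the boundary, contributes. *)
Lemma normc_rectint_le a b c d (alpha beta z0 : C) (e D : R) :
  cdiff_rect a b c d -> a <= b -> c <= d -> 0 <= e -> b - a + (d - c) <= D ->
  (forall x y, a <= x <= b -> c <= y <= d ->
    normc (g (x +i* y) - alpha - beta * (x +i* y - z0)) <= e) ->
  normc (rectint a b c d) <= 4 * e * D.
Proof.
move=> dg ab cd e0 abD h.
have H y : c <= y <= d -> ccontinuous_on (fun x => g (x +i* y)) a b.
  by move=> ycd; apply: cdiff_horizontal => x xab; exact: dg.
have V x : a <= x <= b -> ccontinuous_on (fun y => g (x +i* y)) c d.
  by move=> xab; apply: cdiff_vertical => y ycd; exact: dg.
have cc : c <= c <= d by rewrite lexx.
have dd : c <= d <= d by rewrite lexx andbT.
have aa : a <= a <= b by rewrite lexx.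
have bb : a <= b <= b by rewrite lexx andbT.
(* The differences of the affine part between opposite sides; the contributions (b - a) kx and i (d
   - c) ky cancel. *)
pose kx : C := beta * (0 +i* (c - d)); pose ky : C := beta * (b - a)%:C.
have -> : rectint a b c d =
    segint (fun x => g (x +i* c) - g (x +i* d) - kx) a b +
    'i%C * segint (fun y => g (b +i* y) - g (a +i* y) - ky) c d.
  have cx : ccontinuous_on (fun x => g (x +i* c) - g (x +i* d)) a b.
    by apply: ccontinuous_onB; auto.
  have cy : ccontinuous_on (fun y => g (b +i* y) - g (a +i* y)) c d.
    by apply: ccontinuous_onB; auto.
  rewrite segintB//; last exact: ccontinuous_on_cst.
  rewrite [in RHS](@segintB _ _ _ c d)//; last exact: ccontinuous_on_cst.
  rewrite !segint_cst// /rectint /kx /ky.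
  have -> : (0 +i* (c - d)) = - ((d - c)%:C * 'i%C) :> C.
    by apply: complex_eq; rewrite !reim /=; ring.
  by move: 'i%C => I; ring.
apply: (le_trans (normcD _ _)); rewrite normcM normc_i normr1 mul1r.
have bx : normc (segint (fun x => g (x +i* c) - g (x +i* d) - kx) a b) <= 2 * ((b - a) * (2 * e)).
  apply: normc_segint_le => //.
    apply: ccontinuous_onB; last exact: ccontinuous_on_cst.
    by apply: ccontinuous_onB; auto.
  move=> x xab.
  rewrite (_ : _ - _ = (g (x +i* c) - alpha - beta * (x +i* c - z0)) -
     (g (x +i* d) - alpha - beta * (x +i* d - z0))).
    by apply: (le_trans (normcB _ _)); rewrite mulr_natl mulr2n; apply: lerD; apply: h.
  rewrite /kx (_ : 0 +i* (c - d) = (x +i* c) - (x +i* d)); first ring.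
  by apply: complex_eq; rewrite !reim /=; ring.
have by_ : normc (segint (fun y => g (b +i* y) - g (a +i* y) - ky) c d) <= 2 * ((d - c) * (2 * e)).
  apply: normc_segint_le => //.
    apply: ccontinuous_onB; last exact: ccontinuous_on_cst.
    by apply: ccontinuous_onB; auto.
  move=> y yab.
  rewrite (_ : _ - _ = (g (b +i* y) - alpha - beta * (b +i* y - z0)) -
     (g (a +i* y) - alpha - beta * (a +i* y - z0))).
    by apply: (le_trans (normcB _ _)); rewrite mulr_natl mulr2n; apply: lerD; apply: h.
  rewrite /ky (_ : (b - a)%:C = (b +i* y) - (a +i* y)); first ring.
  by apply: complex_eq; rewrite !reim /=; ring.
apply: (le_trans (lerD bx by_)).
rewrite (_ : _ + _ = 4 * e * (b - a + (d - c))); last ring.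
by rewrite ler_wpM2l// mulr_ge0.
Qed.

(* Goursat: quarter the rectangle indefinitely; at the limit point the
   integrand is affine up to an error that beats the area of the quarters. *)
Lemma rectint0 a b c d : cdiff_rect a b c d -> a <= b -> c <= d ->
  rectint a b c d = 0.
Proof.
move=> dg ab cd; pose L := b - a; pose M := d - c; pose eta := normc (rectint a b c d).
have L0 : 0 <= L by rewrite /L subr_ge0.
have M0 : 0 <= M by rewrite /M subr_ge0.
pose w (k : nat) (N : R) := N / 2 ^+ k.
have wS k N : w k.+1 N = w k N / 2 by rewrite /w exprS invfM; ring.
have wD k N N' : w k (N + N') = w k N + w k N' by rewrite /w mulrDl.
have w_ge0 k N : 0 <= N -> 0 <= w k N by move=> ?; rewrite /w divr_ge0// exprn_ge0.
(* A state records the generation and the lower left corner of a rectangle; it is bad if the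
   rectangle lies in the original one and carries at least its share eta / 4^generation. *)
pose Bad (s : nat * (R * R)) := [/\ a <= s.2.1, s.2.1 + w s.1 L <= b, c <= s.2.2,
  s.2.2 + w s.1 M <= d & eta / 4 ^+ s.1 <=
  normc (rectint s.2.1 (s.2.1 + w s.1 L) s.2.2 (s.2.2 + w s.1 M))].
have /choice[F hF] : forall s, exists s', Bad s -> [/\ Bad s', s'.1 = s.1.+1,
    s.2.1 <= s'.2.1 /\ s'.2.1 + w s'.1 L <= s.2.1 + w s.1 L &
    s.2.2 <= s'.2.2 /\ s'.2.2 + w s'.1 M <= s.2.2 + w s.1 M].
  move=> [k [x y]]; have [hs|ns] := pselect (Bad (k, (x, y))); last by exists (k, (x, y)).
  have [/= ax xb cy yd he] := hs.
  have dg' : cdiff_rect x (x + w k L) y (y + w k M).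
    by move=> u v /andP[? ?] /andP[? ?]; apply: dg; apply/andP; split; lra.
  have xx : x <= x + w k L by rewrite lerDl w_ge0.
  have yy : y <= y + w k M by rewrite lerDl w_ge0.
  have [x' [y' []]] := rectint_quarter dg' xx yy he.
  rewrite ![_ + w k _ - _]addrAC !subrr !add0r => xx' x'b yy' y'd he'.
  exists (k.+1, (x', y')) => _; split => //=; rewrite ?wS//; split => //=; rewrite ?wS; try lra.
  by move: he'; rewrite exprS invfM mulrA mulrAC.
pose u k := iter k F (0%N, (a, c)).
have B0 : Bad (0%N, (a, c)).
  rewrite /Bad /= /w !expr0 !divr1 /L /M (addrC a) (addrC c) !subrK.
  by split; exact: lexx.
have Bu k : Bad (u k) /\ (u k).1 = k.
  elim: k => [//|k [ih1 ih2]].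
  by have [h1 h2 _ _] := hF _ ih1; split => //; rewrite /u iterS h2 ih2.
have nest j k : (j <= k)%N -> [/\ (u j).2.1 <= (u k).2.1,
    (u k).2.1 + w k L <= (u j).2.1 + w j L, (u j).2.2 <= (u k).2.2 &
    (u k).2.2 + w k M <= (u j).2.2 + w j M].
  elim: k => [|k ih]; first by rewrite leqn0 => /eqP ->.
  rewrite leq_eqVlt => /orP[/eqP -> //|/ih[i1 i2 i3 i4]].
  have [hb hk] := Bu k; have [hb' hk'] := Bu k.+1.
  have [_ _] := hF _ hb; rewrite -/(u k.+1) hk hk' => -[h1 h2] [h3 h4].
  by split; lra.
have limit (p : R * R -> R) N : 0 <= N -> (forall j k, (j <= k)%N ->
    p (u j).2 <= p (u k).2 /\ p (u k).2 + w k N <= p (u j).2 + w j N) ->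
    exists x, forall k, p (u k).2 <= x <= p (u k).2 + w k N.
  (* The common point of the nested segments is the supremum of their left endpoints. *)
  move=> N0 hp; exists (sup (range (fun k => p (u k).2))) => k.
  have ub j i : p (u i).2 <= p (u j).2 + w j N.
    have [ij|/ltnW ji] := leqP i j.
      by have [h _] := hp _ _ ij; rewrite (le_trans h)// lerDl w_ge0.
    by have [_ h] := hp _ _ ji; rewrite (le_trans _ h)// lerDl w_ge0.
  apply/andP; split.
    apply: ub_le_sup; last by exists k.
    by exists (p (u 0%N).2 + w 0%N N) => _ [i _ <-]; exact: ub.
  by apply: ge_sup => [|_ [i _ <-]]; [exists (p (u 0%N).2), 0%N|exact: ub].
have [x hx] := limit fst L L0 (fun j k jk => let: And4 h1 h2 _ _ := nest j k jk in conj h1 h2).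
have [y hy] := limit snd M M0 (fun j k jk => let: And4 _ _ h1 h2 := nest j k jk in conj h1 h2).
have [dz hz] : cdiff g (x +i* y).
  have := hx 0%N; have := hy 0%N; rewrite /= /w expr0 !divr1 /L /M => hy0 hx0.
  by apply: dg; [move: hx0|move: hy0]; rewrite addrC subrK.
have eta0 : 0 <= eta by exact: normc_ge0.
suff : eta = 0 by exact: eq0_normc.
apply/eqP; rewrite eq_le eta0 andbT; apply/ler_addgt0Pr => e e0; rewrite add0r.
(* At generation k the estimate reads eta / 4^k <= 4 (e / K) (L + M)^2 / 4^k, which for this [K]
   gives eta <= e. *)
pose K := 4 * (L + M) ^+ 2 + 1.
have K0 : 0 < K by rewrite ltr_wpDl// mulr_ge0// sqr_ge0.
have [r r0 hr] := hz _ (divr_gt0 e0 K0).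
have [k hk] : exists k, w k (L + M) < r.
  have : w^~ (L + M) @ \oo --> (0 : R).
    rewrite -(mulr0 (L + M)); apply: cvgM; first exact: cvg_cst.
    rewrite (_ : (fun _ => _) = (fun k => 2^-1 ^+ k)); last first.
      by apply/funext => k; rewrite exprVn.
    by apply: cvg_expr; rewrite ger0_norm ?invr_ge0// invf_lt1 ?ltr1n.
  move=> /cvgrPdist_lt/(_ _ r0)[k _ /(_ k (leqnn k))] /=.
  rewrite sub0r normrN ger0_norm; first by exists k.
  by rewrite w_ge0// addr_ge0.
have [[ak kb ck kd he] uk] := Bu k; rewrite uk in ak kb ck kd he.
have := @normc_rectint_le (u k).2.1 ((u k).2.1 + w k L) (u k).2.2 ((u k).2.2 + w k M)
  (g (x +i* y)) dz (x +i* y) (e / K * w k (L + M)) (w k (L + M)).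
set X := normc _ => h; have {}h : X <= 4 * (e / K * w k (L + M)) * w k (L + M); last first.
  have := le_trans he h.
  rewrite ler_pdivrMr ?exprn_gt0// => /le_trans; apply.
  have -> : 4 * (e / K * w k (L + M)) * w k (L + M) * 4 ^+ k = e * ((4 * (L + M) ^+ 2) / K).
    rewrite /w (_ : 4 ^+ k = 2 ^+ k * 2 ^+ k); last by rewrite -exprMn -natrM.
    field; rewrite expf_neq0//= andbT; exact: lt0r_neq0.
  apply: ler_piMr; first exact: ltW.
  by rewrite ler_pdivrMr// mul1r lerDl.
apply: h.
- by move=> s t /andP[? ?] /andP[? ?]; apply: dg; apply/andP; split; lra.
- by rewrite lerDl w_ge0.
- by rewrite lerDl w_ge0.
- apply: mulr_ge0; first by apply: divr_ge0; exact: ltW.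
  by apply: w_ge0; exact: addr_ge0.
- by rewrite wD; lra.
- move=> s t sa tc; pose h : C := s +i* t - x +i* y.
  have hh : normc h <= w k (L + M).
    apply: (le_trans (ler_normc_ReIm _)); rewrite /h !reim /= wD; apply: lerD.
      move: sa (hx k) => /andP[? ?] /andP[? ?]; rewrite ler_norml.
      by apply/andP; split; lra.
    move: tc (hy k) => /andP[? ?] /andP[? ?]; rewrite ler_norml.
    by apply/andP; split; lra.
  have := hr h (le_lt_trans hh hk); rewrite [_ + h]addrC /h subrK => /le_trans; apply.
  by apply: ler_wpM2l => //; apply: divr_ge0; exact: ltW.
Qed.

End goursat.

(** * Mean values over circles, the maximum principle and unique continuation *)

Section maximum_principle.
Context {R : realType}.
Local Notation C := R[i].
Implicit Types (f F : C -> C) (z c : C).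

Lemma cexp_2pi_periodic (x : R) : cexp (x +i* (2 * pi)) = cexp (x +i* 0).
Proof.
rewrite /cexp /cis /=; congr (_ * _).
by rewrite mulr_natl -[pi *+ 2]add0r cosD2pi sinD2pi.
Qed.

(* Cauchy's theorem in the logarithmic coordinate: the average of f over the
   circle of radius exp x about c does not depend on x. *)
Lemma circle_mean f c (rho : R) : 0 < rho ->
  (forall z, normc (z - c) <= rho -> cdiff f z) ->
  ccontinuous_on (fun y => f (c + rho%:C * cis y)) 0 (2 * pi) /\
  segint (fun y => f (c + rho%:C * cis y)) 0 (2 * pi) = (2 * pi)%:C * f c.
Proof.
move=> rho0 df; pose g w := f (c + cexp w).
have pi0 : 0 <= 2 * pi :> R by rewrite mulr_ge0// pi_ge0.
have dg w : Re w <= ln rho -> cdiff g w.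
  move=> wr; apply: (@cdiff_comp _ (fun w => c + cexp w) f).
    by apply: cdiffD; [exact: cdiff_cst|exact: cdiff_cexp].
  apply: df; rewrite addrAC subrr add0r normc_cexp -[rho]lnK ?posrE//.
  by rewrite ler_expR.
have gE (x y : R) : g (x +i* y) = f (c + (expR x)%:C * cis y) by [].
have gc (x : R) : x <= ln rho -> ccontinuous_on (fun y => g (x +i* y)) 0 (2 * pi).
  by move=> xr; apply: cdiff_vertical => y _; exact: dg.
(* The horizontal sides cancel because [g] has period 2 pi i, so the integrals over the two vertical
   sides agree. *)
have gi (x : R) : x <= ln rho -> segint (fun y => g (x +i* y)) 0 (2 * pi) =
    segint (fun y => g (ln rho +i* y)) 0 (2 * pi).
  move=> xr; have := @rectint0 _ g x (ln rho) 0 (2 * pi).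
  have dr : cdiff_rect g x (ln rho) 0 (2 * pi).
    by move=> u v /andP[_ ur] _; exact: dg.
  have i0 : 'i%C != 0 :> C by rewrite eq_complex /= oner_eq0 andbF.
  move=> /(_ dr xr pi0); rewrite /rectint; move: 'i%C i0 => I I0.
  rewrite (@eq_segint _ _ (fun=> 0)); last first.
    by move=> u _; rewrite /g cexp_2pi_periodic subrr.
  rewrite (segint_cst 0 xr) mulr0 add0r segintB; [|exact: gc..].
  move=> /eqP; rewrite mulf_eq0 (negbTE I0) orFb subr_eq0 eq_sym => /eqP h.
  exact: h.
have E : (fun y => f (c + rho%:C * cis y)) = (fun y => g (ln rho +i* y)).
  by apply/funext => y; rewrite gE lnK.
rewrite E; split; first exact: gc.
apply/subr0_eq/(@normc_le_ball _ _ (4 * pi)); first by rewrite mulr_ge0// pi_ge0.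
move=> e e0.
have [|r r0 hr] := @cdiff_continuous _ f c _ _ e0.
  by apply: df; rewrite subrr normc0 ltW.
(* The mean may be computed on a circle of radius at most r/2, where f is within e of f c. *)
pose x := Num.min (ln rho) (ln (r / 2)).
have xr : x <= ln rho by rewrite ge_min lexx.
have ex : expR x < r.
  apply: (@le_lt_trans _ _ (r / 2)); last lra.
  by rewrite -[leRHS]lnK ?posrE ?divr_gt0// ler_expR ge_min lexx orbT.
rewrite -(gi _ xr) (_ : (2 * pi)%:C * f c = segint (fun=> f c) 0 (2 * pi)); last first.
  by rewrite segint_cst// subr0.
rewrite -segintB; [|exact: gc|exact: ccontinuous_on_cst].
apply: (@le_trans _ _ (2 * ((2 * pi - 0) * e))).
  apply: normc_segint_le => //.
    by apply: ccontinuous_onB; [exact: gc|exact: ccontinuous_on_cst].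
  move=> y _; rewrite gE; apply/ltW/hr.
  rewrite addrAC subrr add0r normcM normc_cis mulr1 normc_real ger0_norm ?expR_ge0//.
by rewrite subr0; have := @pi_ge0 R; lra.
Qed.

(** The square is compact as a product of two segments, and it contains the disc of radius L. *)
Definition in_square c (L : R) z := `|Re (z - c)| <= L /\ `|Im (z - c)| <= L.

Lemma in_square_ball c L z : normc (z - c) <= L -> in_square c L z.
Proof.
by move=> h; split; apply: le_trans h; [exact: ler_Re_normc|exact: ler_Im_normc].
Qed.

Lemma square_EVT c (L : R) (h : C -> R) : 0 <= L ->
  (forall z, in_square c L z -> forall e : R, 0 < e ->
     exists2 r : R, 0 < r & forall w, normc (w - z) < r -> `|h w - h z| < e) ->
  exists2 z, in_square c L z & forall w, in_square c L w -> h w <= h z.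
Proof.
move=> L0 hc; pose K : set (R * R)%type := `[- L, L]%classic `*` `[- L, L]%classic.
have cK : compact K by apply: compact_setX; exact: segment_compact.
have K0 : K !=set0 by exists (0, 0); split; rewrite /= in_itv /= oppr_le0 L0.
pose pt (p : R * R) : C := c + (p.1 +i* p.2).
have ptK p : K p -> in_square c L (pt p).
  move=> [/=]; rewrite !in_itv /= => h1 h2.
  by rewrite /in_square /pt addrAC subrr add0r /= !ler_norml.
have hK : {within K, continuous (h \o pt)}.
  apply: continuous_in_subspaceT => p; rewrite inE => /ptK pK.
  apply/cvgrPdist_lt => e /(hc _ pK)[r r0 hr].
  have r2 : 0 < r / 2 by exact: divr_gt0.
  exists (ball p.1 (r / 2), ball p.2 (r / 2)); first by split; exact: nbhsx_ballx.
  move=> q [/= b1 b2]; rewrite distrC; apply: hr.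
  apply: (le_lt_trans (ler_normc_ReIm _)); rewrite /pt !reim /=.
  move: b1 b2; rewrite /ball /= !(distrC _ q.1) !(distrC _ q.2) => b1 b2.
  rewrite (_ : Re c + q.1 - (Re c + p.1) = q.1 - p.1); last ring.
  rewrite (_ : Im c + q.2 - (Im c + p.2) = q.2 - p.2); last ring.
  by rewrite (splitr r) ltrD.
have [p + hp] := compact_EVT_max K0 cK hK.
rewrite inE => /ptK pK; exists (pt p) => // w [w1 w2].
have -> : w = pt (Re (w - c), Im (w - c)).
  by rewrite /pt /=; apply: complex_eq; rewrite !reim /=; ring.
by apply: hp; rewrite inE; split; rewrite /= in_itv /= -ler_norml.
Qed.

Lemma sqr_normcD (x y : C) : normc (x + y) ^+ 2 =
  normc x ^+ 2 + normc y ^+ 2 + 2 * Re (conjc x * y).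
Proof. by rewrite !sqr_normcE; case: x => a b; case: y => u v /=; ring. Qed.

(** Re F is perturbed by e |w - c|^2, whose mean over a circle of radius rho exceeds its value at
    the centre by e rho^2. A maximum of the perturbed function inside the disc of radius L would
    thus contradict [circle_mean]. *)
Lemma maximum_principle F c (L M : R) : 0 <= L ->
  (forall z, in_square c L z -> cdiff F z) ->
  (forall z, in_square c L z -> L <= normc (z - c) -> Re (F z) <= M) ->
  forall z, in_square c L z -> Re (F z) <= M.
Proof.
move=> L0 dF hM z zL; apply/ler_addgt0Pr => e' e'0.
(* On the square |w - c|^2 <= 2 L^2, so the perturbation costs at most e'. *)
pose e := e' / (2 * L ^+ 2 + 1).
have D0 : 0 < 2 * L ^+ 2 + 1 by rewrite ltr_wpDl// mulr_ge0// sqr_ge0.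
have e0 : 0 < e by exact: divr_gt0.
pose h w := Re (F w) + e * normc (w - c) ^+ 2.
pose H w := F w + (e%:C * ((w - c) * (conjc (w - c)))).
have [z1 z1L hz1] : exists2 z, in_square c L z & forall w, in_square c L w -> h w <= h z.
  apply: square_EVT => // w wL e1 e10.
  have [r1 r10 h1] := cdiff_continuous (dF _ wL) (divr_gt0 e10 (ltr0n R 2)).
  pose B := e * (2 * normc (w - c) + 1).
  have B0 : 0 < B by rewrite mulr_gt0// ltr_wpDl// mulr_ge0// normc_ge0.
  exists (Num.min (Num.min r1 1) (e1 / 2 / B)) => [|v].
    by rewrite !lt_min r10 ltr01 !divr_gt0.
  rewrite !lt_min => /andP[/andP[v1 v2] v3].
  rewrite /h (_ : _ - _ = Re (F v - F w) + e * (normc (v - c) ^+ 2 - normc (w - c) ^+ 2)); last first.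
    by rewrite reim; ring.
  apply: (le_lt_trans (ler_normD _ _)); rewrite (splitr e1); apply: ltrD.
    by apply: (le_lt_trans (ler_Re_normc _)); exact: h1.
  have n1 : `|normc (v - c) - normc (w - c)| <= normc (v - w).
    rewrite ler_norml; apply/andP; split.
      by have := normc_triangle w v c; rewrite (normcBC w v); lra.
    by have := normc_triangle v w c; lra.
  rewrite subr_sqr normrM (ger0_norm (ltW e0)) normrM.
  apply: (@le_lt_trans _ _ (e * (normc (v - w) * (2 * normc (w - c) + 1)))).
    apply: ler_wpM2l; first exact: ltW.
    apply: ler_pM => //.
    rewrite ger0_norm; last by rewrite addr_ge0 ?normc_ge0.
    by have := normc_triangle v w c; lra.
  by rewrite mulrCA -/B -ltr_pdivlMr.
have hzM w : in_square c L w -> normc (w - c) ^+ 2 <= 2 * L ^+ 2.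
  move=> [w1 w2]; rewrite sqr_normcE mulr_natl mulr2n; apply: lerD;
  by rewrite -(real_normK (num_real _)) ler_pXn2r// nnegrE.
have Fh : Re (F z) <= h z1.
  by apply: le_trans (hz1 _ zL); rewrite lerDl mulr_ge0 ?sqr_ge0// ltW.
apply: (le_trans Fh); rewrite /h; apply: lerD; last first.
  have := hzM _ z1L; rewrite -(ler_pM2l e0) => /le_trans; apply.
  rewrite /e mulrAC ler_pdivrMr//; apply: ler_wpM2l; first exact: ltW.
  by rewrite lerDl.
apply: hM => //; rewrite leNgt; apply/negP => z1i.
have [s1 s2] := in_square_ball (ltW z1i).
pose rho := L - normc (z1 - c).
have rho0 : 0 < rho by rewrite /rho subr_gt0.
have sub w : normc (w - z1) <= rho -> in_square c L w.
  move=> wr; apply: in_square_ball; apply: (le_trans (normc_triangle w z1 c)).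
  by move: wr; rewrite /rho; lra.
(* Around z1 the perturbation is a constant on each circle plus the real part of a holomorphic
   linear function. With that function added to F, maximality at z1 reads Re G <= Re (G z1) - e
   rho^2 on the circle. *)
pose G w := F w + (2 * e)%:C * (conjc (z1 - c) * (w - z1)).
have dG w : normc (w - z1) <= rho -> cdiff G w.
  move=> wr; apply: cdiffD; first exact/dF/sub.
  apply: cdiffM; first exact: cdiff_cst.
  apply: cdiffM; first exact: cdiff_cst.
  by apply: cdiffB; [exact: cdiff_id|exact: cdiff_cst].
have [cG mG] := circle_mean rho0 dG.
have pi0 := @pi_gt0 R.
have : Re (segint (fun y => G (z1 + rho%:C * cis y)) 0 (2 * pi)) <=
    (2 * pi - 0) * (Re (G z1) - e * rho ^+ 2).
  apply: Re_segint_le => //; first by rewrite mulr_ge0// ltW.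
  move=> y _; pose k := rho%:C * cis y; have nk : normc k = rho.
    by rewrite normcM normc_cis mulr1 normc_real gtr0_norm.
  have zk : in_square c L (z1 + k) by apply: sub; rewrite addrAC subrr add0r nk.
  have := hz1 _ zk; rewrite /h /G -/k [z1 + k - z1]addrAC !subrr !mulr0 addr0 add0r.
  rewrite (_ : z1 + k - c = (z1 - c) + k); last by rewrite addrAC.
  rewrite sqr_normcD nk ReD [Re ((2 * e)%:C * _)]ReM /= mul0r subr0.
  lra.
rewrite mG subr0 ReM /= mul0r subr0 ler_pM2l ?mulr_gt0//.
have : 0 < e * rho ^+ 2 by rewrite mulr_gt0// exprn_gt0.
lra.
Qed.

(* Apply the maximum principle to f / (z - c)^k, which is regular at c since f
   vanishes there, and let k tend to infinity. *)
Lemma unique_continuation_disc f c (r L : R) : 0 < r -> 0 < L ->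
  (forall z, in_square c L z -> cdiff f z) ->
  (forall z, normc (z - c) < r -> f z = 0) ->
  forall z, normc (z - c) < L -> f z = 0.
Proof.
move=> r0 L0 df f0 z zL.
have [zc|zc] := eqVneq z c; first by apply: f0; rewrite zc subrr normc0.
have zL' : in_square c L z by exact/in_square_ball/ltW.
have [z1 z1L hz1] : exists2 z, in_square c L z &
    forall w, in_square c L w -> normc (f w) <= normc (f z).
  apply: square_EVT; first exact: ltW.
  move=> w wL e e0; have [s s0 hs] := cdiff_continuous (df _ wL) e0.
  exists s => // v /hs; apply: le_lt_trans; rewrite ler_norml; apply/andP; split.
    by have := normc_triangle (f w) (f v) 0; rewrite !subr0 (normcBC (f w)); lra.
  by have := normc_triangle (f v) (f w) 0; rewrite !subr0; lra.
pose M := normc (f z1).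
have bound k : normc (f z) <= M * (normc (z - c) / L) ^+ k.
  pose F w := f w / (w - c) ^+ k.
  have dF w : in_square c L w -> cdiff F w.
    (* Near c, and at c itself, the quotient is the zero function, because f vanishes there. *)
    move=> wL; have [wc|wc] := eqVneq w c.
      apply: (@cdiff_near _ (fun=> 0)); last exact: cdiff_cst.
      by exists r => // v; rewrite wc /F => /f0 ->; rewrite mul0r.
    apply: cdiffM; first exact: df.
    apply: cdiffV; first by rewrite expf_neq0// subr_eq0.
    by apply/cdiffX/cdiffB; [exact: cdiff_id|exact: cdiff_cst].
  have [Fz0|Fz] := eqVneq (F z) 0.
    have -> : f z = 0.
      move/eqP: Fz0; rewrite mulf_eq0 => /orP[/eqP //|].
      by rewrite invr_eq0 expf_eq0 subr_eq0 (negbTE zc) andbF.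
    by rewrite normc0 mulr_ge0 ?normc_ge0// exprn_ge0// divr_ge0 ?normc_ge0// ltW.
  (* The maximum principle bounds real parts only; multiplication by [u] rotates F z onto its
     modulus. *)
  pose u := (normc (F z))%:C / F z.
  have nu : normc u = 1.
    by rewrite normcM normcV normc_real ger0_norm ?normc_ge0// mulfV// gt_eqF// normc_gt0.
  have : Re (u * F z) <= M / L ^+ k.
    apply: (@maximum_principle (fun w => u * F w) c L) => //; first exact: ltW.
      by move=> w wL; apply: cdiffM; [exact: cdiff_cst|exact: dF].
    move=> w wL Lw; apply: (le_trans (ler_norm _)); apply: (le_trans (ler_Re_normc _)).
    rewrite normcM nu mul1r normcM normcV normcX; apply: ler_pM; rewrite ?normc_ge0 ?invr_ge0//.
    - by rewrite exprn_ge0// normc_ge0.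
    - exact: hz1.
    - rewrite lef_pV2 ?posrE ?exprn_gt0//; last exact: lt_le_trans Lw.
      by rewrite lerXn2r// nnegrE ?normc_ge0// ltW.
  rewrite /u mulrAC -mulrA mulfV// mulr1 /= {1}/F normcM normcV normcX.
  have n0 : 0 < normc (z - c) by rewrite normc_gt0 subr_eq0.
  by rewrite ler_pdivrMr ?exprn_gt0// expr_div_n mulrCA mulrA mulrC mulrA.
apply: eq0_normc; apply/eqP; rewrite eq_le normc_ge0 andbT.
have [M0|M0] := leP M 0.
  have := bound 0%N; rewrite expr0 mulr1 => /le_trans; exact.
apply/ler_addgt0Pr => e e0; rewrite add0r.
have q0 : 0 <= normc (z - c) / L by rewrite divr_ge0 ?normc_ge0// ltW.
have : (fun k => (normc (z - c) / L) ^+ k) @ \oo --> (0 : R).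
  by apply: cvg_expr; rewrite ger0_norm// ltr_pdivrMr// mul1r.
move=> /cvgrPdist_lt/(_ _ (divr_gt0 e0 M0))[k _ /(_ k (leqnn k))] /=.
rewrite sub0r normrN ger0_norm ?exprn_ge0// ltr_pdivlMr// mulrC => /ltW.
exact: le_trans (bound k).
Qed.

End maximum_principle.

(** * Laplace transforms, Gaussians and the Gamma function *)

Section laplace.
Context {R : realType}.
Local Notation C := R[i].
Local Notation lambda := (@lebesgue_measure R).
Implicit Types (g : R -> C) (s h : C) (v a b : R).

Lemma cderive_quadratic (f : C -> C) z d (K r : R) : 0 < r ->
  (forall h, normc h < r -> normc (f (z + h) - f z - d * h) <= K * normc h ^+ 2) ->
  cderive f z d.
Proof.
move=> r0 fK e e0; have K1 : 0 < `|K| + 1 by rewrite ltr_wpDl.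
exists (Num.min r (e / (`|K| + 1))) => [|h]; first by rewrite lt_min r0 divr_gt0.
rewrite lt_min => /andP[hr he]; apply: (le_trans (fK h hr)).
rewrite expr2 mulrA; apply: ler_wpM2r; first exact: normc_ge0.
move: he; rewrite ltr_pdivlMr// mulrC => /ltW; apply: le_trans.
apply: ler_wpM2r; first exact: normc_ge0.
by rewrite (le_trans (ler_norm K))// lerDl.
Qed.

Definition laplace g s := cint lambda (fun v => cexp (s * v%:C) * g v).

(** Absolute convergence is required on the two edges of a strip only; [expR_between] carries it to
    the interior. *)
Definition laplace_dom g a b := [/\ cmeasurable g,
  lambda.-integrable setT (EFin \o (fun v => expR (a * v) * normc (g v))) &
  lambda.-integrable setT (EFin \o (fun v => expR (b * v) * normc (g v)))].

Lemma laplace_dom_sum g a b : laplace_dom g a b ->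
  lambda.-integrable setT (EFin \o (fun v => (expR (a * v) + expR (b * v)) * normc (g v))).
Proof.
move=> [_ ia ib]; rewrite (_ : _ \o _ = (fun v => (expR (a * v) * normc (g v))%:E +
  (expR (b * v) * normc (g v))%:E)%E); first exact: integrableD.
by apply/funext => v /=; rewrite mulrDl EFinD.
Qed.

Lemma expR_between (sigma a b v : R) : a <= sigma <= b ->
  expR (sigma * v) <= expR (a * v) + expR (b * v).
Proof.
move=> /andP[as_ sb]; have [v0|v0] := leP 0 v.
  by rewrite (le_trans (y := expR (b * v)))// ?ler_expR ?ler_wpM2r// lerDr expR_ge0.
rewrite (le_trans (y := expR (a * v)))// ?lerDl ?expR_ge0//.
by rewrite ler_expR ler_wnM2r// ltW.
Qed.

Lemma cmeasurable_cexp_lin s : cmeasurable (fun v : R => cexp (s * v%:C)).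
Proof.
apply: cmeasurable_cexp; apply: cmeasurableM; first exact: cmeasurable_cst.
by apply: cmeasurable_real; exact: measurable_id.
Qed.

Lemma normc_cexp_lin s v : normc (cexp (s * v%:C)) = expR (Re s * v).
Proof. by rewrite normc_cexp ReM /= mulr0 subr0. Qed.

Lemma laplace_integrable g a b s : laplace_dom g a b -> a <= Re s <= b ->
  cintegrable lambda (fun v => cexp (s * v%:C) * g v).
Proof.
move=> gab sab; have [mg _ _] := gab.
apply: (cintegrable_dom _ (laplace_dom_sum gab)).
  by apply: cmeasurableM => //; exact: cmeasurable_cexp_lin.
move=> v; rewrite normcM normc_cexp_lin; apply: ler_wpM2r; first exact: normc_ge0.
exact: expR_between.
Qed.

Lemma sqr_expR_le (d x : R) : 0 < d -> x ^+ 2 <= 4 / d ^+ 2 * expR (d * `|x|).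
Proof.
move=> d0; rewrite mulrAC ler_pdivlMr ?exprn_gt0// -(real_normK (num_real x)).
rewrite -exprMn mulrC; set y := d * `|x|.
have y0 : 0 <= y by rewrite mulr_ge0// ltW.
rewrite (_ : expR y = expR (y / 2) ^+ 2); last by rewrite -expRM_natl; congr expR; field.
rewrite (_ : 4 = 2 ^+ 2); last by rewrite -natrX.
rewrite -exprMn lerXn2r// ?nnegrE ?mulr_ge0 ?expR_ge0//.
by have := expR_ge1Dx (y / 2); lra.
Qed.

(** Differentiation under the integral sign: the second-order remainder of [cexp] is dominated,
    uniformly for |h| < del, by |h|^2 times a multiple of the weights at the two edges. *)
Lemma cdiff_laplace g a b s : laplace_dom g a b -> a < Re s < b -> cdiff (laplace g) s.
Proof.
move=> gab /andP[a_s sb]; have [mg _ _] := gab; have ig := laplace_dom_sum gab.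
(* Half the distance to the nearer edge: one [del] absorbs the factor v^2, the other absorbs exp(|h
   v|). *)
pose del := Num.min (Re s - a) (b - Re s) / 2.
have del0 : 0 < del by rewrite divr_gt0// lt_min !subr_gt0 a_s.
have del_a : a <= Re s - 2 * del.
  have : Num.min (Re s - a) (b - Re s) <= Re s - a by rewrite ge_min lexx.
  by rewrite /del; lra.
have del_b : Re s + 2 * del <= b.
  have : Num.min (Re s - a) (b - Re s) <= b - Re s by rewrite ge_min lexx orbT.
  by rewrite /del; lra.
pose W v := expR (a * v) + expR (b * v).
have W1 v : expR (Re s * v) * expR (2 * del * `|v|) <= W v.
  rewrite -expRD; have [v0|v0] := leP 0 v.
    rewrite ger0_norm// -mulrDl; apply: expR_between.
    by apply/andP; split => //; lra.
  rewrite ltr0_norm// mulrN -mulrBl; apply: expR_between.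
  by apply/andP; split => //; lra.
pose K := 4 / del ^+ 2.
have K0 : 0 <= K by rewrite divr_ge0// sqr_ge0.
have W2 v : v ^+ 2 * expR (del * `|v|) * expR (Re s * v) <= K * W v.
  apply: (le_trans (y := K * expR (del * `|v|) * expR (del * `|v|) * expR (Re s * v))).
    apply: ler_wpM2r; first exact: expR_ge0.
    apply: ler_wpM2r; first exact: expR_ge0.
    exact: sqr_expR_le.
  have E2 : expR (del * `|v|) * expR (del * `|v|) = expR (2 * del * `|v|).
    by rewrite -expRD; congr expR; ring.
  rewrite (_ : K * _ * _ * _ = K * (expR (Re s * v) * expR (2 * del * `|v|))).
    exact: ler_wpM2l.
  by rewrite -E2; ring.
have W3 v : `|v| * expR (Re s * v) <= (1 + K) * W v.
  have e1 : 1 <= expR (del * `|v|) by rewrite -expR0 ler_expR mulr_ge0// ltW.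
  have s0 := expR_ge0 (Re s * v).
  have vv : `|v| <= 1 + v ^+ 2.
    by rewrite -(real_normK (num_real v)); have := sqr_ge0 (`|v| - 1); nra.
  apply: (le_trans (y := (1 + v ^+ 2) * expR (Re s * v))); first exact: ler_wpM2r.
  rewrite !mulrDl !mul1r; apply: lerD; first by apply: expR_between; rewrite !ltW.
  apply: le_trans (W2 v); apply: ler_wpM2r => //.
  by rewrite ler_peMr// sqr_ge0.
have is_ := @laplace_integrable g a b s gab.
rewrite !ltW// in is_; have {}is_ := is_ isT.
have iZ (k : R) : lambda.-integrable setT (EFin \o (fun v => k * (W v * normc (g v)))).
  rewrite (_ : _ \o _ = (fun v => k%:E * (W v * normc (g v))%:E)%E); first exact: integrableZl.
  by apply/funext => v /=; rewrite EFinM.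
have id_ : cintegrable lambda (fun v => v%:C * (cexp (s * v%:C) * g v)).
  apply: (cintegrable_dom _ (iZ (1 + K))).
  - apply: cmeasurableM; first by apply: cmeasurable_real; exact: measurable_id.
    by apply: cmeasurableM => //; exact: cmeasurable_cexp_lin.
  - move=> v; rewrite normcM [normc (_ * g v)]normcM normc_real normc_cexp_lin !mulrA.
    by apply: ler_wpM2r; [exact: normc_ge0|exact: W3].
exists (cint lambda (fun v => v%:C * (cexp (s * v%:C) * g v))).
apply: (@cderive_quadratic _ _ _ (2 * (4 * (K * \int[lambda]_v (W v * normc (g v))))) del) => // h hd.
have ih : cintegrable lambda (fun v => cexp ((s + h) * v%:C) * g v).
  apply: (laplace_integrable gab); rewrite ReD; have := ler_Re_normc h; rewrite ler_norml.
  by move=> /andP[? ?]; apply/andP; split; lra.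
rewrite /laplace mulrC -cintZ// -!cintB//; last 2 first.
- exact: cintegrableB.
- exact: cintegrableZ.
have -> : 2 * (4 * (K * \int[lambda]_v (W v * normc (g v)))) * normc h ^+ 2 =
    2 * \int[lambda]_v ((4 * K * normc h ^+ 2) * (W v * normc (g v))).
  by rewrite RintegralZl//; ring.
apply: normc_cint_le.
- by apply: cintegrableB; [exact: cintegrableB|exact: cintegrableZ].
- exact: iZ.
move=> v; rewrite mulrDl cexpD.
rewrite (_ : _ - _ - _ = cexp (s * v%:C) * (cexp (h * v%:C) - 1 - h * v%:C) * g v); last by ring.
rewrite normcM [normc (cexp _ * _)]normcM normc_cexp_lin [leRHS]mulrA; apply: ler_wpM2r; first exact: normc_ge0.
have := ler_cexpB2 (h * v%:C); rewrite normcM normc_real => hb.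
apply: (le_trans (y := expR (Re s * v) * (4 * (normc h * `|v|) ^+ 2 * expR (del * `|v|)))).
  apply: ler_wpM2l; first exact: expR_ge0.
  apply: (le_trans hb); apply: ler_wpM2l.
    by apply: mulr_ge0 => //; exact: sqr_ge0.
  by rewrite ler_expR ler_wpM2r// ltW.
rewrite exprMn (real_normK (num_real v)).
have n2 : 0 <= 4 * normc h ^+ 2 by apply: mulr_ge0 => //; exact: sqr_ge0.
have := ler_wpM2l n2 (W2 v); congr (_ <= _); ring.
Qed.

End laplace.

Section one_dimensional.
Context {R : realType}.
Local Notation C := R[i].
Local Notation lambda := (@lebesgue_measure R).

Lemma integrable_cauchy : lambda.-integrable setT (EFin \o (fun x : R => (1 + x ^+ 2)^-1)).
Proof.
have c1 : continuous (fun x : R => (1 + x ^+ 2)^-1).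
  move=> x; apply: cvgV; first by rewrite gt_eqF// ltr_pwDl// sqr_ge0.
  by apply: cvgD; [exact: cvg_cst|exact: exprn_continuous].
have p1 (x : R) : 0 <= (1 + x ^+ 2)^-1 by rewrite invr_ge0 addr_ge0// sqr_ge0.
apply/integrableP; split.
  by apply/measurable_EFinP; exact: continuous_measurable_fun.
under eq_integral do rewrite /= ger0_norm//.
rewrite ge0_symfun_integralT//; last by move=> x /=; rewrite sqrrN.
rewrite (_ : [set x | _] = `[0, +oo[%classic); last first.
  by apply/seteqP; split => x /=; rewrite in_itv /= andbT.
rewrite (@ge0_continuous_FTC2y _ _ (@atan R) 0 (pi / 2)).
- by rewrite atan0 -EFinB -EFinM ltry.
- by [].
- exact: continuous_subspaceT.
- exact: cvgy_atan.
- by move=> x _; exact: derivable_atan.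
- apply: cvg_at_right_filter; exact: continuous_atan.
- by move=> x _; rewrite derive1_atan.
Qed.

Lemma integrable_expR_norm (k : R) : 0 < k ->
  lambda.-integrable setT (EFin \o (fun v => expR (- k * `|v|))).
Proof.
move=> k0; pose K := 4 / k ^+ 2 + 1.
have mf : measurable_fun setT (fun v : R => expR (- k * `|v|)).
  apply: measurableT_comp => //; apply: measurable_funM; first exact: measurable_cst.
  exact: normr_measurable.
have iK : lambda.-integrable setT (EFin \o (fun v : R => K * (1 + v ^+ 2)^-1)).
  rewrite (_ : _ \o _ = (fun v => K%:E * ((1 + v ^+ 2)^-1)%:E)%E).
    exact: (integrableZl _ _ integrable_cauchy).
  by apply/funext => v /=; rewrite EFinM.
apply: (integrable_dom _ iK) => // v; rewrite ger0_norm ?expR_ge0// mulNr expRN.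
have v1 : 0 < 1 + v ^+ 2 by rewrite ltr_pwDl// sqr_ge0.
rewrite -[K]invrK -invfM lef_pV2 ?posrE ?expR_gt0// ?mulr_gt0 ?invr_gt0//; last first.
  by rewrite /K ltr_wpDl// divr_ge0// sqr_ge0.
rewrite mulrC ler_pdivrMr; last by rewrite /K ltr_wpDl// divr_ge0// sqr_ge0.
rewrite /K mulrDr mulr1 addrC; apply: lerD.
  by rewrite mulrC; exact: sqr_expR_le.
by rewrite -expR0 ler_expR mulr_ge0// ltW.
Qed.

(** Up to its peak, the integrand is the density of the normal law with mean m and variance
    1/(2t). *)
Lemma gaussian_integral (t m : R) : 0 < t ->
  lambda.-integrable setT (EFin \o (fun x => expR (- t * (x - m) ^+ 2))) /\
  \int[lambda]_x expR (- t * (x - m) ^+ 2) = Num.sqrt (pi / t).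
Proof.
move=> t0; pose sg := (Num.sqrt (2 * t))^-1.
have sg0 : 0 < sg by rewrite invr_gt0 sqrtr_gt0 mulr_gt0.
have sgn0 : sg != 0 by rewrite gt_eqF.
have sg2 : sg ^+ 2 = (2 * t)^-1 by rewrite exprVn sqr_sqrtr// mulr_ge0// ltW.
have pE : normal_peak sg = (Num.sqrt (pi / t))^-1.
  rewrite /normal_peak sg2; congr (Num.sqrt _)^-1.
  by rewrite -mulr_natl; field; exact: lt0r_neq0.
have pk : 0 < Num.sqrt (pi / t) by rewrite sqrtr_gt0 divr_gt0// pi_gt0.
have E x : normal_pdf m sg x = (Num.sqrt (pi / t))^-1 * expR (- t * (x - m) ^+ 2).
  rewrite normal_pdfE// pE /normal_fun sg2; congr (_ * expR _).
  by rewrite -mulr_natl; field; exact: lt0r_neq0.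
have ipdf := integrable_normal_pdf m sg.
have E' x : expR (- t * (x - m) ^+ 2) = Num.sqrt (pi / t) * normal_pdf m sg x.
  by rewrite E mulVKf// gt_eqF.
split.
  rewrite (_ : _ \o _ = (fun x => (Num.sqrt (pi / t))%:E * (normal_pdf m sg x)%:E)%E).
    exact: integrableZl.
  by apply/funext => x /=; rewrite E' EFinM.
under eq_Rintegral do rewrite E'.
rewrite RintegralZl//; rewrite /Rintegral integral_normal_pdf//=; exact: mulr1.
Qed.

End one_dimensional.

(** * The Fourier transform of the Gaussian *)

Section gauss_fourier.
Context {R : realType}.
Local Notation C := R[i].
Local Notation lambda := (@lebesgue_measure R).

Lemma cderive0_vertical (h : C -> C) : (forall s, cderive h s 0) ->
  forall y : R, h (0 +i* y) = h 0.
Proof.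
move=> dh y.
(* The 1-Lipschitz function [p] stands for the real or the imaginary part. *)
have der (p : C -> R) : (forall x y, `|p x - p y| <= normc (x - y)) ->
    forall t, is_derive t (1:R) (fun y => p (h (0 +i* y))) 0.
  move=> hp t.
  suff : (fun k : R => k^-1 *: (p (h (0 +i* (k *: (1:R) + t))) - p (h (0 +i* t)))) @ 0^' --> (0 : R).
    move=> hc; apply: DeriveDef; first by apply/cvg_ex; exists 0.
    by apply: cvg_lim.
  apply/cvgrPdist_le => e e0; have [r r0 hr] := dh (0 +i* t) _ e0.
  rewrite /dnbhs /within /=; apply/nbhs_ballP; exists r => // k; rewrite /ball /= sub0r normrN => kr k0.
  rewrite sub0r normrN normrM normfV ler_pdivrMl ?normr_gt0// mulrC.
  apply: (le_trans (hp _ _)).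
  have := hr (0 +i* k); rewrite normc_i => /(_ kr); rewrite mul0r subr0.
  by rewrite (_ : (0 +i* t) + (0 +i* k) = (0 +i* (k *: (1 : R) + t)))//;
    apply: complex_eq; rewrite reim /= ?addr0 // /GRing.scale /= mulr1 addrC.
have hRe := @mean_value_any _ _ (fun=> 0) 0 y (der _ (fun x y => eq_ind _ (fun z => `|z| <= _) (ler_Re_normc (x - y)) _ (ReB x y))).
have hIm := @mean_value_any _ _ (fun=> 0) 0 y (der _ (fun x y => eq_ind _ (fun z => `|z| <= _) (ler_Im_normc (x - y)) _ (ImB x y))).
have [_ [_ _]] := hRe; rewrite mul0r => /eqP; rewrite subr_eq0 => /eqP E1.
have [_ [_ _]] := hIm; rewrite mul0r => /eqP; rewrite subr_eq0 => /eqP E2.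
exact: complex_eq.
Qed.

Definition gauss (t : R) : R -> C := fun x => (expR (- t * x ^+ 2))%:C.

Lemma gauss_laplace_dom t a b : 0 < t -> laplace_dom (gauss t) a b.
Proof.
move=> t0.
have key c : lambda.-integrable setT (EFin \o (fun v => expR (c * v) * normc (gauss t v))).
  have [ig _] := gaussian_integral (c / (2 * t)) t0.
  rewrite (_ : _ \o _ = (fun v => (expR (c ^+ 2 / (4 * t)))%:E *
     (expR (- t * (v - c / (2 * t)) ^+ 2))%:E)%E).
    exact: integrableZl.
  apply/funext => v /=; rewrite -EFinM; congr EFin.
  rewrite expr0n addr0 sqrtr_sqr ger0_norm ?expR_ge0// -!expRD; congr expR.
  by field; exact: lt0r_neq0.
split => //; apply: cmeasurable_real; apply: measurableT_comp => //.
by apply: measurable_funM; [exact: measurable_cst|exact: measurable_funX].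
Qed.

(* The function s |-> L(s) exp(-s^2/4t), L the Laplace transform of the
   Gaussian, is holomorphic and, by completing the square, invariant under real
   translations; hence its derivative vanishes. *)
Lemma gauss_fourier (t xi : R) : 0 < t ->
  cintegrable lambda (fun x => gauss t x * cis (x * xi)) /\
  cint lambda (fun x => gauss t x * cis (x * xi)) =
  (Num.sqrt (pi / t) * expR (- xi ^+ 2 / (4 * t)))%:C.
Proof.
move=> t0; have gd a b := gauss_laplace_dom a b t0.
pose L := laplace (gauss t); pose q s : C := - ((4 * t)^-1)%:C * (s * s).
pose h s := L s * cexp (q s).
have gi s : cintegrable lambda (fun v => cexp (s * v%:C) * gauss t v).
  by apply: (laplace_integrable (gd (Re s) (Re s))); rewrite lexx.
(* Translating the integration variable by b/(2t) completes the square. *)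
have shiftL s b : L (s + b%:C) = cexp (s * (b / (2 * t))%:C + (b ^+ 2 / (4 * t))%:C) * L s.
  rewrite /L /laplace -cintZ//.
  have [_ <-] := cint_shift (b / (2 * t)) (gi (s + b%:C)).
  apply: eq_cint => x; rewrite /gauss -!cexp_real -!cexpD; congr cexp.
  apply: complex_eq; rewrite !reim /=; field; exact: lt0r_neq0.
have dh s : cdiff h s.
  apply: cdiffM; first by apply: (cdiff_laplace (gd (Re s - 1) (Re s + 1))); apply/andP; split; lra.
  apply: cdiff_comp (cdiff_cexp _); apply: cdiffM; first exact: cdiff_cst.
  by apply: cdiffM; exact: cdiff_id.
have per s b : h (s + b%:C) = h s.
  rewrite /h shiftL -mulrA mulrCA -cexpD; congr (_ * cexp _).
  by rewrite /q; apply: complex_eq; rewrite !reim /=; field; exact: lt0r_neq0.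
have h0 s : cderive h s 0.
  have [d hd] := dh s; suff -> : 0 = d by [].
  apply/esym/(@normc_le_ball _ _ 1) => // e e0; rewrite mul1r.
  have [r r0 hr] := hd _ e0.
  have := hr (r / 2)%:C; rewrite normc_real ger0_norm ?divr_ge0 ?(ltW r0)//.
  rewrite per subrr sub0r normcN normcM normc_real ger0_norm ?divr_ge0 ?(ltW r0)//.
  rewrite ler_pM2r ?divr_gt0//; apply; lra.
have E := cderive0_vertical h0 xi.
have gE : (fun x => gauss t x * cis (x * xi)) = (fun v => cexp ((0 +i* xi) * v%:C) * gauss t v).
  apply/funext => x; rewrite mulrC; congr (_ * _).
  by rewrite /cexp !reim /= !mul0r mulr0 subrr add0r expR0 mul1r mulrC.
rewrite gE; split => //.
have L0 : L 0 = (Num.sqrt (pi / t))%:C.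
  rewrite /L /laplace; under eq_cint do rewrite mul0r cexp0 mul1r.
  rewrite /gauss cint_real; congr (_%:C).
  have [_ <-] := gaussian_integral 0 t0.
  by apply: eq_Rintegral => x _; rewrite subr0.
move: E; rewrite /h /q mul0r mulr0 cexp0 mulr1 L0.
rewrite (_ : _ * ((0 +i* xi) * _) = (xi ^+ 2 / (4 * t))%:C); last first.
  by apply: complex_eq; rewrite !reim /=; field; exact: lt0r_neq0.
rewrite cexp_real => E.
have e0 : (expR (xi ^+ 2 / (4 * t)))%:C != 0 :> C by rewrite -cexp_real cexp_neq0.
apply: (mulIf e0); rewrite -/(laplace _ _) -/L E -rmorphM /= -mulrA -expRD.
by rewrite mulNr addNr expR0 mulr1.
Qed.

End gauss_fourier.

(** * The Gamma function and the Laplace transform of the Heaviside function *)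

Section gamma.
Context {R : realType}.
Local Notation C := R[i].
Local Notation lambda := (@lebesgue_measure R).

Definition gamma_kernel (v : R) : C := (expR (- expR v))%:C.

(* Euler's integral of t^(s-1) exp(-t) in the variable v = ln t; likewise below,
   Mellin transforms in t appear as Laplace transforms in v. *)
Definition cgamma : C -> C := laplace gamma_kernel.

(** As v tends to +oo, exp(-t) <= N! / t^N with t = exp v and N > s gives decay at rate N - s; as v
    tends to -oo, exp(s v) decays at rate s. *)
Lemma expR_expR_bound (s : R) : 0 < s -> exists k K : R, [/\ 0 < k &
  forall v, expR (s * v) * expR (- expR v) <= K * expR (- k * `|v|)].
Proof.
move=> s0; pose N := Num.bound s; have sN : s < N%:R by apply: archi_boundP; exact: ltW.
pose k := Num.min s (N%:R - s); have k0 : 0 < k by rewrite lt_min s0 subr_gt0.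
exists k, (1 + (N`!)%:R); split => // v.
have F0 : 0 <= (N`!)%:R :> R by [].
have [v0|v0] := leP 0 v.
  rewrite ger0_norm//; apply: (@le_trans _ _ ((N`!)%:R * expR (- k * v))); last first.
    by rewrite ler_wpM2r ?expR_ge0// lerDr.
  have : expR v ^+ N / (N`!)%:R <= expR (expR v).
    have [|N0] := posnP N; first by move=> E; move: sN; rewrite E; lra.
    have := expR_ge1Dxn N.-1 (expR_ge0 v); rewrite prednK// => h.
    by apply: le_trans h; rewrite lerDr.
  rewrite ler_pdivrMr ?ltr0n ?fact_gt0// -expRM_natl => hN.
  rewrite (expRN (expR v)) ler_pdivrMr ?expR_gt0//.
  apply: (@le_trans _ _ (expR (- k * v) * expR (N%:R * v))).
    rewrite -expRD ler_expR -mulrDl ler_wpM2r//.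
    have : k <= N%:R - s by rewrite ge_min lexx orbT.
    lra.
  rewrite [leRHS]mulrAC [leRHS]mulrC; apply: ler_wpM2l; first exact: expR_ge0.
  by rewrite [leRHS]mulrC.
rewrite ltr0_norm// mulrNN.
apply: (@le_trans _ _ (1 * expR (k * v))); last by rewrite ler_wpM2r ?expR_ge0// lerDl.
rewrite mul1r -[leRHS]mulr1; apply: ler_pM; rewrite ?expR_ge0//.
  by rewrite ler_expR; apply: ler_wnM2r; [exact: ltW|rewrite ge_min lexx].
Qed.

Lemma measurable_gamma_kernel : cmeasurable (gamma_kernel : R -> C).
Proof.
apply: cmeasurable_real; apply: measurableT_comp => //; apply: measurableT_comp => //.
Qed.

Lemma normc_gamma_kernel v : normc (gamma_kernel v) = expR (- expR v).
Proof. by rewrite normc_real ger0_norm ?expR_ge0. Qed.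

Lemma gamma_kernel_integrable (s : R) : 0 < s ->
  lambda.-integrable setT (EFin \o (fun v => expR (s * v) * normc (gamma_kernel v))).
Proof.
move=> s0; have [k [K [k0 h]]] := expR_expR_bound s0.
have ik : lambda.-integrable setT (EFin \o (fun v : R => K * expR (- k * `|v|))).
  rewrite (_ : _ \o _ = (fun v => K%:E * (expR (- k * `|v|))%:E)%E).
    exact: (integrableZl _ _ (integrable_expR_norm k0)).
  by apply/funext => v /=; rewrite EFinM.
have mf : measurable_fun setT (fun v : R => expR (s * v) * normc (gamma_kernel v)).
  apply: measurable_funM; last by apply: measurable_normc; exact: measurable_gamma_kernel.
  by apply: measurableT_comp => //; exact: measurable_funM.
apply: (integrable_dom _ ik) => // v.
by rewrite normc_gamma_kernel ger0_norm ?mulr_ge0 ?expR_ge0//; exact: h.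
Qed.

Lemma gamma_laplace_dom (a b : R) : 0 < a -> 0 < b -> laplace_dom gamma_kernel a b.
Proof.
move=> a0 b0; split; first exact: measurable_gamma_kernel.
  exact: (gamma_kernel_integrable a0).
exact: (gamma_kernel_integrable b0).
Qed.

Lemma cdiff_cgamma s : 0 < Re s -> cdiff cgamma s.
Proof.
move=> s0; apply: (@cdiff_laplace _ _ (Re s / 2) (Re s + 1)).
  by apply: gamma_laplace_dom; lra.
by apply/andP; split; lra.
Qed.

(** The substitution t = exp v is made on the segments [-(k+1), k+1] and extended to the whole line
    by monotone convergence. *)
Lemma cgamma_real (s : R) : 0 < s -> cgamma s%:C = (Gamma s)%:C.
Proof.
move=> s0; pose G (t : R) := expR ((s - 1) * ln t) * expR (- t).
have G0 t : 0 <= G t by rewrite mulr_ge0 ?expR_ge0.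
have cG t : 0 < t -> {for t, continuous G}.
  move=> t0; apply: cvgM.
    apply: continuous_comp; last exact: continuous_expR.
    by apply: cvgM; [exact: cvg_cst|exact: continuous_ln].
  by apply: continuous_comp; [exact: oppr_continuous|exact: continuous_expR].
have -> : Gamma s = \int[lambda]_(t in `]0%R, +oo[) G t.
  apply: eq_Rintegral => t; rewrite inE /= in_itv /= andbT => t0.
  by rewrite /powR gt_eqF.
have -> : cgamma s%:C = (\int[lambda]_v (G (expR v) * expR v))%:C.
  rewrite -cint_real; apply: eq_cint => v.
  rewrite /gamma_kernel -rmorphM /= cexp_real -rmorphM /=; congr (_%:C).
  rewrite /G expRK mulrAC; congr (_ * _).
  by rewrite -expRD; congr expR; ring.
have decN k : (- k.+1%:R <= k.+1%:R :> R) by rewrite (@le_trans _ _ 0)// oppr_le0.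
have sub k : (\int[lambda]_(t in `[expR (- k.+1%:R), expR k.+1%:R]) (G t)%:E =
   \int[lambda]_(v in `[(- k.+1%:R)%R, k.+1%:R]) (G (expR v) * expR v)%:E)%E.
  have := @integration_by_substitution_increasing R expR G (- k.+1%:R) k.+1%:R (decN k).
  have E : (expR : R -> R)^`()%classic = (expR : R -> R) by apply/funext => x; rewrite derive1E; exact: (@derive_val _ _ _ _ _ _ _ (is_derive_expR x)).
  rewrite E; apply.
  - by move=> x y _ _; rewrite ltr_expR.
  - by move=> x _; exact: continuous_expR.
  - by apply: cvgP; apply: cvg_at_right_filter; exact: continuous_expR.
  - by apply: cvgP; apply: cvg_at_left_filter; exact: continuous_expR.
  - split; first by move=> x _; exact: derivable_expR.
      by apply: cvg_at_right_filter; exact: continuous_expR.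
    by apply: cvg_at_left_filter; exact: continuous_expR.
  - apply: continuous_in_subspaceT => x; rewrite inE /= in_itv /= => /andP[h _].
    by apply: cG; apply: lt_le_trans h; exact: expR_gt0.
congr (_%:C); rewrite /Rintegral; congr fine.
have mH : measurable_fun setT (fun v : R => G (expR v) * expR v).
  apply: continuous_measurable_fun => v; apply: cvgM; last exact: continuous_expR.
  by apply: continuous_comp; [exact: continuous_expR|apply: cG; exact: expR_gt0].
have natle (j k : nat) : (j <= k)%N -> (j.+1%:R <= k.+1%:R :> R) by rewrite ler_nat.
have e1 : \bigcup_k `[(- k.+1%:R)%R, k.+1%:R]%classic = [set: R].
  apply/seteqP; split => // v _; exists (Num.bound `|v|) => //=.
  rewrite in_itv /= -ler_norml ltW// (lt_trans (archi_boundP _))// ltr_nat//.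
have e2 : \bigcup_k `[expR (- k.+1%:R), expR k.+1%:R]%classic = `]0, +oo[%classic :> set R.
  apply/seteqP; split => [v [k _]|v] /=; rewrite !in_itv /= ?andbT.
    by move=> /andP[h _]; apply: lt_le_trans h; exact: expR_gt0.
  move=> v0; exists (Num.bound `|ln v|) => //=; rewrite in_itv /=.
  set k := Num.bound _; have : `|ln v| <= k.+1%:R.
    by rewrite ltW// (lt_trans (archi_boundP _))// ltr_nat.
  by rewrite ler_norml => /andP[h1 h2]; rewrite -[v]lnK ?posrE// !ler_expR h1.
have c1 : (\int[lambda]_(v in `[(- k.+1%:R)%R, k.+1%:R]) (G (expR v) * expR v)%:E)%E
    @[k --> \oo] --> (\int[lambda]_v (G (expR v) * expR v)%:E)%E.
  rewrite -e1; apply: ge0_nondecreasing_set_cvg_integral => //.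
  - by move=> i j ij; rewrite subsetEset => v /=; rewrite !in_itv /= => /andP[h1 h2];
    apply/andP; split; have := natle _ _ ij; lra.
  - by move=> k; apply/measurable_EFinP; exact: measurable_funTS.
  - by move=> k v _; rewrite lee_fin mulr_ge0 ?expR_ge0.
have c2 : (\int[lambda]_(v in `[expR (- k.+1%:R), expR k.+1%:R]) (G v)%:E)%E
    @[k --> \oo] --> (\int[lambda]_(v in `]0%R, +oo[) (G v)%:E)%E.
  rewrite -e2; apply: ge0_nondecreasing_set_cvg_integral => //.
  - move=> i j ij; rewrite subsetEset => v /=; rewrite !in_itv /= => /andP[h1 h2].
    apply/andP; split; [apply: le_trans h1|apply: (le_trans h2)];
    by rewrite ler_expR ?lerN2 natle.
  - move=> k; apply/measurable_EFinP; apply: subspace_continuous_measurable_fun => //.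
    apply: continuous_in_subspaceT => x; rewrite inE /= in_itv /= => /andP[h _].
    by apply: cG; apply: lt_le_trans h; exact: expR_gt0.
  - by move=> k v _; rewrite lee_fin.
move: c2; rewrite (_ : (fun k => _) = fun k =>
  (\int[lambda]_(v in `[(- k.+1%:R)%R, k.+1%:R]) (G (expR v) * expR v)%:E)%E) => [c2|].
  exact: (cvg_unique _ c1 c2).
by apply/funext => k; exact: sub.
Qed.

(** In the variable v the integrand is at least exp(-exp 1) on [0, 1]. *)
Lemma Gamma_gt0 (s : R) : 0 < s -> 0 < Gamma s.
Proof.
move=> s0; have := cgamma_real s0.
pose f v := expR (s * v) * normc (gamma_kernel v).
have -> : cgamma s%:C = (\int[lambda]_v f v)%:C.
  rewrite -cint_real; apply: eq_cint => v.
  by rewrite -rmorphM /= cexp_real -rmorphM /= /f normc_gamma_kernel.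
move=> [<-]; pose c := expR (- expR 1 : R); have c0 : 0 < c by exact: expR_gt0.
have i1 : lambda.-integrable setT (EFin \o (fun v : R => c * \1_(`[0, 1] : set R) v)).
  rewrite (_ : _ \o _ = (fun v => c%:E * (\1_(`[0, 1] : set R) v)%:E)%E); last first.
    by apply/funext => v /=; rewrite EFinM.
  by apply: integrableZl => //; exact: (integrable_indic_itv 0 1 true false).
apply: (@lt_le_trans _ _ (\int[lambda]_v (c * \1_(`[0, 1] : set R) v))).
  rewrite RintegralZl//; last first.
    exact: (integrable_indic_itv 0 1 true false).
  rewrite mulr_gt0// /Rintegral integral_indic//= setIT lebesgue_measure_itv /= lte_fin ltr01.
  by rewrite oppr0 adde0.
apply: le_Rintegral => //; first exact: gamma_kernel_integrable.
move=> v _; rewrite indicE /f normc_gamma_kernel; case: (boolP (v \in _)) => [|_].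
  rewrite inE /= in_itv /= => /andP[v0 v1]; rewrite mulr1 -[leLHS]mul1r.
  apply: ler_pM; rewrite ?expR_ge0//.
    by rewrite -expR0 ler_expR mulr_ge0// ltW.
  by rewrite ler_expR lerN2 ler_expR.
by rewrite mulr0 mulr_ge0 ?expR_ge0.
Qed.

(** The indicator of t > 1 in the variable v = ln t. Its Laplace transform produces the simple poles
    of the continuation. *)
Definition step_kernel (v : R) : C := (0 < v)%R%:R.

Lemma normc_step_kernel v : normc (step_kernel v) = (0 < v)%R%:R.
Proof. exact: normc_nat. Qed.

Lemma measurable_step_kernel : cmeasurable (step_kernel : R -> C).
Proof.
have -> : (step_kernel : R -> C) = fun v => (\1_(`]0, +oo[ : set R) v)%:C.
  apply/funext => v; rewrite /step_kernel indicE natrC; congr (_%:R%:C); congr nat_of_bool.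
  by apply/idP/idP; rewrite inE /= in_itv /= andbT.
by apply: cmeasurable_real; exact: measurable_indic.
Qed.

Lemma step_laplace_dom (a b : R) : a < 0 -> b < 0 -> laplace_dom step_kernel a b.
Proof.
have key c : c < 0 -> lambda.-integrable setT (EFin \o (fun v => expR (c * v) * normc (step_kernel v))).
  move=> c0; have mc : 0 < - c by lra.
  have mf : measurable_fun setT (fun v : R => expR (c * v) * normc (step_kernel v)).
    apply: measurable_funM; last by apply: measurable_normc; exact: measurable_step_kernel.
    by apply: measurableT_comp => //; exact: measurable_funM.
  apply: (integrable_dom _ (integrable_expR_norm mc)) => // v.
  rewrite normc_step_kernel ger0_norm ?mulr_ge0 ?expR_ge0// opprK.
  have [v0|v0] := ltP 0 v; last by rewrite mulr0 expR_ge0.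
  by rewrite mulr1 gtr0_norm.
move=> a0 b0; split; [exact: measurable_step_kernel|exact: key|exact: key].
Qed.

(** Translating the integral L by b gives (1 - exp(z b)) L = int_{-b}^0 exp(z (v + b)) dv = b +
    O(b^2). Division by b leaves 1 + z L = O(b). *)
Lemma laplace_step z : Re z < 0 -> laplace step_kernel z = - z^-1.
Proof.
move=> z0; have sd := step_laplace_dom z0 z0.
have si : cintegrable lambda (fun v => cexp (z * v%:C) * step_kernel v).
  by apply: (laplace_integrable sd); rewrite lexx.
set L := laplace step_kernel z.
have zn0 : z != 0 by apply: contraTneq z0 => ->; rewrite /= ltxx.
suff h : 1 + z * L = 0.
  apply: (mulfI zn0); rewrite mulrN mulfV//.
  by apply/eqP; rewrite -subr_eq0 opprK addrC h.
pose N := normc z; pose K := 2 * (N + 4 * N ^+ 2 * expR N) + normc L * (4 * N ^+ 2 * expR N).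
have N0 : 0 <= N := normc_ge0 z.
have K0 : 0 <= K.
  by rewrite addr_ge0// ?mulr_ge0 ?addr_ge0 ?mulr_ge0 ?expR_ge0 ?exprn_ge0 ?normc_ge0.
apply: (@normc_le_ball _ _ K) => // e e0; pose b := Num.min 1 e.
have b0 : 0 < b by rewrite lt_min ltr01.
have b1 : b <= 1 by rewrite ge_min lexx.
apply: (@le_trans _ _ (K * b)); last by rewrite ler_wpM2l// ge_min lexx orbT.
rewrite -(ler_pM2r b0) -{1}(ger0_norm (ltW b0)) -normc_real -normcM.
have small (c : R) : `|c| <= b -> normc (cexp (z * c%:C) - 1 - z * c%:C) <= 4 * N ^+ 2 * expR N * b ^+ 2.
  move=> cb; apply: (le_trans (ler_cexpB2 _)); rewrite normcM normc_real -/N.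
  have c0 := normr_ge0 c.
  rewrite exprMn (_ : 4 * _ * _ * b ^+ 2 = 4 * (N ^+ 2 * b ^+ 2) * expR N); last by ring.
  apply: ler_pM; rewrite ?expR_ge0 ?mulr_ge0 ?exprn_ge0//.
    by rewrite ler_pM2l// ler_wpM2l ?exprn_ge0// ler_pXn2r// nnegrE ltW.
  by rewrite ler_expR ler_piMr// (le_trans cb).
have [si' E] := cint_shift b si.
pose J v : C := ((- b < v) && (v <= 0))%R%:R.
have JE v : step_kernel (v + b) = step_kernel v + J v.
  rewrite /step_kernel /J -ltrBlDr sub0r; have [v0|v0] := ltP 0 v.
    by rewrite (lt_trans _ v0) ?oppr_lt0//= addr0.
  by rewrite andbT add0r.
have JR v : J v = (\1_(`](- b)%R, 0%R] : set R) v)%:C.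
  rewrite /J indicE natrC; congr (_%:R%:C); congr nat_of_bool.
  by apply/idP/idP; rewrite inE /= in_itv /=.
have iJ : lambda.-integrable setT (EFin \o (\1_(`](- b)%R, 0%R] : set R) : R -> R)).
  exact: (integrable_indic_itv (- b) 0 false false).
have IJ : \int[lambda]_v (\1_(`](- b)%R, 0%R] : set R) v) = b.
  rewrite /Rintegral integral_indic//= setIT lebesgue_measure_itv /= lte_fin oppr_lt0 b0.
  by rewrite opprK add0e.
have cJ : cintegrable lambda J.
  by rewrite (_ : J = fun v => (\1_(`](- b)%R, 0%R] : set R) v)%:C);
    [exact: cintegrable_real|exact/funext].
have cintJ : cint lambda J = b%:C.
  by rewrite (funext JR) cint_real IJ.
have Eb v : cexp (z * (v + b)%:C) = cexp (z * b%:C) * cexp (z * v%:C).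
  by rewrite rmorphD /= mulrDr cexpD mulrC.
pose H v := cexp (z * (v + b)%:C) * J v.
have HE v : H v = cexp (z * (v + b)%:C) * step_kernel (v + b) -
    cexp (z * b%:C) * (cexp (z * v%:C) * step_kernel v).
  by rewrite JE /H Eb; ring.
have iH : cintegrable lambda H.
  rewrite (funext HE).
  by apply: cintegrableB => //; exact: cintegrableZ.
have cH : cint lambda H = (1 - cexp (z * b%:C)) * L.
  rewrite (funext HE) cintB//; last exact: cintegrableZ.
  by rewrite cintZ// E mulrBl mul1r.
have HJ : normc (cint lambda H - b%:C) <= 2 * (N + 4 * N ^+ 2 * expR N) * b ^+ 2.
  rewrite -cintJ -cintB//.
  have iB : lambda.-integrable setT (EFin \o (fun v : R =>
      ((N + 4 * N ^+ 2 * expR N) * b) * \1_(`](- b)%R, 0%R] : set R) v)).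
    rewrite (_ : _ \o _ = (fun v => ((N + 4 * N ^+ 2 * expR N) * b)%:E *
       (\1_(`](- b)%R, 0%R] : set R) v)%:E)%E); first exact: integrableZl.
    by apply/funext => v /=; rewrite EFinM.
  apply: (le_trans (normc_cint_le (cintegrableB iH cJ) iB _)).
    move=> v; rewrite /H; have := JR v.
    rewrite /J; case: andP => [[v1 v2]|_] JRv; last first.
      rewrite mulr0 subr0 normc0 indicE !mulr_ge0 ?addr_ge0 ?mulr_ge0 ?expR_ge0 ?exprn_ge0//.
      exact: ltW.
    have -> : (\1_(`](- b)%R, 0%R] : set R) v : R) = 1.
      by rewrite indicE mem_set//= in_itv /= v1.
    rewrite !mulr1.
    have vb : `|v + b| <= b by rewrite ger0_norm; lra.
    rewrite (_ : cexp _ - 1 = (cexp (z * (v + b)%:C) - 1 - z * (v + b)%:C) + z * (v + b)%:C); last by ring.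
    apply: (le_trans (normcD _ _)); rewrite mulrDl addrC; apply: lerD.
      by rewrite normcM normc_real; apply: ler_wpM2l.
    apply: (le_trans (small _ vb)); apply: ler_wpM2l.
      by rewrite !mulr_ge0 ?expR_ge0 ?exprn_ge0.
    by rewrite expr2 ler_piMr// ltW.
  by rewrite RintegralZl// IJ; lra.
have bb : `|b| <= b by rewrite ger0_norm// ltW.
have -> : (1 + z * L) * b%:C = - ((cint lambda H - b%:C)) + - (cexp (z * b%:C) - 1 - z * b%:C) * L.
  by rewrite cH; ring.
apply: (le_trans (normcD _ _)); rewrite -[leRHS]mulrA -expr2 /K mulrDl.
apply: lerD; first by rewrite normcN.
rewrite normcM normcN -[leRHS]mulrA mulrC; apply: ler_wpM2l; first exact: normc_ge0.
exact: small.
Qed.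

End gamma.

(** * Schwartz functions and their Fourier transforms *)

Section rapid_decay.
Context {R : realType} {n : nat}.
Local Notation C := R[i].
Local Notation lambda := (@lebesgue_measure R).
Local Notation mu := (@lebesgue_tuple R n).
Local Notation row := (@row_of_tuple R n).
Implicit Types (x y : 'rV[R]_n) (psi : 'rV[R]_n -> C).

Lemma sqnorm_ge0 x : 0 <= sqnorm x.
Proof. by apply: sumr_ge0 => i _; exact: sqr_ge0. Qed.

Lemma sqr_coord_le x i : x ord0 i ^+ 2 <= sqnorm x.
Proof. by rewrite /sqnorm (bigD1 i)//= lerDl sumr_ge0// => j _; exact: sqr_ge0. Qed.

Lemma bracket_ge1 x : 1 <= 1 + sqnorm x.
Proof. by rewrite lerDl sqnorm_ge0. Qed.

Lemma bracket_gt0 x : 0 < 1 + sqnorm x.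
Proof. by rewrite (lt_le_trans ltr01)// bracket_ge1. Qed.

Lemma coord_le_bracket x i : `|x ord0 i| <= 1 + sqnorm x.
Proof.
apply: (@le_trans _ _ (1 + `|x ord0 i| ^+ 2)).
  by have := sqr_ge0 (`|x ord0 i| - 1); nra.
by rewrite lerD2l real_normK ?num_real// sqr_coord_le.
Qed.

Definition rapid psi := cmeasurable (psi \o row) /\
  forall N, exists K, forall x, (1 + sqnorm x) ^+ N * normc (psi x) <= K.

Lemma measurable_row_coord i : measurable_fun setT (fun t : n.-tuple R => row t ord0 i).
Proof. rewrite (_ : (fun t => _) = (fun t : n.-tuple R => tnth t i)).
  exact: measurable_tnth.
by apply/funext => t; rewrite mxE. Qed.

Lemma measurable_row_dotp y : measurable_fun setT (fun t : n.-tuple R => dotp (row t) y).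
Proof.
apply: measurable_sum => i; apply: measurable_funM; first exact: measurable_row_coord.
exact: measurable_cst.
Qed.

Lemma measurable_row_sqnorm : measurable_fun setT (fun t : n.-tuple R => sqnorm (row t)).
Proof. by apply: measurable_sum => i; apply: measurable_funX; exact: measurable_row_coord. Qed.

Definition weight (x : 'rV[R]_n) : R := (1 + sqnorm x) ^- n.

(** Each 1 + x_i^2 is at most 1 + |x|^2, so the weight is dominated by a product of one-dimensional
    Cauchy functions. *)
Lemma weight_integrable : mu.-integrable setT (EFin \o (weight \o row)).
Proof.
pose c (x : R) : C := ((1 + x ^+ 2)^-1)%:C.
have ic : cintegrable lambda c by apply: cintegrable_real; exact: integrable_cauchy.
have [iP _] := @cint_prod _ n (fun=> c) (fun=> ic).
have ms := measurable_row_sqnorm.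
have mw : measurable_fun setT (weight \o row).
  pose g (y : R) := (1 + `|y|) ^- n.
  have -> : weight \o row = g \o (fun t => sqnorm (row t)).
    by apply/funext => t /=; rewrite /g ger0_norm ?sqnorm_ge0.
  apply: (measurableT_comp (f := g)) => //; apply: continuous_measurable_fun => y.
  apply: cvgV; first by rewrite expf_neq0// gt_eqF// ltr_pwDl.
  apply: (@continuous_comp _ _ _ (fun y : R => 1 + `|y|) (fun u => u ^+ n)).
    by apply: cvgD; [exact: cvg_cst|exact: norm_continuous].
  exact: exprn_continuous.
apply: (integrable_dom _ (cintegrable_normc iP)) => // t.
have w0 : 0 <= weight (row t) by rewrite invr_ge0 exprn_ge0// ltW// bracket_gt0.
have -> : normc (\prod_(i < n) c (tnth t i)) = (\prod_(i < n) (1 + tnth t i ^+ 2))^-1.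
  rewrite /c -rmorph_prod /= expr0n addr0 sqrtr_sqr prodfV ger0_norm//.
  by rewrite invr_ge0 prodr_ge0// => i _; rewrite addr_ge0// sqr_ge0.
rewrite /= ger0_norm// lef_pV2 ?posrE ?exprn_gt0 ?bracket_gt0//; last first.
  by apply: prodr_gt0 => i _; rewrite ltr_pwDl// sqr_ge0.
rewrite -[X in _ ^+ X]card_ord -prodr_const; apply: ler_prod => i _.
rewrite addr_ge0 ?sqr_ge0//= lerD2l (le_trans _ (sqr_coord_le (row t) i))//.
by rewrite mxE.
Qed.

Lemma rapid_bound psi : rapid psi -> exists2 K, 0 <= K &
  forall x, normc (psi x) <= K * weight x.
Proof.
move=> [_ /(_ n)[K h]]; exists `|K| => // x.
rewrite /weight ler_pdivlMr ?exprn_gt0 ?bracket_gt0// mulrC.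
exact: le_trans (h x) (ler_norm K).
Qed.

Lemma weightZ_integrable K : mu.-integrable setT (EFin \o (fun t => K * weight (row t))).
Proof.
rewrite (_ : _ \o _ = (fun t => K%:E * (weight (row t))%:E)%E).
  exact: (integrableZl _ _ weight_integrable).
by apply/funext => t /=; rewrite EFinM.
Qed.

Lemma rapid_integrable psi : rapid psi -> cintegrable mu (psi \o row).
Proof.
move=> rp; have [K K0 h] := rapid_bound rp.
by apply: (cintegrable_dom _ (weightZ_integrable K)) => [|t]; [case: rp|exact: h].
Qed.

Lemma rapid_dom psi psi' (K : R) (m : nat) : rapid psi -> cmeasurable (psi' \o row) ->
  (forall x, normc (psi' x) <= K * (1 + sqnorm x) ^+ m * normc (psi x)) -> rapid psi'.
Proof.
move=> [_ rp] mp h; split => // N; have [L hL] := rp (N + m)%N.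
exists (`|K| * L) => x; have b0 := bracket_gt0 x.
apply: (@le_trans _ _ ((1 + sqnorm x) ^+ N * (`|K| * (1 + sqnorm x) ^+ m * normc (psi x)))).
  rewrite ler_pM2l ?exprn_gt0//; apply: (le_trans (h x)).
  by rewrite !ler_wpM2r ?normc_ge0 ?exprn_ge0 ?(ltW b0)// ler_norm.
rewrite [leLHS](_ : _ = `|K| * ((1 + sqnorm x) ^+ (N + m) * normc (psi x))); last first.
  by rewrite exprD; ring.
by rewrite ler_wpM2l.
Qed.

Lemma rapid_cis psi y : rapid psi -> rapid (fun x => psi x * cis (dotp x y)).
Proof.
move=> rp; apply: (@rapid_dom psi _ 1 0) => //.
  apply: cmeasurableM; first by case: rp.
  by apply: cmeasurable_cis; exact: measurable_row_dotp.
by move=> x; rewrite normcM normc_cis expr0 !mul1r mulr1.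
Qed.

Lemma fourier_integrable psi y : rapid psi ->
  cintegrable mu (fun t => psi (row t) * cis (dotp (row t) y)).
Proof. by move=> rp; exact: (rapid_integrable (rapid_cis y rp)). Qed.

Lemma fourierE psi y : fourier psi y = cint mu (fun t => psi (row t) * cis (dotp (row t) y)).
Proof. by []. Qed.

Lemma fourier_bounded psi : rapid psi -> exists K, forall y, normc (fourier psi y) <= K.
Proof.
move=> rp; have [K K0 h] := rapid_bound rp.
exists (2 * \int[mu]_t (K * weight (row t))) => y; rewrite fourierE.
apply: normc_cint_le; [exact: fourier_integrable|exact: weightZ_integrable|].
by move=> t; rewrite normcM normc_cis mulr1; exact: h.
Qed.

Lemma dotpDr x y z : dotp x (y + z) = dotp x y + dotp x z.
Proof. by rewrite /dotp -big_split; apply: eq_bigr => i _; rewrite mxE mulrDr. Qed.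

Lemma dotpDl x y z : dotp (x + y) z = dotp x z + dotp y z.
Proof. by rewrite /dotp -big_split; apply: eq_bigr => i _; rewrite mxE mulrDl. Qed.

Lemma norm_coord_le x i : `|x ord0 i| <= `|x|.
Proof. by rewrite [leRHS]mx_normrE (le_trans _ (le_bigmax _ _ (ord0, i))). Qed.

Lemma dotp_le x y : `|dotp x y| <= n%:R * (1 + sqnorm x) * `|y|.
Proof.
apply: (le_trans (ler_norm_sum _ _ _)).
apply: (@le_trans _ _ (\sum_(i < n) (1 + sqnorm x) * `|y|)).
  apply: ler_sum => i _; rewrite normrM; apply: ler_pM => //.
    exact: coord_le_bracket.
  exact: norm_coord_le.
by rewrite sumr_const card_ord -mulrA mulr_natl.
Qed.

End rapid_decay.

Lemma differentiable_littleo (R : numFieldType) (V W : normedModType R)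
    (f : V -> W) (df : {linear V -> W}) x : continuous df ->
  (forall e : R, 0 < e -> \forall h \near (0 : V), `|f (h + x) - f x - df h| <= e * `|h|) ->
  differentiable f x /\ 'd f x = df :> (V -> W).
Proof.
move=> dfc hf.
have E : f \o shift x = cst (f x) + df +o_ (0 : V) id.
  apply/eqaddoP => e e0; have := hf e e0; apply: filterS => h.
  by rewrite /= !fctE opprD addrA.
split; last exact: diff_unique.
apply/diff_locallyP; have dE := diff_unique dfc E.
split; first by rewrite dE.
by rewrite dE.
Qed.

Section real_schwartz_class.
Context {R : realType} {n : nat}.
Local Notation V := 'rV[R]_n.
Local Notation e_ := (@delta_mx R 1 n ord0).
Implicit Types (f g : V -> R) (x : V).

Definition pderiv (i : 'I_n) f : V -> R := fun x => 'D_(e_ i) f x.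

Lemma real_schwartz_differentiable f x : real_schwartz f -> differentiable f x.
Proof. by move=> [h _]; exact: (h [::] x). Qed.

Lemma real_schwartz_bound f N : real_schwartz f ->
  exists K, forall x, (1 + sqnorm x) ^+ N * `|f x| <= K.
Proof. by move=> [_ /(_ N [::])]. Qed.

Lemma real_schwartz_pderiv f i : real_schwartz f -> real_schwartz (pderiv i f).
Proof.
have E s : partials s (pderiv i f) = partials (rcons s i) f.
  by rewrite /partials foldr_rcons.
move=> [h1 h2]; split => [s x|N s]; first by rewrite E.
have [K hK] := h2 N (rcons s i); exists K => x.
by rewrite E; exact: hK.
Qed.

(** A coinduction principle: iterated partial derivatives never leave P, so differentiability and
    decay need checking only for members of P. It is applied to classes made large enough to be
    stable under derivatives. *)
Lemma real_schwartz_family (P : (V -> R) -> Prop) :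
  (forall f x, P f -> differentiable f x) ->
  (forall f N, P f -> exists K, forall x, (1 + sqnorm x) ^+ N * `|f x| <= K) ->
  (forall f i, P f -> P (pderiv i f)) -> forall f, P f -> real_schwartz f.
Proof.
move=> P1 P2 P3 f Pf; have Ps s : P (partials s f).
  by elim: s => //= i s ih; exact: (P3 _ i ih).
by split => [s x|N s]; [exact: P1|exact: P2].
Qed.

Lemma real_schwartz_lin a b f g : real_schwartz f -> real_schwartz g ->
  real_schwartz (fun x => a * f x + b * g x).
Proof.
move=> sf sg; apply: (@real_schwartz_family (fun h => exists f g,
  [/\ real_schwartz f, real_schwartz g & h = fun x => a * f x + b * g x])); last by exists f, g.
- move=> _ x [u [v [su sv ->]]].
  by apply: differentiableD; apply: differentiableZ; exact: real_schwartz_differentiable.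
- move=> _ N [u [v [su sv ->]]].
  have [K hK] := real_schwartz_bound N su; have [L hL] := real_schwartz_bound N sv.
  exists (`|a| * K + `|b| * L) => x.
  have b0 : 0 <= (1 + sqnorm x) ^+ N by rewrite exprn_ge0// ltW// bracket_gt0.
  apply: (@le_trans _ _ ((1 + sqnorm x) ^+ N * (`|a| * `|u x| + `|b| * `|v x|))).
    by rewrite ler_wpM2l// (le_trans (ler_normD _ _))// !normrM.
  rewrite mulrDr; by apply: lerD; rewrite mulrCA ler_wpM2l.
- move=> _ i [u [v [su sv ->]]]; exists (pderiv i u), (pderiv i v).
  split; try exact: real_schwartz_pderiv.
  apply/funext => x; have du := diff_derivable (v := e_ i) (real_schwartz_differentiable x su).
  have dv := diff_derivable (v := e_ i) (real_schwartz_differentiable x sv).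
  rewrite /pderiv (@deriveD _ _ _ (a \*: u) (b \*: v)); try exact: derivableZ.
  by rewrite !deriveZ.
Qed.

Lemma differentiable_coord_rV i x : differentiable (fun y : V => y ord0 i) x.
Proof. exact: differentiable_coord. Qed.

Lemma derive_coord_rV i (v : V) x : 'D_v (fun y : V => y ord0 i) x = v ord0 i.
Proof.
rewrite /derive; apply: cvg_lim => //; apply/cvgrPdist_le => eps eps0.
near=> h; have h0 : h != 0 by near: h; exact: nbhs_dnbhs_neq.
rewrite /= !mxE addrK /GRing.scale /= mulrA mulVf// mul1r subrr normr0.
exact: ltW.
Unshelve. all: by end_near. Qed.

(** The functions x_i u + v form a stable class: the j-th derivative is x_i (d_j u) + (delta_ij u +
    d_j v). *)
Lemma real_schwartz_coord i f : real_schwartz f -> real_schwartz (fun x => x ord0 i * f x).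
Proof.
move=> sf; have s0 : real_schwartz (fun x : V => 0 * f x + 0 * f x) by exact: real_schwartz_lin.
apply: (@real_schwartz_family (fun h => exists f g,
  [/\ real_schwartz f, real_schwartz g & h = fun x => x ord0 i * f x + g x])); last by exists f, (fun x => 0 * f x + 0 * f x); split => //; apply/funext => x; rewrite !mul0r !addr0.
- move=> _ x [u [v [su sv ->]]]; apply: differentiableD; last exact: real_schwartz_differentiable.
  by apply: differentiableM; [exact: differentiable_coord_rV|exact: real_schwartz_differentiable].
- move=> _ N [u [v [su sv ->]]].
  have [K hK] := real_schwartz_bound N.+1 su; have [L hL] := real_schwartz_bound N sv.
  exists (K + L) => x.
  have b0 : 0 <= (1 + sqnorm x) ^+ N by rewrite exprn_ge0// ltW// bracket_gt0.
  apply: (@le_trans _ _ ((1 + sqnorm x) ^+ N * (`|x ord0 i * u x| + `|v x|))).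
    by rewrite ler_wpM2l// ler_normD.
  rewrite mulrDr; apply: lerD; last exact: hL.
  apply: le_trans (hK x); rewrite normrM mulrA exprSr ler_wpM2r// ler_wpM2l//.
  exact: coord_le_bracket.
- move=> _ j [u [v [su sv ->]]]; pose d : R := (e_ j) ord0 i.
  exists (pderiv j u), (fun x => d * u x + 1 * pderiv j v x).
  split; try (by apply: real_schwartz_lin => //; exact: real_schwartz_pderiv).
    exact: real_schwartz_pderiv.
  apply/funext => x; have du := diff_derivable (v := e_ j) (real_schwartz_differentiable x su).
  have dv := diff_derivable (v := e_ j) (real_schwartz_differentiable x sv).
  have dc := diff_derivable (v := e_ j) (differentiable_coord_rV i x).
  rewrite /pderiv (deriveD (derivableM dc du) dv) (deriveM dc du) derive_coord_rV.
  rewrite /GRing.scale /= mul1r addrA.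
  by congr (_ + _ + _); rewrite mulrC.
Qed.

Lemma real_schwartz_taylor i f N : real_schwartz f -> exists2 K, 0 <= K &
  forall x (t : R), `|t| <= 1 ->
  (1 + sqnorm x) ^+ N * `|f (x + t *: e_ i) - f x - t * pderiv i f x| <= K * t ^+ 2.
Proof.
move=> sf; have sf1 := real_schwartz_pderiv i sf; have sf2 := real_schwartz_pderiv i sf1.
have [K hK] := real_schwartz_bound N sf2; exists (3 ^+ N * `|K|) => [|x t t1].
  by rewrite mulr_ge0// exprn_ge0.
have line g : real_schwartz g -> forall s : R,
    is_derive s (1 : R) (fun s => g (x + s *: e_ i)) (pderiv i g (x + s *: e_ i)).
  move=> sg s; have := diff_derivable (v := e_ i) (real_schwartz_differentiable (x + s *: e_ i) sg).
  have E : (fun h : R => h^-1 *: (g (h *: e_ i + (x + s *: e_ i)) - g (x + s *: e_ i))) =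
      (fun h : R => h^-1 *: (((fun s => g (x + s *: e_ i)) \o shift s) (h *: (1 : R)) - g (x + s *: e_ i))).
    apply/funext => h /=; congr (_ *: (g _ - _)).
    by rewrite -[h *: (1 : R)]/(h * 1) mulr1 scalerDl addrCA.
  move=> dg; apply: DeriveDef; first by rewrite /derivable -E.
  by rewrite /pderiv /derive -E.
have [c [c1 c2 Ec]] := mean_value_any 0 t (line _ sf).
have [c' [c'1 c'2 Ec']] := mean_value_any 0 c (line _ sf1).
move: Ec Ec' c1 c'1; rewrite !scale0r !addr0 !subr0 => Ec Ec' c1 c'1.
rewrite Ec (_ : _ - _ = t * (c * pderiv i (pderiv i f) (x + c' *: e_ i))); last first.
  by rewrite mulrC -mulrBr Ec' (mulrC c).
set y := x + c' *: e_ i.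
(* The derivative is taken at a nearby point y while the weight is at x; as |x - y| <= 1, the two
   weights differ by a factor of at most 3. *)
have xy : 1 + sqnorm x <= 3 * (1 + sqnorm y).
  have c'1' : c' ^+ 2 <= 1.
    rewrite -(real_normK (num_real c')) exprn_ile1//.
    by rewrite (le_trans c'1)// (le_trans c1).
  have : sqnorm x <= 2 * sqnorm y + 2 * c' ^+ 2.
    have -> : 2 * sqnorm y + 2 * c' ^+ 2 = \sum_(j < n) (2 * (y ord0 j) ^+ 2 + 2 * (c' *: e_ i) ord0 j ^+ 2).
      rewrite big_split /= -!mulr_sumr; congr (_ + 2 * _).
      rewrite (bigD1 i)//= !mxE !eqxx mulr1 big1 ?addr0// => j ji.
      by rewrite !mxE (negbTE ji) andbF mulr0 expr0n.
    apply: ler_sum => j _.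
    have -> : x ord0 j = y ord0 j - (c' *: e_ i) ord0 j by rewrite /y mxE addrK.
    by have := sqr_ge0 (y ord0 j + (c' *: e_ i) ord0 j); nra.
  have := sqnorm_ge0 y; lra.
rewrite !normrM.
have b0 := bracket_gt0 x; have b1 := bracket_gt0 y.
apply: (@le_trans _ _ ((3 * (1 + sqnorm y)) ^+ N * (`|t| * (`|t| * `|pderiv i (pderiv i f) y|)))).
  apply: ler_pM => //; first by rewrite exprn_ge0// ltW.
    by rewrite lerXn2r// nnegrE ?mulr_ge0// ltW.
  by rewrite ler_wpM2l// ler_wpM2r.
rewrite [leLHS](_ : _ = 3 ^+ N * `|t| ^+ 2 * ((1 + sqnorm y) ^+ N * `|pderiv i (pderiv i f) y|)); last by rewrite exprMn; ring.
rewrite real_normK ?num_real// [leRHS]mulrAC; apply: ler_wpM2l.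
  by apply: mulr_ge0; [exact: exprn_ge0|exact: sqr_ge0].
exact: le_trans (hK y) (ler_norm K).
Qed.

End real_schwartz_class.

Section schwartz_class.
Context {R : realType} {n : nat}.
Local Notation C := R[i].
Local Notation V := 'rV[R]_n.
Local Notation mu := (@lebesgue_tuple R n).
Local Notation row := (@row_of_tuple R n).
Local Notation e_ := (@delta_mx R 1 n ord0).
Implicit Types (phi psi : V -> C) (x xi : V).

Definition cpderiv (i : 'I_n) phi : V -> C := fun x =>
  pderiv i (fun x => Re (phi x)) x +i* pderiv i (fun x => Im (phi x)) x.

Lemma schwartz_rapid phi : schwartz phi -> rapid phi.
Proof.
move=> [s1 s2]; split.
  have c (f : V -> R) : real_schwartz f -> continuous f.
    by move=> sf x; apply: differentiable_continuous; exact: real_schwartz_differentiable.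
  split; [exact: (continuous_measurable_tuple (c _ s1))|exact: (continuous_measurable_tuple (c _ s2))].
move=> N; have [K hK] := real_schwartz_bound N s1; have [L hL] := real_schwartz_bound N s2.
exists (K + L) => x; apply: (@le_trans _ _ ((1 + sqnorm x) ^+ N * (`|Re (phi x)| + `|Im (phi x)|))).
  by rewrite ler_wpM2l ?ler_normc_ReIm// exprn_ge0// ltW// bracket_gt0.
by rewrite mulrDr lerD.
Qed.

Lemma schwartz_cpderiv i phi : schwartz phi -> schwartz (cpderiv i phi).
Proof. by move=> [s1 s2]; split; exact: real_schwartz_pderiv. Qed.

Lemma schwartzD phi psi : schwartz phi -> schwartz psi -> schwartz (fun x => phi x + psi x).
Proof.
move=> [a1 a2] [b1 b2]; split.
  rewrite (_ : (fun x => _) = fun x => 1 * Re (phi x) + 1 * Re (psi x)); first exact: real_schwartz_lin.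
  by apply/funext => x; rewrite !mul1r ReD.
rewrite (_ : (fun x => _) = fun x => 1 * Im (phi x) + 1 * Im (psi x)); first exact: real_schwartz_lin.
by apply/funext => x; rewrite !mul1r ImD.
Qed.

Lemma schwartzZ c phi : schwartz phi -> schwartz (fun x => c * phi x).
Proof.
move=> [a1 a2]; split.
  rewrite (_ : (fun x => _) = fun x => Re c * Re (phi x) + (- Im c) * Im (phi x)); first exact: real_schwartz_lin.
  by apply/funext => x; rewrite ReM mulNr.
rewrite (_ : (fun x => _) = fun x => Re c * Im (phi x) + Im c * Re (phi x)); first exact: real_schwartz_lin.
by apply/funext => x; rewrite ImM.
Qed.

Lemma schwartz_coord i phi : schwartz phi -> schwartz (fun x => (x ord0 i)%:C * phi x).
Proof.
move=> [a1 a2]; split.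
  rewrite (_ : (fun x => _) = fun x => x ord0 i * Re (phi x)); first exact: real_schwartz_coord.
  by apply/funext => x; rewrite ReM /= mul0r subr0.
rewrite (_ : (fun x => _) = fun x => x ord0 i * Im (phi x)); first exact: real_schwartz_coord.
by apply/funext => x; rewrite ImM /= mul0r addr0.
Qed.

Lemma schwartz_sum (I : Type) (s : seq I) (F : I -> V -> C) phi : schwartz phi ->
  (forall i, schwartz (F i)) -> schwartz (fun x => \sum_(i <- s) F i x).
Proof.
move=> sphi h; elim: s => [|i s ih].
  rewrite (_ : (fun x => _) = fun x => 0 * phi x); first exact: schwartzZ.
  by apply/funext => x; rewrite big_nil mul0r.
rewrite (_ : (fun x => _) = fun x => F i x + \sum_(j <- s) F j x); first exact: schwartzD.
by apply/funext => x; rewrite big_cons.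
Qed.

Lemma schwartz_sqnorm k phi : schwartz phi -> schwartz (fun x => (sqnorm x ^+ k)%:C * phi x).
Proof.
move=> sphi; elim: k => [|k ih].
  rewrite (_ : (fun x => _) = fun x => 1 * phi x); first exact: schwartzZ.
  by apply/funext => x; rewrite expr0.
rewrite (_ : (fun x => _) = fun x => \sum_(i < n) ((x ord0 i)%:C * ((x ord0 i)%:C * ((sqnorm x ^+ k)%:C * phi x)))).
  by apply: (schwartz_sum _ sphi) => i; do 2 apply: schwartz_coord.
apply/funext => x; rewrite exprS rmorphM /= -mulrA {1}/sqnorm rmorph_sum /= mulr_suml.
by apply: eq_bigr => i _; rewrite rmorphXn /= expr2 -mulrA.
Qed.

End schwartz_class.

(** * Fourier transforms of derivatives; invariance of the Schwartz class *)

Section fourier_schwartz.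
Context {R : realType} {n : nat}.
Local Notation C := R[i].
Local Notation V := 'rV[R]_n.
Local Notation mu := (@lebesgue_tuple R n).
Local Notation row := (@row_of_tuple R n).
Local Notation e_ := (@delta_mx R 1 n ord0).
Implicit Types (phi psi : V -> C) (x xi : V).

Definition tuple_of_row (v : V) : n.-tuple R := [tuple v ord0 i | i < n].

Lemma row_tuple_add v t : row (tuple_add (tuple_of_row v) t) = row t + v.
Proof. by apply/rowP => i; rewrite !mxE !tnth_mktuple. Qed.

Lemma dotp_delta i xi (s : R) : dotp (s *: e_ i) xi = s * xi ord0 i.
Proof.
rewrite /dotp (bigD1 i)//= big1 ?addr0; first by rewrite !mxE !eqxx mulr1.
by move=> j ji; rewrite !mxE (negbTE ji) andbF mulr0 mul0r.
Qed.

Lemma schwartz_taylor i phi : schwartz phi -> exists2 K, 0 <= K &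
  forall x (s : R), `|s| <= 1 ->
  normc (phi (x + s *: e_ i) - phi x - s%:C * cpderiv i phi x) <= K * weight x * s ^+ 2.
Proof.
move=> [s1 s2]; have [K K0 hK] := real_schwartz_taylor i n s1.
have [L L0 hL] := real_schwartz_taylor i n s2.
exists (K + L) => [|x s sle]; first exact: addr_ge0.
apply: (le_trans (ler_normc_ReIm _)).
have -> : (K + L) * weight x * s ^+ 2 = K * s ^+ 2 * weight x + L * s ^+ 2 * weight x by ring.
have b0 : 0 < (1 + sqnorm x) ^+ n by rewrite exprn_gt0// bracket_gt0.
rewrite !reim /= !mul0r subr0 addr0; apply: lerD; rewrite ler_pdivlMr// mulrC.
  exact: hK.
exact: hL.
Qed.

(** Translation replaces integration by parts: shifting phi by s e_i multiplies its transform by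
    cis(-s xi_i). Both sides are expanded to first order in s, with remainders of order s^2, and
    divided by s. *)
Lemma fourier_cpderiv i phi xi : schwartz phi ->
  fourier (cpderiv i phi) xi = - ((0 +i* xi ord0 i) * fourier phi xi).
Proof.
move=> sphi; have rphi := schwartz_rapid sphi.
have rd := schwartz_rapid (schwartz_cpderiv i sphi).
have [K K0 hK] := schwartz_taylor i sphi.
pose F := fourier phi xi; pose D := fourier (cpderiv i phi) xi.
pose M := 2 * \int[mu]_t (K * weight (row t)) + 2 * xi ord0 i ^+ 2 * normc F.
have ge0int : 0 <= \int[mu]_t (K * weight (row t)).
  apply: Rintegral_ge0 => t _; rewrite mulr_ge0// invr_ge0 exprn_ge0// ltW//.
  exact: bracket_gt0.
have M0 : 0 <= M.
  apply: addr_ge0; first exact: mulr_ge0.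
  by apply: mulr_ge0; [apply: mulr_ge0 => //; exact: sqr_ge0|exact: normc_ge0].
apply/eqP; rewrite -addr_eq0; apply/eqP.
apply: (@normc_le_ball _ _ M) => // e e0.
pose s := Num.min 1 e.
have s0 : 0 < s by rewrite lt_min ltr01.
have sle : `|s| <= 1 by rewrite ger0_norm ?ge_min ?lexx// ltW.
apply: (@le_trans _ _ (M * s)); last by rewrite ler_wpM2l// ge_min lexx orbT.
pose v := tuple_of_row (s *: e_ i).
pose h (t : n.-tuple R) := phi (row t) * cis (dotp (row t) xi).
have ih : cintegrable mu h by exact: fourier_integrable.
have mh : cmeasurable h := cintegrable_measurable ih.
have mhv : cmeasurable (fun t => h (tuple_add v t)).
  exact: (cmeasurable_comp mh (measurable_tuple_add v)).
pose g t := cis (- (s * xi ord0 i)) * h (tuple_add v t).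
have gE t : g t = phi (row t + s *: e_ i) * cis (dotp (row t) xi).
  rewrite /g /h /v row_tuple_add mulrCA -cisD dotpDl dotp_delta; congr (_ * cis _).
  by ring.
pose r t := (phi (row t + s *: e_ i) - phi (row t) - s%:C * cpderiv i phi (row t)) *
  cis (dotp (row t) xi).
pose q t := cpderiv i phi (row t) * cis (dotp (row t) xi).
have iq : cintegrable mu q by exact: fourier_integrable.
have rE t : r t = g t - h t - s%:C * q t by rewrite gE /r /h /q; ring.
have mr : cmeasurable r.
  rewrite (funext rE); apply: cmeasurableB.
    apply: cmeasurableB => //; apply: cmeasurableM => //; exact: cmeasurable_cst.
  by apply: cmeasurableM; [exact: cmeasurable_cst|exact: cintegrable_measurable iq].
have rb t : normc (r t) <= s ^+ 2 * (K * weight (row t)).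
  rewrite normcM normc_cis mulr1 [leRHS]mulrC; exact: hK.
have iw : mu.-integrable setT (EFin \o (fun t => s ^+ 2 * (K * weight (row t)))).
  rewrite (_ : _ \o _ = (fun t => (s ^+ 2)%:E * (K * weight (row t))%:E)%E).
    exact: (integrableZl _ _ (weightZ_integrable K)).
  by apply/funext => t /=; rewrite EFinM.
have ir : cintegrable mu r by apply: (cintegrable_dom _ iw).
have ig : cintegrable mu g.
  rewrite (_ : g = fun t => r t + (h t + s%:C * q t)).
    by apply: cintegrableD => //; apply: cintegrableD => //; exact: cintegrableZ.
  by apply/funext => t; rewrite rE; ring.
have ihv : cintegrable mu (fun t => h (tuple_add v t)).
  rewrite (_ : (fun t => _) = fun t => cis (s * xi ord0 i) * g t); first exact: cintegrableZ.
  by apply/funext => t; rewrite /g mulrA -cisD subrr cis0 mul1r.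
have cr : cint mu r = cis (- (s * xi ord0 i)) * F - F - s%:C * D.
  rewrite (funext rE) cintB; [|exact: cintegrableB|exact: cintegrableZ].
  by rewrite cintB// !cintZ// cint_tuple_shift.
have br : normc (cint mu r) <= s ^+ 2 * (2 * \int[mu]_t (K * weight (row t))).
  rewrite mulrCA -RintegralZl//; last exact: weightZ_integrable.
  exact: normc_cint_le.
rewrite -(ler_pM2r s0) -{1}(ger0_norm (ltW s0)) -normc_real -normcM.
have -> : (fourier (cpderiv i phi) xi + (0 +i* xi ord0 i) * fourier phi xi) * s%:C =
    - cint mu r + (cis (- (s * xi ord0 i)) - 1 - (0 +i* (- (s * xi ord0 i)))) * F.
  rewrite cr -/F -/D (_ : (0 +i* (- (s * xi ord0 i))) = - (s%:C * (0 +i* xi ord0 i))); first ring.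
  by apply: complex_eq; rewrite !reim /=; ring.
apply: (le_trans (normcD _ _)); rewrite normcN.
rewrite [leRHS](_ : _ = s ^+ 2 * (2 * \int[mu]_t (K * weight (row t))) +
   2 * (- (s * xi ord0 i)) ^+ 2 * normc F); last by rewrite /M; ring.
apply: lerD => //; rewrite normcM; apply: ler_wpM2r; first exact: normc_ge0.
exact: normc_cisB2.
Qed.

(** The transform formula at xi = 0; all integrations by parts for the moments rest on this. *)
Lemma cint_cpderiv i phi : schwartz phi ->
  cint mu (fun t => cpderiv i phi (row t)) = 0.
Proof.
move=> sphi; have := fourier_cpderiv i 0 sphi.
rewrite mxE (_ : 0 +i* 0 = 0)// mul0r oppr0 => <-; apply: eq_cint => t.
by rewrite /dotp big1 ?cis0 ?mulr1// => j _; rewrite [X in _ * X]mxE mulr0.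
Qed.

Lemma fourierD phi psi xi : rapid phi -> rapid psi ->
  fourier (fun x => phi x + psi x) xi = fourier phi xi + fourier psi xi.
Proof.
move=> r1 r2; rewrite !fourierE -cintD; try exact: fourier_integrable.
by apply: eq_cint => t; rewrite mulrDl.
Qed.

Lemma fourierZ c phi xi : rapid phi ->
  fourier (fun x => c * phi x) xi = c * fourier phi xi.
Proof.
move=> r1; rewrite !fourierE -cintZ; last exact: fourier_integrable.
by apply: eq_cint => t; rewrite mulrA.
Qed.

Lemma fourier_sum (I : Type) (s : seq I) (F : I -> V -> C) xi :
  (forall i, rapid (F i)) ->
  fourier (fun x => \sum_(i <- s) F i x) xi = \sum_(i <- s) fourier (F i) xi.
Proof.
move=> h; rewrite fourierE -cint_sum; last by move=> i; exact: fourier_integrable.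
by apply: eq_cint => t; rewrite mulr_suml.
Qed.

(** The estimate |cis a - 1 - ia| <= 2 a^2 with a = <x, h> leaves an integrable remainder, quadratic
    in |h|. The imaginary part is reached later as the real part for -i phi. *)
Lemma fourier_differentiable phi xi : schwartz phi ->
  differentiable (fun xi => Re (fourier phi xi)) xi /\
  forall j, pderiv j (fun xi => Re (fourier phi xi)) xi =
    Re (fourier (fun x => 'i%C * ((x ord0 j)%:C * phi x)) xi).
Proof.
move=> sphi; pose c j := Re (fourier (fun x => 'i%C * ((x ord0 j)%:C * phi x)) xi).
pose L (h : V) : R := \sum_(j < n) h ord0 j * c j.
have Llin : linear L.
  move=> a u v; rewrite /L scaler_sumr -big_split; apply: eq_bigr => j _.
  by rewrite !mxE mulrDl /GRing.scale /= mulrA.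
pose LL : {linear V -> R} := HB.pack L (GRing.isLinear.Build R V R _ L Llin).
have rphi := schwartz_rapid sphi.
have rj j : rapid (fun x => 'i%C * ((x ord0 j)%:C * phi x)).
  by apply/schwartz_rapid/schwartzZ/schwartz_coord.
have cL : continuous LL.
  apply: (@continuous_big R 'I_n +%R 0 predT _ V _ (fun j (h : V) => h ord0 j * c j)).
    exact: add_continuous.
  by move=> j _ h; apply: cvgMr_tmp; [exact: nbhs_filter|exact: coord_continuous].
have [K K0 hK] : exists2 K, 0 <= K & forall h, normc (fourier phi (xi + h) - fourier phi xi -
    \sum_(j < n) (h ord0 j)%:C * fourier (fun x => 'i%C * ((x ord0 j)%:C * phi x)) xi)
    <= K * `|h| ^+ 2.
  (* The squared weight dominates <x, h>^2 up to the factor n^2 |h|^2. *)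
  have r2 : rapid (fun x => ((1 + sqnorm x) ^+ 2)%:C * phi x).
    apply: (@rapid_dom _ _ phi _ 1 2) => //.
      apply: cmeasurableM; last by case: rphi.
      apply: cmeasurable_real; apply: measurable_funX; apply: measurable_funD => //.
      exact: measurable_row_sqnorm.
    move=> x; rewrite normcM normc_real mul1r ger0_norm//.
    by rewrite exprn_ge0// ltW// bracket_gt0.
  have [M M0 hM] := rapid_bound r2.
  pose I := \int[mu]_t (M * weight (row t)).
  have I0 : 0 <= I.
    apply: Rintegral_ge0 => t _; rewrite mulr_ge0// invr_ge0 exprn_ge0// ltW//.
    exact: bracket_gt0.
  exists (2 * (2 * n%:R ^+ 2 * I)) => [|h]; first by rewrite !mulr_ge0// sqr_ge0.
  have -> : \sum_(j < n) (h ord0 j)%:C * fourier (fun x => 'i%C * ((x ord0 j)%:C * phi x)) xi =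
      cint mu (fun t => phi (row t) * cis (dotp (row t) xi) * (0 +i* dotp (row t) h)).
    under eq_bigr do rewrite -fourierZ//.
    rewrite -fourier_sum; last first.
      by move=> j; apply/schwartz_rapid/schwartzZ/schwartzZ/schwartz_coord.
    apply: eq_cint => t; rewrite [RHS]mulrAC; congr (_ * _).
    have -> : (0 +i* dotp (row t) h) = 'i%C * (dotp (row t) h)%:C.
      by apply: complex_eq; rewrite !reim /=; ring.
    rewrite /dotp rmorph_sum /= !mulr_sumr; apply: eq_bigr => j _.
    by rewrite rmorphM /=; move: 'i%C => J; ring.
  have i1 y : cintegrable mu (fun t => phi (row t) * cis (dotp (row t) y)).
    exact: fourier_integrable.
  pose k t := phi (row t) * cis (dotp (row t) xi) *
    (cis (dotp (row t) h) - 1 - (0 +i* dotp (row t) h)).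
  have mk : cmeasurable k.
    apply: cmeasurableM; first exact: cintegrable_measurable (i1 xi).
    apply: cmeasurableB.
      apply: cmeasurableB; last exact: cmeasurable_cst.
      by apply: cmeasurable_cis; exact: measurable_row_dotp.
    by split => /=; [exact: measurable_cst|exact: measurable_row_dotp].
  have kb t : normc (k t) <= (2 * n%:R ^+ 2 * `|h| ^+ 2) * (M * weight (row t)).
    rewrite normcM normcM normc_cis mulr1.
    apply: (@le_trans _ _ (normc (phi (row t)) * (2 * dotp (row t) h ^+ 2))).
      by apply: ler_wpM2l; [exact: normc_ge0|exact: normc_cisB2].
    apply: (@le_trans _ _ (normc (phi (row t)) * (2 * (n%:R * (1 + sqnorm (row t)) * `|h|) ^+ 2))).
      apply: ler_wpM2l; first exact: normc_ge0.
      rewrite ler_pM2l// -(real_normK (num_real (dotp _ _))) lerXn2r ?nnegrE//.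
        by rewrite !mulr_ge0// ltW// bracket_gt0.
      exact: dotp_le.
    rewrite [leLHS](_ : _ = 2 * n%:R ^+ 2 * `|h| ^+ 2 * ((1 + sqnorm (row t)) ^+ 2 * normc (phi (row t)))); last by ring.
    apply: ler_wpM2l; first by rewrite !mulr_ge0// sqr_ge0.
    have := hM (row t); rewrite normcM normc_real ger0_norm//.
    by rewrite exprn_ge0// ltW// bracket_gt0.
  have iwk : mu.-integrable setT (EFin \o (fun t => (2 * n%:R ^+ 2 * `|h| ^+ 2) * (M * weight (row t)))).
    rewrite (_ : _ \o _ = (fun t => (2 * n%:R ^+ 2 * `|h| ^+ 2)%:E * (M * weight (row t))%:E)%E).
      exact: (integrableZl _ _ (weightZ_integrable M)).
    by apply/funext => t /=; rewrite EFinM.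
  have ik : cintegrable mu k by apply: (cintegrable_dom _ iwk).
  have idd : cintegrable mu (fun t => phi (row t) * cis (dotp (row t) xi) * (0 +i* dotp (row t) h)).
    rewrite (_ : (fun t => _) = fun t => phi (row t) * cis (dotp (row t) (xi + h)) -
      phi (row t) * cis (dotp (row t) xi) - k t).
      by apply: cintegrableB => //; exact: cintegrableB.
    by apply/funext => t; rewrite /k dotpDr cisD; ring.
  rewrite !fourierE -!cintB//; last exact: cintegrableB.
  have -> : 2 * (2 * n%:R ^+ 2 * I) * `|h| ^+ 2 =
      2 * \int[mu]_t ((2 * n%:R ^+ 2 * `|h| ^+ 2) * (M * weight (row t))).
    rewrite RintegralZl//; last exact: weightZ_integrable.
    by rewrite -/I; ring.
  rewrite (_ : (fun t => _) = k); first exact: normc_cint_le.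
  by apply/funext => t; rewrite /k dotpDr cisD; ring.
have [|d1 d2] := @differentiable_littleo _ _ _ (fun xi => Re (fourier phi xi)) LL xi cL.
  move=> e e0; have eK : 0 < e / (K + 1) by rewrite divr_gt0// ltr_wpDl.
  apply/nbhs_ballP; exists (e / (K + 1)) => // h; rewrite -ball_normE /= sub0r normrN => hh.
  have -> : Re (fourier phi (h + xi)) - Re (fourier phi xi) - L h =
     Re (fourier phi (xi + h) - fourier phi xi -
    \sum_(j < n) (h ord0 j)%:C * fourier (fun x => 'i%C * ((x ord0 j)%:C * phi x)) xi).
    rewrite !ReB Re_sum (addrC h); congr (_ - _).
    by apply: eq_bigr => j _; rewrite ReM /= mul0r subr0.
  apply: (le_trans (ler_Re_normc _)); apply: (le_trans (hK h)).
  rewrite expr2 mulrA; apply: ler_wpM2r => //.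
  apply: (@le_trans _ _ ((K + 1) * `|h|)); first by rewrite ler_wpM2r// lerDl.
  by rewrite mulrC -ler_pdivlMr ?ltW// ltr_wpDl.
split => // j; rewrite /pderiv deriveE// d2 /= /L (bigD1 j)//= big1 ?addr0.
  by rewrite !mxE !eqxx mul1r.
by move=> k kj; rewrite !mxE (negbTE kj) andbF mul0r.
Qed.

(** Each factor 1 + |xi|^2 is absorbed by replacing phi with psi = (1 - Laplacian) phi. *)
Lemma fourier_decay phi N : schwartz phi ->
  exists K, forall xi, (1 + sqnorm xi) ^+ N * normc (fourier phi xi) <= K.
Proof.
elim: N phi => [|N ih] phi sphi.
  have [K hK] := fourier_bounded (schwartz_rapid sphi).
  by exists K => xi; rewrite expr0 mul1r.
pose psi x := phi x + (-1) * \sum_(i < n) cpderiv i (cpderiv i phi) x.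
have sS : schwartz (fun x => \sum_(i < n) cpderiv i (cpderiv i phi) x).
  by apply: (schwartz_sum _ sphi) => i; do 2 apply: schwartz_cpderiv.
have spsi : schwartz psi by apply: schwartzD => //; exact: schwartzZ.
have E xi : fourier psi xi = (1 + sqnorm xi)%:C * fourier phi xi.
  rewrite /psi fourierD; [|exact: schwartz_rapid|exact/schwartz_rapid/schwartzZ].
  rewrite fourierZ; last exact: schwartz_rapid.
  rewrite fourier_sum; last by move=> i; apply: schwartz_rapid; do 2 apply: schwartz_cpderiv.
  rewrite rmorphD /= mulrDl rmorph1 mul1r; congr (_ + _).
  rewrite /sqnorm rmorph_sum /= mulr_suml mulr_sumr; apply: eq_bigr => i _.
  rewrite !fourier_cpderiv//; last exact: schwartz_cpderiv.
  rewrite (_ : (xi ord0 i ^+ 2)%:C = - ((0 +i* xi ord0 i) * (0 +i* xi ord0 i))).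
    by move: (0 +i* _) => a; ring.
  by apply: complex_eq; rewrite !reim /=; ring.
have [K hK] := ih psi spsi; exists K => xi; apply: le_trans (hK xi).
rewrite E normcM normc_real ger0_norm; last by rewrite ltW// bracket_gt0.
by rewrite exprSr mulrA.
Qed.

(** The stable class consists of the real parts of transforms of Schwartz functions: d_j of such a
    function comes from i x_j phi. *)
Lemma schwartz_fourier phi : schwartz phi -> schwartz (fourier phi).
Proof.
pose P (f : V -> R) := exists2 phi, schwartz phi & f = fun xi => Re (fourier phi xi).
have key f : P f -> real_schwartz f.
  apply: real_schwartz_family => [_ x [u su ->]|_ N [u su ->]|_ i [u su ->]].
  - by have [] := fourier_differentiable x su.
  - have [K hK] := fourier_decay N su; exists K => x; apply: le_trans (hK x).
    by rewrite ler_wpM2l ?ler_Re_normc// exprn_ge0// ltW// bracket_gt0.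
  - exists (fun x => 'i%C * ((x ord0 i)%:C * u x)); first by apply/schwartzZ/schwartz_coord.
    by apply/funext => x; have [_ ->] := fourier_differentiable x su.
move=> sphi; split; apply: key; first by exists phi.
exists (fun x => - 'i%C * phi x); first exact: schwartzZ.
apply/funext => xi; rewrite fourierZ; last exact: schwartz_rapid.
by rewrite reim /= oppr0 mul0r sub0r mulN1r opprK.
Qed.

End fourier_schwartz.

(** * Mellin transforms of Gaussian averages *)

Section gaussian_pairing.
Context {R : realType} {n : nat}.
Local Notation C := R[i].
Local Notation V := 'rV[R]_n.
Local Notation lambda := (@lebesgue_measure R).
Local Notation mu := (@lebesgue_tuple R n).
Local Notation row := (@row_of_tuple R n).
Implicit Types (chi : V -> C) (x : V) (t : R).

Definition gaussn t (y : V) : C := (expR (- t * sqnorm y))%:C.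

Lemma gaussnE t (u : n.-tuple R) : gaussn t (row u) = \prod_(i < n) gauss t (tnth u i).
Proof.
rewrite /gaussn /gauss -rmorph_prod /= -expR_sum -mulr_sumr; congr (expR (_ * _))%:C.
by apply: eq_bigr => i _; rewrite mxE.
Qed.

Lemma cis_sum (I : Type) (s : seq I) (F : I -> R) :
  cis (\sum_(i <- s) F i) = \prod_(i <- s) (cis (F i) : C).
Proof.
elim: s => [|i s ih]; first by rewrite !big_nil cis0.
by rewrite !big_cons cisD ih.
Qed.

Lemma gaussn_fourier t x : 0 < t ->
  cintegrable mu (fun u => gaussn t (row u) * cis (dotp x (row u))) /\
  cint mu (fun u => gaussn t (row u) * cis (dotp x (row u))) =
  (Num.sqrt (pi / t) ^+ n * expR (- sqnorm x / (4 * t)))%:C.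
Proof.
move=> t0.
have := @cint_prod _ n (fun i v => gauss t v * cis (v * x ord0 i))
  (fun i => (gauss_fourier (x ord0 i) t0).1).
rewrite (_ : (fun u => _) = (fun u => gaussn t (row u) * cis (dotp x (row u)))); last first.
  apply/funext => u; rewrite big_split /= -gaussnE; congr (_ * _).
  by rewrite -cis_sum; congr cis; apply: eq_bigr => i _; rewrite mxE mulrC.
move=> [i1 ->]; split => //.
under eq_bigr do rewrite (gauss_fourier _ t0).2.
rewrite -rmorph_prod big_split /= prodr_const card_ord -expR_sum; congr (_ * expR _)%:C.
by rewrite -mulr_suml -sumrN.
Qed.

Lemma measurable_gaussn t : cmeasurable (fun u : n.-tuple R => gaussn t (row u)).
Proof.
apply: cmeasurable_real; apply: measurableT_comp => //.
apply: measurable_funM; first exact: measurable_cst.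
exact: measurable_row_sqnorm.
Qed.

Lemma gaussn_integrable t : 0 < t -> cintegrable mu (fun u => gaussn t (row u)).
Proof.
move=> t0; have [+ _] := gaussn_fourier 0 t0; congr (cintegrable mu _).
apply/funext => u; rewrite /dotp big1 ?cis0 ?mulr1// => j _.
by rewrite mxE mul0r.
Qed.

Lemma gaussn_int t : 0 < t -> \int[mu]_u expR (- t * sqnorm (row u)) = Num.sqrt (pi / t) ^+ n.
Proof.
move=> t0; have [_] := gaussn_fourier 0 t0.
rewrite (_ : (fun u => _) = fun u => (expR (- t * sqnorm (row u)))%:C); last first.
  apply/funext => u; rewrite /dotp big1 ?cis0 ?mulr1// => j _.
  by rewrite mxE mul0r.
rewrite cint_real => -[->]; rewrite /sqnorm big1 ?oppr0 ?mul0r ?expR0 ?mulr1// => j _.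
by rewrite mxE expr0n.
Qed.

(** The multiplication formula: by Fubini the transform moves from chi to the Gaussian, where it is
    explicit. *)
Lemma gaussian_pairing chi t : 0 < t -> rapid chi ->
  cint mu (fun u => gaussn t (row u) * fourier chi (row u)) =
  (Num.sqrt (pi / t) ^+ n)%:C * cint mu (fun u => chi (row u) * (expR (- sqnorm (row u) / (4 * t)))%:C).
Proof.
move=> t0 rc; have ig := gaussn_integrable t0; have ic := rapid_integrable rc.
pose f (z : n.-tuple R * n.-tuple R) := gaussn t (row z.1) * (chi (row z.2) * cis (dotp (row z.2) (row z.1))).
have mdot : measurable_fun setT (fun z : n.-tuple R * n.-tuple R => dotp (row z.2) (row z.1)).
  apply: measurable_sum => i; apply: measurable_funM.
    exact: (measurableT_comp (measurable_row_coord i) measurable_snd).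
  exact: (measurableT_comp (measurable_row_coord i) measurable_fst).
have mf : cmeasurable f.
  apply: cmeasurableM; first exact: (cmeasurable_comp (measurable_gaussn t) measurable_fst).
  apply: cmeasurableM; last exact: cmeasurable_cis.
  by have [mc _] := rc; exact: (cmeasurable_comp mc measurable_snd).
have [ip _] := cint_mul ig ic.
have fi : cintegrable (mu \x mu)%E f.
  apply: (cintegrable_dom _ (cintegrable_normc ip)) => // z.
  by rewrite /f !normcM normc_cis mulr1.
have s2 (y : n.-tuple R) : cintegrable mu (fun u => f (y, u)).
  exact: (@cintegrableZ _ _ _ _ (gaussn t (row y)) _ (fourier_integrable (row y) rc)).
have s1 (u : n.-tuple R) : cintegrable mu (fun y => f (y, u)).
  rewrite (_ : (fun y : n.-tuple R => _) = fun y : n.-tuple R => chi (row u) * (gaussn t (row y) * cis (dotp (row u) (row y)))).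
    exact: (cintegrableZ (chi (row u)) (gaussn_fourier (row u) t0).1).
  by apply/funext => y; rewrite /f /= mulrCA.
have -> : (fun u : n.-tuple R => gaussn t (row u) * fourier chi (row u)) =
    fun u : n.-tuple R => cint mu (fun y => f (u, y)).
  apply/funext => u; rewrite /f /= fourierE.
  by rewrite (cintZ (gaussn t (row u)) (fourier_integrable (row u) rc)).
rewrite (cint_fubini fi s2 s1) -cintZ.
  apply: eq_cint => u.
  rewrite (_ : (fun y : n.-tuple R => _) = fun y : n.-tuple R => chi (row u) * (gaussn t (row y) * cis (dotp (row u) (row y)))).
    have [i1 e1] := gaussn_fourier (row u) t0.
    by rewrite (cintZ (chi (row u)) i1) e1 rmorphM /= mulrCA.
  by apply/funext => y; rewrite /f /= mulrCA.
apply: (cintegrable_dom _ (cintegrable_normc ic)) => [|u].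
  have [mc _] := rc; apply: cmeasurableM => //; apply: cmeasurable_real.
  apply: measurableT_comp => //; apply: measurable_funM; last exact: measurable_cst.
  by apply: measurableT_comp => //; exact: measurable_row_sqnorm.
rewrite normcM normc_real ger0_norm ?expR_ge0// ler_piMr ?normc_ge0//.
rewrite -expR0 ler_expR mulNr oppr_le0 divr_ge0 ?sqnorm_ge0//.
by rewrite mulr_ge0// ltW.
Qed.

End gaussian_pairing.

Section fubini_second_marginal.
Context d1 d2 (T1 : measurableType d1) (T2 : measurableType d2) {R : realType}.
Variables (m1 : {sigma_finite_measure set T1 -> \bar R})
  (m2 : {sigma_finite_measure set T2 -> \bar R}).

Lemma integrable_Rintegral2 (f : T1 * T2 -> R) : (m1 \x m2)%E.-integrable setT (EFin \o f) ->
  (forall y, m1.-integrable setT (fun x => (f (x, y))%:E)) ->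
  m2.-integrable setT (EFin \o (fun y => \int[m1]_x f (x, y))).
Proof.
move=> fi i1; have mf : measurable_fun setT (EFin \o f) by case/integrableP: fi.
apply/integrableP; split; first by apply/measurable_EFinP; exact: (measurable_Rintegral2 fi).
apply: le_lt_trans ((integrable21ltyP _ _ mf).1 fi); apply: ge0_le_integral => //=.
- apply/measurable_EFinP; apply: measurableT_comp => //; exact: (measurable_Rintegral2 fi).
- apply: (measurable_fun_fubini_tonelli_G (abse \o (EFin \o f))) => //=.
  exact: measurableT_comp.
- move=> y _; change (`|(\int[m1]_x f (x, y))%:E| <= \int[m1]_x `|(f (x, y))%:E|)%E.
  have -> : (\int[m1]_x f (x, y))%:E = (\int[m1]_x (f (x, y))%:E)%E.
    exact: EFin_Rintegral (i1 y).
  by apply: le_abse_integral => //; case/integrableP: (i1 y).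
Qed.

Lemma cintegrable_cint2 (f : T1 * T2 -> R[i]) : cintegrable (m1 \x m2)%E f ->
  (forall y, cintegrable m1 (fun x => f (x, y))) ->
  cintegrable m2 (fun y => cint m1 (fun x => f (x, y))).
Proof.
move=> [f1 f2] i1; split => /=.
  by apply: (integrable_Rintegral2 f1) => y; have [] := i1 y.
by apply: (integrable_Rintegral2 f2) => y; have [] := i1 y.
Qed.

End fubini_second_marginal.

Section mellin.
Context {R : realType} {n : nat}.
Local Notation C := R[i].
Local Notation V := 'rV[R]_n.
Local Notation lambda := (@lebesgue_measure R).
Local Notation mu := (@lebesgue_tuple R n).
Local Notation row := (@row_of_tuple R n).
Variables (g psi : V -> C).
Hypotheses (rg : rapid g) (rpsi : rapid psi).
Hypothesis gpsi : forall x, normc (g x) <= sqnorm x * normc (psi x).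
Implicit Types (s : C) (v t : R).

Definition gauss_average t : C := cint mu (fun u => gaussn t (row u) * g (row u)).

(* |x|^(-2 s) g x; at the origin, where ln 0 = 0 would make the power 1, g vanishes. *)
Definition log_power s (x : V) : C := cexp (- s * (ln (sqnorm x))%:C) * g x.

Lemma rapid_vanish0 x : sqnorm x = 0 -> g x = 0.
Proof.
move=> x0; have := gpsi x; rewrite x0 mul0r leNgt normc_gt0 => /negPn/eqP.
by [].
Qed.

Lemma measurable_log_sqnorm : measurable_fun setT (fun u : n.-tuple R => ln (sqnorm (row u))).
Proof. by apply: measurableT_comp; [exact: measurable_ln|exact: measurable_row_sqnorm]. Qed.

Lemma measurable_log_power s : cmeasurable (log_power s \o row).
Proof.
apply: cmeasurableM; last by case: rg.
apply: cmeasurable_cexp; apply: cmeasurableM; first exact: cmeasurable_cst.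
by apply: cmeasurable_real; exact: measurable_log_sqnorm.
Qed.

(** Integrated over v first, this gives cgamma(s) |x|^(-2s) g(x); integrated over x first, the
    integrand of the Mellin transform of the Gaussian average. *)
Definition mellin_kernel s (z : R * n.-tuple R) : C :=
  cexp (s * z.1%:C) * (gaussn (expR z.1) (row z.2) * g (row z.2)).

Lemma measurable_mellin_kernel s : cmeasurable (mellin_kernel s).
Proof.
apply: cmeasurableM.
  exact: (cmeasurable_comp (cmeasurable_cexp_lin s) measurable_fst).
apply: cmeasurableM; last first.
  by have [mg _] := rg; exact: (cmeasurable_comp mg measurable_snd).
apply: cmeasurable_real; apply: measurableT_comp => //.
apply: measurable_funM.
  apply: measurableT_comp => //; exact: measurableT_comp.
exact: (measurableT_comp measurable_row_sqnorm measurable_snd).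
Qed.

Lemma normc_gaussn t (x : V) : 0 <= t -> normc (gaussn t x : C) <= 1.
Proof.
move=> t0; rewrite normc_real ger0_norm ?expR_ge0// -expR0 ler_expR mulNr oppr_le0.
by rewrite mulr_ge0 ?sqnorm_ge0.
Qed.

Lemma gaussn_dom_integrable t : 0 <= t -> cintegrable mu (fun u => gaussn t (row u) * g (row u)).
Proof.
move=> t0; apply: (cintegrable_dom _ (cintegrable_normc (rapid_integrable rg))) => [|u].
  by apply: cmeasurableM; [exact: measurable_gaussn|case: rg].
rewrite normcM ler_piMl ?normc_ge0//; exact: normc_gaussn.
Qed.

(* The second bound, with t = exp v, uses q exp(-t q) <= (2/t) exp(-t q/2): the
   double zero of g at the origin gains one power of 1/t over the Gaussian integral. *)
Lemma gauss_average_bound : exists2 M : R, 0 <= M & forall v,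
  \int[mu]_u normc (gaussn (expR v) (row u) * g (row u)) <= M /\
  \int[mu]_u normc (gaussn (expR v) (row u) * g (row u)) <=
    M * expR (- (n%:R / 2 + 1) * v).
Proof.
have [P P0 hP] := rapid_bound rpsi.
have ig := cintegrable_normc (rapid_integrable rg).
pose M1 := \int[mu]_u normc (g (row u)).
have M10 : 0 <= M1 by apply: Rintegral_ge0 => u _; exact: normc_ge0.
(* The factor 2 P comes from the bound on q exp(-t q/2) and from |g| <= q P; the root is the
   Gaussian integral at t/2 stripped of its power of t. *)
pose M2 := 2 * P * Num.sqrt (pi * 2) ^+ n.
have M20 : 0 <= M2 by rewrite !mulr_ge0// exprn_ge0// sqrtr_ge0.
exists (M1 + M2); first exact: addr_ge0.
move=> v; have it := cintegrable_normc (gaussn_dom_integrable (expR_ge0 v)).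
split.
  apply: (@le_trans _ _ M1); last by rewrite lerDl.
  apply: le_Rintegral => // u _; rewrite normcM ler_piMl ?normc_ge0//.
  by apply: normc_gaussn; exact: expR_ge0.
apply: (@le_trans _ _ (M2 * expR (- (n%:R / 2 + 1) * v))); last first.
  by apply: ler_wpM2r; [exact: expR_ge0|rewrite lerDr].
have t20 : 0 < expR v / 2 by rewrite divr_gt0 ?expR_gt0.
have ih := cintegrable_normc (gaussn_integrable (n := n) t20).
have -> : M2 * expR (- (n%:R / 2 + 1) * v) =
    \int[mu]_u (2 * expR (- v) * P * expR (- (expR v / 2) * sqnorm (row u))).
  rewrite RintegralZl//; last first.
    have := ih; congr (integrable _ _ _).
    apply/funext => u; congr (_%:E); rewrite -[RHS]ger0_norm ?expR_ge0//; exact: normc_real.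
  rewrite (gaussn_int (n := n) t20) /M2.
  have -> : pi / (expR v / 2) = pi * 2 * expR (- v) :> R.
    by rewrite expRN; field; rewrite gt_eqF ?expR_gt0.
  rewrite [in RHS]sqrtrM ?mulr_ge0 ?pi_ge0// exprMn.
  have -> : Num.sqrt (expR (- v)) = expR (- v / 2) :> R.
    have -> : - v = 2%:R * (- v / 2) by lra.
    by rewrite expRM_natl sqrtr_sqr ger0_norm ?expR_ge0//; congr expR; lra.
  rewrite -expRM_natl.
  have -> : - (n%:R / 2 + 1) * v = n%:R * (- v / 2) + - v by ring.
  by rewrite expRD; ring.
apply: le_Rintegral => //.
  have := integrableZl measurableT (2 * expR (- v) * P) ih.
  congr (integrable _ _ _); apply/funext => u; congr (_%:E); congr (_ * _).
  rewrite -[RHS]ger0_norm ?expR_ge0//; exact: normc_real.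
move=> u _; rewrite normcM normc_real ger0_norm ?expR_ge0//.
set q := sqnorm (row u); have q0 : 0 <= q by exact: sqnorm_ge0.
have hg : normc (g (row u)) <= q * P.
  apply: (le_trans (gpsi _)); apply: ler_wpM2l => //.
  apply: (le_trans (hP _)); rewrite ler_piMr//.
  by rewrite /weight invf_le1 ?exprn_gt0 ?bracket_gt0// exprn_ege1// bracket_ge1.
apply: (@le_trans _ _ (expR (- expR v * q) * (q * P))).
  by apply: ler_wpM2l; [exact: expR_ge0|].
have hq : q * (expR v / 2) <= expR (expR v / 2 * q).
  by have := expR_ge1Dx (expR v / 2 * q); lra.
have -> : - expR v * q = - (expR v / 2) * q + - (expR v / 2 * q) by lra.
rewrite expRD; set E := expR (- _ * q); have E0 : 0 <= E by exact: expR_ge0.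
have -> : E * expR (- (expR v / 2 * q)) * (q * P) = (expR (- (expR v / 2 * q)) * q) * (P * E) by ring.
have -> : 2 * expR (- v) * P * E = 2 * expR (- v) * (P * E) by ring.
apply: ler_wpM2r; first exact: mulr_ge0.
rewrite expRN ler_pdivrMl ?expR_gt0//.
rewrite expRN mulrA ler_pdivlMr ?expR_gt0//.
by move: hq; lra.
Qed.

End mellin.

Section mellin_identity.
Context {R : realType} {n : nat}.
Local Notation C := R[i].
Local Notation V := 'rV[R]_n.
Local Notation lambda := (@lebesgue_measure R).
Local Notation mu := (@lebesgue_tuple R n).
Local Notation row := (@row_of_tuple R n).
Variables (g psi : V -> C).
Hypotheses (rg : rapid g) (rpsi : rapid psi).
Hypothesis gpsi : forall x, normc (g x) <= sqnorm x * normc (psi x).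
Implicit Types (s : C) (v t : R).

Lemma mellin_kernel_section1 s v : cintegrable mu (fun u => mellin_kernel g s (v, u)).
Proof. exact: (cintegrableZ (cexp (s * v%:C)) (gaussn_dom_integrable rg (expR_ge0 v))). Qed.

(** The bounded estimate leaves exp(Re s v), decaying as v tends to -oo; the other leaves the rate
    n/2 + 1 - Re s as v tends to +oo. The strip is where both rates are positive. *)
Lemma mellin_kernel_decay s : 0 < Re s < n%:R / 2 + 1 -> exists k M : R, 0 < k /\
  forall v, \int[mu]_u normc (mellin_kernel g s (v, u)) <= M * expR (- k * `|v|).
Proof.
move=> /andP[s0 s1]; have [M M0 hM] := gauss_average_bound rg rpsi gpsi.
pose k := Num.min (Re s) (n%:R / 2 + 1 - Re s).
have k0 : 0 < k by rewrite lt_min s0 subr_gt0.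
exists k, M; split => // v.
have -> : \int[mu]_u normc (mellin_kernel g s (v, u)) =
    expR (Re s * v) * \int[mu]_u normc (gaussn (expR v) (row u) * g (row u)).
  rewrite -RintegralZl//.
    by apply: eq_Rintegral => u _; rewrite /mellin_kernel [LHS]normcM normc_cexp_lin.
  exact: (cintegrable_normc (gaussn_dom_integrable rg (expR_ge0 v))).
have [h1 h2] := hM v.
have [v0|v0] := leP 0 v.
  apply: le_trans (ler_wpM2l (expR_ge0 _) h2) _.
  rewrite mulrCA -expRD; apply: ler_wpM2l => //; rewrite ler_expR ger0_norm//.
  have : k <= n%:R / 2 + 1 - Re s by rewrite ge_min lexx orbT.
  by move=> hk; rewrite -mulrDl; apply: ler_wpM2r => //; lra.
apply: le_trans (ler_wpM2l (expR_ge0 _) h1) _.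
rewrite mulrC; apply: ler_wpM2l => //; rewrite ler_expR ltr0_norm// mulrNN.
by apply: ler_wnM2r; [exact: ltW|rewrite ge_min lexx].
Qed.

Lemma mellin_kernel_integrable s : 0 < Re s < n%:R / 2 + 1 ->
  cintegrable (lambda \x mu)%E (mellin_kernel g s).
Proof.
move=> hs; have [k [M [k0 hM]]] := mellin_kernel_decay hs.
have ih : lambda.-integrable setT (EFin \o (fun v => M * expR (- k * `|v|))).
  rewrite (_ : _ \o _ = (fun v => M%:E * (expR (- k * `|v|))%:E)%E).
    exact: (integrableZl measurableT M (integrable_expR_norm k0)).
  by apply/funext => v /=; rewrite EFinM.
have mk : cmeasurable (mellin_kernel g s : measurableTypeR R * n.-tuple R -> C).
  exact: (measurable_mellin_kernel rg s).
exact (@cintegrable_prod_dom _ _ _ _ _ lambda mu (mellin_kernel g s)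
  (fun v => M * expR (- k * `|v|)) mk (mellin_kernel_section1 s) hM ih).
Qed.

Lemma mellin_kernel_cint1 s v :
  cint mu (fun u => mellin_kernel g s (v, u)) = cexp (s * v%:C) * gauss_average g (expR v).
Proof. exact: (cintZ (cexp (s * v%:C)) (gaussn_dom_integrable rg (expR_ge0 v))). Qed.

(** The substitution t |x|^2 -> t in Euler's integral is a translation of v by ln |x|^2. At the
    origin g vanishes and so do both sides. *)
Lemma mellin_kernel_section2 s (u : n.-tuple R) : 0 < Re s ->
  cintegrable lambda (fun v => mellin_kernel g s (v, u)) /\
  cint lambda (fun v => mellin_kernel g s (v, u)) = cgamma s * log_power g s (row u).
Proof.
move=> s0; rewrite /mellin_kernel /log_power /=.
have [q0|q0] := eqVneq (sqnorm (row u)) 0.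
  rewrite (rapid_vanish0 gpsi q0) !mulr0.
  rewrite (_ : (fun v => _) = fun=> 0); first by split; [exact: cintegrable0|exact: cint0].
  by apply/funext => v; rewrite !mulr0.
have {}q0 : 0 < sqnorm (row u) by rewrite lt_neqAle eq_sym q0 sqnorm_ge0.
set l := ln (sqnorm (row u)).
have el : expR l = sqnorm (row u) by rewrite /l lnK ?posrE.
have ik : cintegrable lambda (fun v => cexp (s * v%:C) * gamma_kernel v).
  apply: (laplace_integrable (gamma_laplace_dom s0 s0)); by rewrite lexx.
have [ish esh] := cint_shift l ik.
have E : (fun v : R => cexp (s * v%:C) * (gaussn (expR v) (row u) * g (row u))) =
    (fun v => (cexp (- s * l%:C) * g (row u)) * (cexp (s * (v + l)%:C) * gamma_kernel (v + l))).
  apply/funext => v; rewrite rmorphD /= mulrDr cexpD.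
  have -> : gaussn (expR v) (row u) = gamma_kernel (v + l) :> C.
    by rewrite /gaussn /gamma_kernel expRD el mulNr.
  rewrite mulNr cexpN.
  have := cexp_neq0 (s * l%:C).
  move: (cexp _) (cexp _) (gamma_kernel _) (g _) => x1 x2 x3 x4 h.
  by field.
rewrite E; split; first exact: (cintegrableZ _ ish).
by rewrite (cintZ _ ish) esh mulrC.
Qed.

(** The modulus depends on Re s only, so s may be taken real; Fubini then gives integrability after
    multiplication by Gamma(Re s), a positive number that can be divided out. *)
Lemma log_power_integrable s : 0 < Re s < n%:R / 2 + 1 ->
  cintegrable mu (log_power g s \o row).
Proof.
move=> hs; have /andP[s0 _] := hs; have hs' : 0 < Re (Re s)%:C < n%:R / 2 + 1 by [].
have := cintegrable_cint2 (mellin_kernel_integrable hs') (fun u => (mellin_kernel_section2 u (s0 : 0 < Re (Re s)%:C)).1).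
rewrite (_ : (fun u => cint lambda _) = fun u => (Gamma (Re s))%:C * log_power g (Re s)%:C (row u)); last first.
  by apply/funext => u; rewrite (mellin_kernel_section2 u (s0 : 0 < Re (Re s)%:C)).2 cgamma_real.
move=> /(cintegrableZ ((Gamma (Re s))%:C^-1)) /cintegrable_normc iN.
apply: (cintegrable_dom _ iN) => [|u]; first exact: (measurable_log_power rg).
rewrite mulrA mulVf ?mul1r; last first.
  by have := Gamma_gt0 s0; apply: contraTneq => -[->]; rewrite ltxx.
have NE s' : normc (log_power g s' (row u)) = expR (- Re s' * ln (sqnorm (row u))) * normc (g (row u)).
  by rewrite /log_power [LHS]normcM [X in X * _]normc_cexp_lin !reim.
by rewrite /comp !NE.
Qed.

Lemma mellin_gauss_average s : 0 < Re s < n%:R / 2 + 1 ->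
  laplace (fun v => gauss_average g (expR v)) s = cgamma s * cint mu (log_power g s \o row).
Proof.
move=> hs; have /andP[s0 _] := hs.
have F := cint_fubini (mellin_kernel_integrable hs) (mellin_kernel_section1 s)
  (fun u => (mellin_kernel_section2 u s0).1).
have -> : laplace (fun v => gauss_average g (expR v)) s =
    cint lambda (fun v => cint mu (fun u => mellin_kernel g s (v, u))).
  by apply: eq_cint => v; rewrite mellin_kernel_cint1.
rewrite F -(cintZ (cgamma s) (log_power_integrable hs)).
by apply: eq_cint => u; exact: (mellin_kernel_section2 u s0).2.
Qed.

Lemma gauss_average_laplace_dom (a b : R) : 0 < a < n%:R / 2 + 1 -> 0 < b < n%:R / 2 + 1 ->
  laplace_dom (fun v => gauss_average g (expR v)) a b.
Proof.
have H (c : R) : 0 < c < n%:R / 2 + 1 ->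
    cintegrable lambda (fun v => cexp (c%:C * v%:C) * gauss_average g (expR v)).
  move=> hc; have hs : 0 < Re c%:C < n%:R / 2 + 1 by [].
  have := cintegrable_cint1 (mellin_kernel_integrable hs) (mellin_kernel_section1 c%:C).
  by congr (cintegrable _ _); apply/funext => v; rewrite mellin_kernel_cint1.
have H' (c : R) : 0 < c < n%:R / 2 + 1 -> lambda.-integrable setT
    (EFin \o (fun v => expR (c * v) * normc (gauss_average g (expR v)))).
  move=> /H /cintegrable_normc; congr (integrable _ _ _); apply/funext => v.
  by congr (_%:E); rewrite normcM normc_cexp_lin.
move=> ha hb; split; [|exact: H'|exact: H'].
rewrite (_ : (fun v => _) = fun v => cexp (- a%:C * v%:C) * (cexp (a%:C * v%:C) * gauss_average g (expR v))).
  apply: cmeasurableM; first exact: cmeasurable_cexp_lin.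
  exact: cintegrable_measurable (H a ha).
by apply/funext => v; rewrite mulrA -cexpD mulNr addNr cexp0 mul1r.
Qed.

End mellin_identity.

(** * Expansion in powers of 1/t and continuation of the Mellin transform *)

Section exponential_taylor.
Context {R : realType}.
Implicit Types y : R.

Definition exp_taylor (K : nat) y : R := \sum_(m < K) (- y) ^+ m / m`!%:R.

Lemma is_derive_exp_taylor K y : is_derive y 1 (exp_taylor K.+1) (- exp_taylor K y).
Proof.
elim: K => [|K ih].
  rewrite (_ : exp_taylor 1 = cst 1); last first.
    by apply/funext => z; rewrite /exp_taylor big_ord1 expr0 divr1.
  by rewrite /exp_taylor big_ord0 oppr0; exact: is_derive_cst.
rewrite (_ : exp_taylor K.+2 = exp_taylor K.+1 + ((K.+1)`!%:R)^-1 \*: ((-%R : R -> R) ^+ K.+1)); last first.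
  apply/funext => z; rewrite /exp_taylor big_ord_recr /= [X in _ + X]mulrC.
  by rewrite fctE /=; congr (_ + _ * _); rewrite exprfctE.
have -> : - exp_taylor K.+1 y = - exp_taylor K y + ((K.+1)`!%:R)^-1 *: ((K.+1%:R * (- y) ^+ K) *: -1).
  rewrite /exp_taylor big_ord_recr /= opprD; congr (_ + _).
  rewrite /GRing.scale /= factS natrM invfM mulrN1 mulrN; congr (- _).
  have : (K.+1)%:R != 0 :> R by [].
  have : (K`!)%:R != 0 :> R by rewrite pnatr_eq0 -lt0n fact_gt0.
  move: (K.+1)%:R (K`!)%:R => a b b0 a0.
  by field; rewrite b0 a0.
apply: is_deriveD; apply: is_deriveZ.
Qed.

(** The derivative of the remainder of order K+1 is minus the remainder of order K, so the mean
    value theorem gives the bound c^K y with 0 <= c <= y. *)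
Lemma exp_taylor_bound K y : 0 <= y -> `|expR (- y) - exp_taylor K y| <= y ^+ K.
Proof.
elim: K y => [|K ih] y y0.
  rewrite /exp_taylor big_ord0 subr0 expr0 ger0_norm ?expR_ge0//.
  by rewrite -expR0 ler_expR oppr_le0.
pose f z := expR (- z) - exp_taylor K.+1 z.
have df (z : R) : is_derive z (1 : R) f (- (expR (- z) - exp_taylor K z)).
  have -> : - (expR (- z) - exp_taylor K z) = expR (- z) * -1 - (- exp_taylor K z) by ring.
  exact: (is_deriveB (is_derive1_comp (is_derive_expR (- z)) (is_deriveNid z (1 : R)))
    (is_derive_exp_taylor K z)).
have [c [c1 c2 fE]] := mean_value_any 0 y df.
have : f 0 = 0.
  rewrite /f oppr0 expR0 /exp_taylor big_ord_recl /= oppr0 big1 ?addr0 ?divr1 ?expr0 ?subrr// => i _.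
  by rewrite /bump /= add1n expr0n mul0r.
move=> f0; rewrite f0 !subr0 in fE c1; rewrite -/(f y) fE normrM normrN (ger0_norm y0).
have c0 : 0 <= c by case/orP: c2 => /andP[h1 h2] => //; exact: le_trans y0 h1.
rewrite exprSr; apply: ler_wpM2r => //.
apply: le_trans (ih _ c0) _.
by rewrite !ger0_norm// in c1; rewrite lerXn2r ?nnegrE.
Qed.

End exponential_taylor.

Section heat_expansion.
Context {R : realType} {n : nat}.
Local Notation C := R[i].
Local Notation V := 'rV[R]_n.
Local Notation lambda := (@lebesgue_measure R).
Local Notation mu := (@lebesgue_tuple R n).
Local Notation row := (@row_of_tuple R n).
Variable chi : V -> C.
Hypothesis rc : rapid chi.
Implicit Types (s : C) (v t : R).

(** The coefficient of t^(-m) in exp(-|x|^2 / (4t)). *)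
Definition heat_weight (m : nat) (x : V) : R := (- (sqnorm x / 4)) ^+ m / m`!%:R.

Definition heat_moment (m : nat) : C :=
  cint mu (fun u => chi (row u) * (heat_weight m (row u))%:C).

Lemma rapid_heat_weight m : rapid (fun x => chi x * (heat_weight m x)%:C).
Proof.
apply: (@rapid_dom _ _ chi _ 1 m rc) => [|x].
  have [mc _] := rc; apply: cmeasurableM => //; apply: cmeasurable_real.
  apply: measurable_funM; last exact: measurable_cst.
  apply: measurable_funX; apply: measurableT_comp => //.
  by apply: measurable_funM; [exact: measurable_row_sqnorm|exact: measurable_cst].
rewrite mul1r normcM normc_real mulrC; apply: ler_wpM2r; first exact: normc_ge0.
rewrite /heat_weight normrM normrX normrN normfV normr_nat.
have f1 : 1 <= m`!%:R :> R by rewrite ler1n fact_gt0.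
rewrite ler_pdivrMr; last exact: lt_le_trans f1.
apply: (@le_trans _ _ ((1 + sqnorm x) ^+ m * 1)); last first.
  by apply: ler_wpM2l => //; apply: exprn_ge0; exact: ltW (bracket_gt0 x).
rewrite mulr1; have q0 := sqnorm_ge0 x.
rewrite ger0_norm ?divr_ge0//; apply: lerXn2r; rewrite ?nnegrE; lra.
Qed.

(** After the multiplication formula the exponential is expanded under the integral; the factor
    (pi/t)^(n/2) accounts for the offset n/2 in the exponents and for the power of sqrt(pi). *)
Lemma heat_expansion K : exists2 M : R, 0 <= M & forall v,
  normc (gauss_average (fourier chi) (expR v) -
    \sum_(m < K) ((Num.sqrt pi ^+ n)%:C * heat_moment m * (expR (- (n%:R / 2 + m%:R) * v))%:C))
  <= M * expR (- (n%:R / 2 + K%:R) * v).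
Proof.
pose h u := normc (chi (row u)) * (sqnorm (row u) / 4) ^+ K.
have ih : mu.-integrable setT (EFin \o h).
  have iN := cintegrable_normc (rapid_integrable (rapid_heat_weight K)).
  have := integrableZl measurableT K`!%:R iN; congr (integrable _ _ _).
  apply/funext => u; congr (_%:E); rewrite [normc _]normcM normc_real /heat_weight.
  rewrite normrM normrX normrN normfV normr_nat ger0_norm ?divr_ge0 ?sqnorm_ge0//.
  rewrite mulrCA mulrA [_ * (_ * _^-1)]mulrC.
  have : (K`!)%:R != 0 :> R by rewrite pnatr_eq0 -lt0n fact_gt0.
  rewrite /h; move: (K`!)%:R => a a0.
  by field.
have h0 : 0 <= \int[mu]_u h u.
  by apply: Rintegral_ge0 => u _; rewrite mulr_ge0 ?normc_ge0// exprn_ge0// divr_ge0// sqnorm_ge0.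
exists (Num.sqrt pi ^+ n * (2 * \int[mu]_u h u)).
  by rewrite !mulr_ge0// exprn_ge0// sqrtr_ge0.
move=> v; have ev := expR_gt0 v.
rewrite /gauss_average gaussian_pairing//.
have -> : Num.sqrt (pi / expR v) ^+ n = Num.sqrt pi ^+ n * expR (- (n%:R / 2) * v) :> R.
  rewrite sqrtrM ?pi_ge0// exprMn; congr (_ * _).
  have -> : (expR v)^-1 = expR (- v / 2) ^+ 2 by rewrite -expRM_natl -expRN; congr expR; lra.
  by rewrite sqrtr_sqr ger0_norm ?expR_ge0// -expRM_natl; congr expR; lra.
pose r u := expR (- (sqnorm (row u) / 4 * expR (- v))) - exp_taylor K (sqnorm (row u) / 4 * expR (- v)).
pose fe (u : n.-tuple R) := chi (row u) * (expR (- sqnorm (row u) / (4 * expR v)))%:C.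
pose fs (m : 'I_K) (u : n.-tuple R) := (expR (- m%:R * v))%:C * (chi (row u) * (heat_weight m (row u))%:C).
have ife : cintegrable mu fe.
  apply: (cintegrable_dom _ (cintegrable_normc (rapid_integrable rc))) => [|u].
    have [mc _] := rc; apply: cmeasurableM => //; apply: cmeasurable_real.
    apply: measurableT_comp => //; apply: measurable_funM; last exact: measurable_cst.
    by apply: measurableT_comp => //; exact: measurable_row_sqnorm.
  rewrite [normc (fe u)]normcM normc_real ger0_norm ?expR_ge0// ler_piMr ?normc_ge0//.
  rewrite -expR0 ler_expR mulNr oppr_le0 divr_ge0 ?sqnorm_ge0//.
have ifm m := rapid_integrable (rapid_heat_weight m).
have ifs m : cintegrable mu (fs m) by exact: (cintegrableZ _ (ifm m)).
have fr u : chi (row u) * (r u)%:C = fe u - \sum_(m < K) fs m u.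
  rewrite /r rmorphB mulrBr; congr (_ * (expR _)%:C - _).
    by rewrite expRN; field; rewrite gt_eqF.
  rewrite rmorph_sum mulr_sumr; apply: eq_bigr => m _.
  rewrite /fs mulrCA -rmorphM /=; congr (_ * _%:C).
  have -> : - m%:R * v = m%:R * - v by ring.
  by rewrite /heat_weight expRM_natl -mulNr exprMn; ring.
have ifr : cintegrable mu (fun u => chi (row u) * (r u)%:C).
  rewrite (funext fr); apply: cintegrableB => //; exact: cintegrable_sum.
have E : cint mu fe = cint mu (fun u => chi (row u) * (r u)%:C) +
   \sum_(m < K) heat_moment m * (expR (- m%:R * v))%:C.
  rewrite (funext fr) cintB//; last exact: cintegrable_sum.
  rewrite cint_sum//; rewrite [X in _ - X](_ : _ = \sum_(m < K) heat_moment m * (expR (- m%:R * v))%:C) ?subrK//.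
  by apply: eq_bigr => m _; rewrite (cintZ _ (ifm m)) mulrC.
rewrite E mulrDr.
have -> : \sum_(m < K) ((Num.sqrt pi ^+ n)%:C * heat_moment m * (expR (- (n%:R / 2 + m%:R) * v))%:C) =
  (Num.sqrt pi ^+ n * expR (- (n%:R / 2) * v))%:C * \sum_(m < K) heat_moment m * (expR (- m%:R * v))%:C.
  rewrite mulr_sumr; apply: eq_bigr => m _.
  have -> : - (n%:R / 2 + m%:R) * v = - (n%:R / 2) * v + - m%:R * v by ring.
  by rewrite expRD !rmorphM /=; ring.
rewrite addrK normcM normc_real ger0_norm; last by rewrite mulr_ge0 ?expR_ge0// exprn_ge0// sqrtr_ge0.
have -> : - (n%:R / 2 + K%:R) * v = - (n%:R / 2) * v + - K%:R * v by ring.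
rewrite expRD mulrACA; apply: ler_wpM2l.
  by rewrite mulr_ge0 ?expR_ge0// exprn_ge0// sqrtr_ge0.
have iK : mu.-integrable setT (EFin \o (fun u => expR (- K%:R * v) * h u)).
  have := integrableZl measurableT (expR (- K%:R * v)) ih.
  by congr (integrable _ _ _); apply/funext => u /=; rewrite EFinM.
have -> : 2 * \int[mu]_u h u * expR (- K%:R * v) = 2 * \int[mu]_u (expR (- K%:R * v) * h u).
  by rewrite RintegralZl// -mulrA [_ * expR _]mulrC.
apply: (normc_cint_le ifr iK) => u.
rewrite normcM normc_real /h mulrCA; apply: ler_wpM2l; first exact: normc_ge0.
apply: le_trans (exp_taylor_bound K _) _.
  by rewrite mulr_ge0 ?expR_ge0// divr_ge0 ?sqnorm_ge0.
by rewrite exprMn -expRM_natl mulrC mulrN mulNr.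
Qed.

End heat_expansion.

Section mellin_continuation.
Context {R : realType} {n : nat}.
Local Notation C := R[i].
Local Notation V := 'rV[R]_n.
Local Notation lambda := (@lebesgue_measure R).
Local Notation mu := (@lebesgue_tuple R n).
Local Notation row := (@row_of_tuple R n).
Variables (chi psi : V -> C).
Local Notation g := (fourier chi).
Hypotheses (rc : rapid chi) (rg : rapid g) (rpsi : rapid psi).
Hypothesis gpsi : forall x, normc (g x) <= sqnorm x * normc (psi x).
Implicit Types (s : C) (v t : R).

(* This removes the pole at s = n/2, so that the strip 0 < Re s < n/2 + 1 is pole-free. *)
Lemma heat_moment0 : heat_moment chi 0 = 0.
Proof.
rewrite -(rapid_vanish0 gpsi (x := 0)); last first.
  by rewrite /sqnorm big1// => i _; rewrite mxE expr0n.
rewrite fourierE; apply: eq_cint => u.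
rewrite /heat_weight expr0 divr1 [dotp _ _]big1 ?cis0// => i _.
by rewrite [X in _ * X]mxE mulr0.
Qed.

Variable k : nat.
Let theta v : C := gauss_average g (expR v).
(** Index l stands for the term m = l + 1 of the expansion, since the moment of index 0 vanishes. *)
Let coef (l : nat) : C := (Num.sqrt pi ^+ n)%:C * heat_moment chi l.+1.
Let theta0 v : C := (1 - step_kernel v) * theta v.
Let thetaK v : C := step_kernel v * (theta v -
  \sum_(l < k.+1) coef l * (expR (- (n%:R / 2 + l.+1%:R) * v))%:C).

Let theta_measurable : cmeasurable (theta : R -> C).
Proof.
have h : 0 < (2^-1 : R) < n%:R / 2 + 1.
  have := ler0n R n; lra.
by have [] := gauss_average_laplace_dom rg rpsi gpsi h h.
Qed.

Let theta0_dom (a b : R) : 0 < a < n%:R / 2 + 1 -> a <= b -> laplace_dom theta0 a b.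
Proof.
move=> ha ab; have [_ ia _] := gauss_average_laplace_dom rg rpsi gpsi ha ha.
have m0 : cmeasurable (theta0 : R -> C).
  apply: cmeasurableM => //; apply: cmeasurableB; first exact: cmeasurable_cst.
  exact: measurable_step_kernel.
have H c : a <= c -> lambda.-integrable setT (EFin \o (fun v => expR (c * v) * normc (theta0 v))).
  move=> ac.
  have mf : measurable_fun setT (fun v : R => expR (c * v) * normc (theta0 v)).
    apply: measurable_funM; last exact: measurable_normc.
    apply: measurableT_comp => //; exact: measurable_funM.
  apply: (integrable_dom _ ia) => // v.
  rewrite ger0_norm; last by apply: mulr_ge0; [exact: expR_ge0|exact: normc_ge0].
  rewrite /theta0 normcM /step_kernel; have [v0|v0] := ltP 0 v.
    rewrite subrr normc0 mul0r mulr0; apply: mulr_ge0; [exact: expR_ge0|exact: normc_ge0].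
  rewrite subr0 normc1 mul1r; apply: ler_wpM2r; first exact: normc_ge0.
  by rewrite ler_expR; apply: ler_wnM2r.
by split => //; apply: H.
Qed.

Let thetaK_dom (a b : R) : a < n%:R / 2 + k.+2%:R -> b < n%:R / 2 + k.+2%:R -> laplace_dom thetaK a b.
Proof.
have [M M0 hM] := heat_expansion rc k.+2.
have mK : cmeasurable (thetaK : R -> C).
  apply: cmeasurableM; first exact: measurable_step_kernel.
  apply: cmeasurableB => //; apply: cmeasurable_sum => l.
  apply: cmeasurableM; first exact: cmeasurable_cst.
  apply: cmeasurable_real; apply: measurableT_comp => //; exact: measurable_funM.
have H c : c < n%:R / 2 + k.+2%:R ->
    lambda.-integrable setT (EFin \o (fun v => expR (c * v) * normc (thetaK v))).
  move=> hc.
  have mf : measurable_fun setT (fun v : R => expR (c * v) * normc (thetaK v)).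
    apply: measurable_funM; last exact: measurable_normc.
    apply: measurableT_comp => //; exact: measurable_funM.
  have c0 : c - (n%:R / 2 + k.+2%:R) < 0 by rewrite subr_lt0.
  have [_ ia _] := step_laplace_dom c0 c0.
  have iM : lambda.-integrable setT
      (EFin \o (fun v => M * (expR ((c - (n%:R / 2 + k.+2%:R)) * v) * normc (step_kernel v : C)))).
    have := integrableZl measurableT M ia.
    by congr (integrable _ _ _); apply/funext => v /=; rewrite EFinM.
  apply: (integrable_dom _ iM) => // v.
  rewrite ger0_norm; last by apply: mulr_ge0; [exact: expR_ge0|exact: normc_ge0].
  rewrite /thetaK normcM [leLHS]mulrCA [leRHS]mulrA [leRHS]mulrC.
  apply: ler_wpM2l; first exact: normc_ge0.
  (* Of the k + 2 terms of the expansion the first is zero; the others are the k + 1 terms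
     subtracted in [thetaK]. *)
  have := hM v; rewrite big_ord_recl /= heat_moment0 mulr0 mul0r add0r => h.
  apply: le_trans (ler_wpM2l (expR_ge0 (c * v)) h) _.
  by rewrite mulrCA -expRD -mulrDl.
by move=> ha hb; split => //; apply: H.
Qed.

(** E is the sum of the transforms of [theta0], holomorphic for Re s > 0, and of [thetaK],
    holomorphic for Re s < n/2 + k + 2. In the original strip the subtracted terms are integrable
    against exp(s v) on v > 0, and [laplace_step] turns them into the polar terms. *)
Lemma mellin_continuation : exists E : C -> C,
  (forall s, 0 < Re s < n%:R / 2 + k.+2%:R -> cdiff E s) /\
  forall s, 0 < Re s < n%:R / 2 + 1 ->
    cgamma s * cint mu (log_power g s \o row) =
    E s - \sum_(l < k.+1) (Num.sqrt pi ^+ n)%:C * heat_moment chi l.+1 /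
      (s - (n%:R / 2 + l.+1%:R)%:C).
Proof.
exists (fun s => laplace theta0 s + laplace thetaK s); split=> s hs.
  have /andP[s0 s1] := hs.
  apply: cdiffD.
    pose a := Num.min (Re s) 1 / 2.
    have a0 : 0 < a by rewrite divr_gt0// lt_min s0 /=.
    have a1 : a <= 1 / 2 by rewrite /a ler_pdivrMr// divfK// ge_min lexx orbT.
    have as' : a < Re s.
      have : Num.min (Re s) 1 <= Re s by rewrite ge_min lexx.
      by rewrite /a; lra.
    apply: (@cdiff_laplace _ _ a (Re s + 1)); last by apply/andP; split; [|rewrite ltrDl].
    apply: theta0_dom; first by have := ler0n R n; rewrite a0 /=; lra.
    lra.
  apply: (@cdiff_laplace _ _ (Re s - 1) ((Re s + (n%:R / 2 + k.+2%:R)) / 2)); last lra.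
  apply: thetaK_dom; lra.
have /andP[s0 s1] := hs.
rewrite -(mellin_gauss_average rg rpsi gpsi hs).
have i0 : cintegrable lambda (fun v => cexp (s * v%:C) * theta0 v).
  by apply: (laplace_integrable (theta0_dom hs (lexx _))); rewrite lexx.
have hK : Re s < n%:R / 2 + k.+2%:R by apply: lt_le_trans s1 _; rewrite lerD2l ler1n.
have iK : cintegrable lambda (fun v => cexp (s * v%:C) * thetaK v).
  by apply: (laplace_integrable (thetaK_dom hK hK)); rewrite lexx.
pose z (l : nat) : C := s - (n%:R / 2 + l.+1%:R)%:C.
have z0 l : Re (z l) < 0.
  by rewrite /z reim /= subr_lt0; apply: lt_le_trans s1 _; rewrite lerD2l ler1n.
have iz l : cintegrable lambda (fun v => coef l * (cexp (z l * v%:C) * step_kernel v)).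
  apply: cintegrableZ; apply: (laplace_integrable (step_laplace_dom (z0 l) (z0 l))).
  by rewrite lexx.
have -> : \sum_(l < k.+1) (Num.sqrt pi ^+ n)%:C * heat_moment chi l.+1 /
      (s - (n%:R / 2 + l.+1%:R)%:C) = - cint lambda (fun v => \sum_(l < k.+1)
       coef l * (cexp (z l * v%:C) * step_kernel v)).
  rewrite cint_sum => [|l]; last exact: iz.
  rewrite -sumrN; apply: eq_bigr => l _; rewrite cintZ.
    by have := laplace_step (z0 l); rewrite /laplace => ->; rewrite mulrN opprK.
  apply: (laplace_integrable (step_laplace_dom (z0 l) (z0 l))); by rewrite lexx.
rewrite opprK /laplace -(cintD i0 iK) -cintD; last first.
- by apply: cintegrable_sum => l; exact: iz.
- exact: cintegrableD.
apply: eq_cint => v; rewrite /theta0 /thetaK -/(theta v).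
have -> : \sum_(l < k.+1) coef l * (cexp (z l * v%:C) * step_kernel v) =
  cexp (s * v%:C) * (step_kernel v * \sum_(l < k.+1) coef l * (expR (- (n%:R / 2 + l.+1%:R) * v))%:C).
  rewrite !mulr_sumr; apply: eq_bigr => l _.
  have -> : z l * v%:C = s * v%:C + (- (n%:R / 2 + l.+1%:R) * v)%:C.
    by rewrite /z mulrBl mulNr rmorphN rmorphM.
  by rewrite cexpD cexp_real; ring.
ring.
Qed.

End mellin_continuation.

(** * Exterior algebra *)

Section exterior_algebra.
Context {R : realType} {n : nat}.
Local Notation C := R[i].
Local Notation form := (cform R n).
Implicit Types (w v : form) (i j k : 'I_n) (I : {set 'I_n}) (x : 'rV[R]_n).

Lemma wedge_signU1 i k I : k \notin I ->
  wedge_sign i (k |: I) = (-1) ^+ (k < i)%N * wedge_sign i I :> C.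
Proof.
move=> kI; rewrite /wedge_sign -exprD; congr (_ ^+ _).
rewrite (cardD1 k) !inE eqxx /=; congr (_ + _)%N.
apply: eq_card => j; rewrite !inE; case: eqVneq => [->|//] /=.
by rewrite (negPf kI).
Qed.

Lemma wedge_signD1 i k I : k \in I ->
  wedge_sign i I = (-1) ^+ (k < i)%N * wedge_sign i (I :\ k)%SET :> C.
Proof. by move=> kI; rewrite -wedge_signU1 ?finset.setD1K ?finset.setD11. Qed.

Lemma wedge_sign_sqr i I : wedge_sign i I * wedge_sign i I = 1 :> C.
Proof. by rewrite -expr2 sqrr_sign. Qed.

Lemma wedge_sign_swap i j (s t : C) : i != j ->
  (-1) ^+ (j < i)%N * s * t + (-1) ^+ (i < j)%N * t * s = 0.
Proof. by rewrite neq_ltn => /orP[] h; rewrite h ltnNge (ltnW h) /=; ring. Qed.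

(** With the next two lemmas, the canonical anticommutation relations. For i and j distinct, exactly
    one of i < j and j < i holds, so exactly one of the two orders acquires an extra sign. *)
Lemma wedge_wedge i j w : wedge_basis i (wedge_basis j w) + wedge_basis j (wedge_basis i w) = 0.
Proof.
apply/ffunP => I; rewrite !ffunE.
have [<-|ij] := eqVneq i j; first by rewrite !inE eqxx /= mulr0 if_same addr0.
rewrite !inE ij eq_sym ij /=.
have [iI|] := boolP (i \in I); have [jI|] := boolP (j \in I); rewrite ?mulr0 ?addr0//.
rewrite (wedge_signD1 i jI) (wedge_signD1 j iI) !mulrA.
rewrite (_ : I :\ j :\ i = I :\ i :\ j)%SET; last by rewrite finset.setDDl finset.setUC -finset.setDDl.
rewrite -mulrDl -[RHS](mul0r (w (I :\ i :\ j)%SET)); congr (_ * _).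
have := @wedge_sign_swap i j (wedge_sign i (I :\ j)%SET) (wedge_sign j (I :\ i)%SET) ij.
by rewrite -!mulrA.
Qed.

Lemma contract_contract i j w :
  contract_basis i (contract_basis j w) + contract_basis j (contract_basis i w) = 0.
Proof.
apply/ffunP => I; rewrite !ffunE.
have [<-|ij] := eqVneq i j; first by rewrite !inE eqxx /= mulr0 if_same addr0.
rewrite !inE (eq_sym j i) (negPf ij) /=.
have [iI|] := boolP (i \in I); have [jI|] := boolP (j \in I); rewrite ?mulr0 ?addr0//.
move=> jI iI.
rewrite (wedge_signU1 i jI) (wedge_signU1 j iI) !mulrA.
rewrite (_ : j |: (i |: I) = i |: (j |: I))%SET; last by rewrite finset.setUCA.
rewrite -mulrDl -[RHS](mul0r (w (i |: (j |: I))%SET)); congr (_ * _).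
have := @wedge_sign_swap i j (wedge_sign i I) (wedge_sign j I) ij.
by move: (wedge_sign _ _) (wedge_sign _ _) ((-1) ^+ _) ((-1) ^+ _) => a b c d <-; ring.
Qed.

Lemma wedge_contract i j w :
  wedge_basis i (contract_basis j w) + contract_basis j (wedge_basis i w) = (i == j)%:R *: w.
Proof.
apply/ffunP => I; rewrite !ffunE.
have [<-|ij] := eqVneq i j.
  rewrite !inE eqxx /= scale1r.
  have [iI|iI] := boolP (i \in I); rewrite /= ?mulr0 ?addr0 ?add0r.
    by rewrite (wedge_signD1 i iI) ltnn mul1r mulrA wedge_sign_sqr mul1r finset.setD1K.
  by rewrite (wedge_signU1 i iI) ltnn mul1r mulrA wedge_sign_sqr mul1r finset.setU1K.
rewrite scale0r !inE (eq_sym j i) (negPf ij) /=.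
have [iI|] := boolP (i \in I); have [jI|] := boolP (j \in I); rewrite /= ?andbF ?mulr0 ?addr0//.
move=> jI; rewrite (wedge_signD1 j iI) (wedge_signU1 i jI).
rewrite (_ : (j |: I) :\ i = j |: (I :\ i))%SET; last first.
  rewrite finset.setDUl; congr (_ :|: _)%SET; apply/finset.setDidPl.
  by rewrite disjoints1 !inE eq_sym.
move: ij; rewrite neq_ltn => /orP[] h; rewrite h ltnNge (ltnW h) /=; ring.
Qed.

Lemma scale_combine (s c : C) (a b : C^o) : s * (c *: a + b) = c *: (s * a : C^o) + s * b :> C.
Proof. rewrite /GRing.scale /=; ring. Qed.

Lemma wedge_basis_lincomb i (J : Type) (s : seq J) (c : J -> C) (v : J -> form) :
  wedge_basis i (\sum_(j <- s) c j *: v j) = \sum_(j <- s) c j *: wedge_basis i (v j).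
Proof.
apply/ffunP => I; elim: s => [|j s ih].
  by rewrite !big_nil !ffunE mulr0 if_same.
rewrite !big_cons ffunE in ih *; rewrite [in RHS]ffunE -ih !ffunE.
by case: ifP => _; rewrite ?scaler0 ?addr0//; exact: scale_combine.
Qed.

Lemma contract_basis_lincomb i (J : Type) (s : seq J) (c : J -> C) (v : J -> form) :
  contract_basis i (\sum_(j <- s) c j *: v j) = \sum_(j <- s) c j *: contract_basis i (v j).
Proof.
apply/ffunP => I; elim: s => [|j s ih].
  by rewrite !big_nil !ffunE mulr0 if_same.
rewrite !big_cons ffunE in ih *; rewrite [in RHS]ffunE -ih !ffunE.
by case: ifP => _; rewrite ?scaler0 ?addr0//; exact: scale_combine.
Qed.

Lemma int_extE x w : int_ext x w =
  \sum_i \sum_j (x ord0 i * x ord0 j)%:C *: contract_basis i (wedge_basis j w).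
Proof.
rewrite /int_ext /int_mul; apply: eq_bigr => i _.
rewrite /ext_mul contract_basis_lincomb scaler_sumr; apply: eq_bigr => j _.
by rewrite scalerA rmorphM.
Qed.

Lemma ext_intE x w : ext_int x w =
  \sum_i \sum_j (x ord0 i * x ord0 j)%:C *: wedge_basis i (contract_basis j w).
Proof.
rewrite /ext_int /ext_mul; apply: eq_bigr => i _.
rewrite /int_mul wedge_basis_lincomb scaler_sumr; apply: eq_bigr => j _.
by rewrite scalerA rmorphM.
Qed.

Lemma ext_mul_sqr x w : ext_mul x (ext_mul x w) = 0.
Proof.
have E : ext_mul x (ext_mul x w) =
    \sum_i \sum_j (x ord0 i * x ord0 j)%:C *: wedge_basis i (wedge_basis j w).
  rewrite {1}/ext_mul; apply: eq_bigr => i _.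
  rewrite /ext_mul wedge_basis_lincomb scaler_sumr; apply: eq_bigr => j _.
  by rewrite scalerA rmorphM.
have : ext_mul x (ext_mul x w) + ext_mul x (ext_mul x w) = 0.
  rewrite E [X in X + _ = _]exchange_big /= -big_split /= big1// => i _.
  rewrite -big_split /= big1// => j _.
  by rewrite [x ord0 j * _]mulrC -scalerDr wedge_wedge scaler0.
by move/eqP; rewrite -mulr2n -scaler_nat scaler_eq0 pnatr_eq0 /= => /eqP.
Qed.

Lemma int_mul_sqr x w : int_mul x (int_mul x w) = 0.
Proof.
have E : int_mul x (int_mul x w) =
    \sum_i \sum_j (x ord0 i * x ord0 j)%:C *: contract_basis i (contract_basis j w).
  rewrite {1}/int_mul; apply: eq_bigr => i _.
  rewrite /int_mul contract_basis_lincomb scaler_sumr; apply: eq_bigr => j _.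
  by rewrite scalerA rmorphM.
have : int_mul x (int_mul x w) + int_mul x (int_mul x w) = 0.
  rewrite E [X in X + _ = _]exchange_big /= -big_split /= big1// => i _.
  rewrite -big_split /= big1// => j _.
  by rewrite [x ord0 j * _]mulrC -scalerDr contract_contract scaler0.
by move/eqP; rewrite -mulr2n -scaler_nat scaler_eq0 pnatr_eq0 /= => /eqP.
Qed.

(** The symmetric coefficients x_i x_j see only the anticommutators, of which only the diagonal ones
    survive. Divided by |x|^2, the two operators are thus complementary projections. *)
Lemma int_ext_ext_int x w : int_ext x w + ext_int x w = (sqnorm x)%:C *: w.
Proof.
rewrite int_extE ext_intE exchange_big /= -big_split /=.
rewrite rmorph_sum scaler_suml; apply: eq_bigr => i _.
rewrite -big_split /= (bigD1 i)//= big1 ?addr0 => [|j ji].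
  by rewrite -scalerDr addrC wedge_contract eqxx scale1r expr2.
by rewrite [x ord0 j * _]mulrC -scalerDr addrC wedge_contract eq_sym (negPf ji) scale0r scaler0.
Qed.

Lemma ext_mulD x v w : ext_mul x (v + w) = ext_mul x v + ext_mul x w.
Proof.
rewrite /ext_mul -big_split /=; apply: eq_bigr => i _; rewrite -scalerDr; congr (_ *: _).
by apply/ffunP => I; rewrite !ffunE; case: ifP => _; rewrite ?addr0// mulrDr.
Qed.

Lemma ext_mulZ x c w : ext_mul x (c *: w) = c *: ext_mul x w.
Proof.
rewrite /ext_mul scaler_sumr; apply: eq_bigr => i _; rewrite scalerA mulrC -scalerA; congr (_ *: _).
by apply/ffunP => I; rewrite !ffunE; case: ifP => _; rewrite ?scaler0//; exact: mulrCA.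
Qed.

Lemma int_mulD x v w : int_mul x (v + w) = int_mul x v + int_mul x w.
Proof.
rewrite /int_mul -big_split /=; apply: eq_bigr => i _; rewrite -scalerDr; congr (_ *: _).
by apply/ffunP => I; rewrite !ffunE; case: ifP => _; rewrite ?addr0// mulrDr.
Qed.

Lemma int_mulZ x c w : int_mul x (c *: w) = c *: int_mul x w.
Proof.
rewrite /int_mul scaler_sumr; apply: eq_bigr => i _; rewrite scalerA mulrC -scalerA; congr (_ *: _).
by apply/ffunP => I; rewrite !ffunE; case: ifP => _; rewrite ?scaler0//; exact: mulrCA.
Qed.

Lemma int_extD x v w : int_ext x (v + w) = int_ext x v + int_ext x w.
Proof. by rewrite /int_ext ext_mulD int_mulD. Qed.

Lemma int_extZ x c w : int_ext x (c *: w) = c *: int_ext x w.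
Proof. by rewrite /int_ext ext_mulZ int_mulZ. Qed.

Lemma ext_intD x v w : ext_int x (v + w) = ext_int x v + ext_int x w.
Proof. by rewrite /ext_int int_mulD ext_mulD. Qed.

Lemma ext_intZ x c w : ext_int x (c *: w) = c *: ext_int x w.
Proof. by rewrite /ext_int int_mulZ ext_mulZ. Qed.

Lemma int_ext_ext_int0 x w : int_ext x (ext_int x w) = 0.
Proof. by rewrite /int_ext /ext_int ext_mul_sqr -(scale0r 0) int_mulZ !scale0r. Qed.

Lemma ext_int_int_ext0 x w : ext_int x (int_ext x w) = 0.
Proof. by rewrite /int_ext /ext_int int_mul_sqr -(scale0r 0) ext_mulZ !scale0r. Qed.

Lemma int_ext_sqr x w : int_ext x (int_ext x w) = (sqnorm x)%:C *: int_ext x w.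
Proof. by rewrite -int_extZ -int_ext_ext_int int_extD int_ext_ext_int0 addr0. Qed.

Lemma ext_int_sqr x w : ext_int x (ext_int x w) = (sqnorm x)%:C *: ext_int x w.
Proof. by rewrite -ext_intZ -int_ext_ext_int ext_intD ext_int_int_ext0 add0r. Qed.

Lemma wedge_contract_diag i w I :
  wedge_basis i (contract_basis i w) I = (i \in I)%:R * w I.
Proof.
rewrite !ffunE; have [iI|] := boolP (i \in I); last by rewrite mul0r.
by rewrite !inE eqxx (wedge_signD1 i iI) ltnn mul1r mulrA wedge_sign_sqr finset.setD1K.
Qed.

Lemma contract_wedge_diag i w I :
  contract_basis i (wedge_basis i w) I = (i \notin I)%:R * w I.
Proof.
rewrite !ffunE; have [iI|iI] := boolP (i \in I); first by rewrite mul0r.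
by rewrite !inE eqxx (wedge_signU1 i iI) ltnn mul1r mulrA wedge_sign_sqr finset.setU1K.
Qed.

Lemma sum_mem I : \sum_(i < n) (i \in I)%:R = #|I|%:R :> C.
Proof.
by rewrite -sum1_card natr_sum [RHS]big_mkcond; apply: eq_bigr => i _; case: (i \in I).
Qed.

(** The degree operator: the i-th term keeps the coefficient at I exactly when i lies in I. As
    traces of quadratic forms, this sum and the next give p and n - p. *)
Lemma sum_wedge_contract p w I : is_pform p w ->
  \sum_i (wedge_basis i (contract_basis i w) I : C) = p%:R * (w I : C) :> C.
Proof.
move=> pw; transitivity (\sum_i ((i \in I)%:R * (w I : C))).
  by apply: eq_bigr => i _; exact: wedge_contract_diag.
rewrite -mulr_suml sum_mem.
by have [->//|Ip] := eqVneq #|I| p; rewrite pw// !mulr0.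
Qed.

Lemma sum_contract_wedge p w I : is_pform p w ->
  \sum_i (contract_basis i (wedge_basis i w) I : C) = (n%:R - p%:R) * (w I : C) :> C.
Proof.
move=> pw; transitivity (\sum_(i < n) ((1 - (i \in I)%:R) * (w I : C))).
  apply: eq_bigr => i _; rewrite [LHS]contract_wedge_diag.
  by case: (i \in I); rewrite ?subrr ?subr0.
rewrite -mulr_suml sumrB sum_mem sumr_const card_ord.
by have [->//|Ip] := eqVneq #|I| p; rewrite pw// !mulr0.
Qed.

Lemma ext_int_0form x w : is_pform 0 w -> ext_int x w = 0.
Proof.
move=> w0; rewrite ext_intE; apply: big1 => i _; apply: big1 => j _.
rewrite (_ : contract_basis j w = 0).
  by rewrite (_ : wedge_basis i 0 = 0) ?scaler0//; apply/ffunP => I; rewrite !ffunE mulr0 if_same.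
apply/ffunP => I; rewrite !ffunE w0 ?mulr0 ?if_same//.
by rewrite cards_eq0; apply/finset.set0Pn; exists j; rewrite !inE eqxx.
Qed.

End exterior_algebra.

(** * Moments and residues *)

Section integration_by_parts.
Context {R : realType} {n : nat}.
Local Notation C := R[i].
Local Notation V := 'rV[R]_n.
Local Notation mu := (@lebesgue_tuple R n).
Local Notation row := (@row_of_tuple R n).
Local Notation e_ := (@delta_mx R 1 n ord0).
Implicit Types (f h : V -> R) (phi psi : V -> C) (i j : 'I_n).

Lemma pderivD i f h x : real_schwartz f -> real_schwartz h ->
  pderiv i (fun x => f x + h x) x = pderiv i f x + pderiv i h x.
Proof.
move=> sf sh; apply: deriveD; apply: diff_derivable; exact: real_schwartz_differentiable.
Qed.

Lemma pderiv_coord i j f x : real_schwartz f ->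
  pderiv i (fun x => x ord0 j * f x) x = (i == j)%:R * f x + x ord0 j * pderiv i f x.
Proof.
move=> sf; have du := diff_derivable (v := e_ i) (real_schwartz_differentiable x sf).
have dc := diff_derivable (v := e_ i) (differentiable_coord_rV j x).
rewrite /pderiv (deriveM dc du) derive_coord_rV mxE eqxx /= eq_sym addrC.
by rewrite /GRing.scale /= [f x * _]mulrC.
Qed.

Lemma cpderivD i phi psi x : schwartz phi -> schwartz psi ->
  cpderiv i (fun x => phi x + psi x) x = cpderiv i phi x + cpderiv i psi x.
Proof.
move=> [a1 a2] [b1 b2]; apply: complex_eq; rewrite !reim /= -pderivD//;
  by congr (pderiv i _ x); apply/funext => y; rewrite !reim.
Qed.

Lemma cpderiv_coord i j phi x : schwartz phi ->
  cpderiv i (fun x => (x ord0 j)%:C * phi x) x =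
  (i == j)%:R * phi x + (x ord0 j)%:C * cpderiv i phi x.
Proof.
move=> [a1 a2]; apply: complex_eq; rewrite !reim Re_natr Im_natr /= !mul0r.
  rewrite !subr0 -pderiv_coord//; congr (pderiv i _ x); apply/funext => y.
  by rewrite !reim /= mul0r subr0.
rewrite !addr0 -pderiv_coord//; congr (pderiv i _ x); apply/funext => y.
by rewrite !reim /= mul0r addr0.
Qed.

Lemma cpderiv0 i x : cpderiv i (fun _ : V => 0 : C) x = 0.
Proof. by rewrite /cpderiv /pderiv /= derive_cst. Qed.

Lemma cpderiv_sum (J : Type) (s : seq J) (F : J -> V -> C) i x phi : schwartz phi ->
  (forall l, schwartz (F l)) ->
  cpderiv i (fun x => \sum_(l <- s) F l x) x = \sum_(l <- s) cpderiv i (F l) x.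
Proof.
move=> sphi sF; elim: s => [|l s ih].
  rewrite big_nil -[RHS](cpderiv0 i x); congr (cpderiv i _ x).
  by apply/funext => y; rewrite big_nil.
rewrite big_cons -ih -cpderivD//; last exact: (schwartz_sum _ sphi).
by congr (cpderiv i _ x); apply/funext => y; rewrite big_cons.
Qed.

Lemma cpderiv_sqnorm1 i phi x : schwartz phi ->
  cpderiv i (fun x => (sqnorm x)%:C * phi x) x =
  2 * (x ord0 i)%:C * phi x + (sqnorm x)%:C * cpderiv i phi x.
Proof.
move=> sphi.
have -> : (fun x => (sqnorm x)%:C * phi x) =
    fun x => \sum_(j < n) ((x ord0 j)%:C * ((x ord0 j)%:C * phi x)).
  apply/funext => y; rewrite /sqnorm rmorph_sum /= mulr_suml.
  by apply: eq_bigr => j _; rewrite rmorphXn /= expr2 mulrA.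
rewrite (cpderiv_sum _ _ _ sphi) => [|j]; last by do 2 apply: schwartz_coord.
have -> : \sum_(j < n) cpderiv i (fun y => (y ord0 j)%:C * ((y ord0 j)%:C * phi y)) x =
    \sum_(j < n) ((i == j)%:R * (2 * (x ord0 j)%:C * phi x) + (x ord0 j ^+ 2)%:C * cpderiv i phi x).
  apply: eq_bigr => j _; rewrite cpderiv_coord ?cpderiv_coord//; last exact: schwartz_coord.
  by rewrite rmorphXn /=; ring.
rewrite big_split /= -mulr_suml /sqnorm rmorph_sum; congr (_ + _).
rewrite (bigD1 i)//= eqxx mul1r big1 ?addr0// => j ji.
by rewrite eq_sym (negPf ji) mul0r.
Qed.

(** For m = 0 the truncated exponent m.-1 is harmless, its term being killed by the factor 2 m; the
    same convention holds in the moments below. *)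
Lemma cpderiv_sqnorm i m phi x : schwartz phi ->
  cpderiv i (fun x => (sqnorm x ^+ m)%:C * phi x) x =
  (2 * m)%:R * (x ord0 i)%:C * (sqnorm x ^+ m.-1)%:C * phi x + (sqnorm x ^+ m)%:C * cpderiv i phi x.
Proof.
move=> sphi; elim: m => [|m ih].
  rewrite muln0 !mul0r add0r expr0 mul1r; congr (cpderiv i _ x).
  by apply/funext => y; rewrite expr0 mul1r.
rewrite (_ : (fun x => _) = fun x => (sqnorm x)%:C * ((sqnorm x ^+ m)%:C * phi x)); last first.
  by apply/funext => y; rewrite exprS rmorphM mulrA.
rewrite cpderiv_sqnorm1; last exact: schwartz_sqnorm.
rewrite ih; case: m {ih} => [|m] /=.
  by rewrite expr0 expr1 muln0 muln1 !mul0r; ring.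
by rewrite !exprS !rmorphM /= !natrM -[m.+2%:R]natr1; ring.
Qed.

(** The derivative d_j of x_i |x|^(2m) phi has integral zero. *)
Lemma cint_coord_pderiv i j m phi : schwartz phi ->
  cint mu (fun u => (row u ord0 i)%:C * ((sqnorm (row u) ^+ m)%:C * cpderiv j phi (row u))) =
  - cint mu (fun u => ((i == j)%:R * (sqnorm (row u) ^+ m)%:C +
      (2 * m)%:R * (row u ord0 i * row u ord0 j)%:C * (sqnorm (row u) ^+ m.-1)%:C) * phi (row u)).
Proof.
move=> sphi; have sq := schwartz_sqnorm m sphi.
have i1 := rapid_integrable (schwartz_rapid (schwartz_coord i (schwartz_sqnorm m (schwartz_cpderiv j sphi)))).
have i2 : cintegrable mu (fun u => ((i == j)%:R * (sqnorm (row u) ^+ m)%:C +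
      (2 * m)%:R * (row u ord0 i * row u ord0 j)%:C * (sqnorm (row u) ^+ m.-1)%:C) * phi (row u)).
  have := rapid_integrable (schwartz_rapid (schwartzD (schwartzZ (i == j)%:R sq)
    (schwartzZ (2 * m)%:R (schwartz_coord i (schwartz_coord j (schwartz_sqnorm m.-1 sphi)))))).
  by congr (cintegrable mu _); apply/funext => u; rewrite /comp rmorphM /=; ring.
have := cint_cpderiv j (schwartz_coord i sq).
under eq_cint => u do rewrite cpderiv_coord// cpderiv_sqnorm//.
rewrite (_ : (fun u => _) = fun u : n.-tuple R => (row u ord0 i)%:C * ((sqnorm (row u) ^+ m)%:C * cpderiv j phi (row u))
  + ((i == j)%:R * (sqnorm (row u) ^+ m)%:C +
      (2 * m)%:R * (row u ord0 i * row u ord0 j)%:C * (sqnorm (row u) ^+ m.-1)%:C) * phi (row u)).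
  by rewrite cintD// => /eqP; rewrite addr_eq0 => /eqP.
by apply/funext => u; rewrite eq_sym rmorphM /=; ring.
Qed.

(** The vanishing integral of d_i (|x|^(2m+2) d_j phi) yields the factor 2(m+1) and leaves one
    derivative, which the preceding lemma removes. *)
Lemma cint_hessian i j m phi : schwartz phi ->
  cint mu (fun u => (sqnorm (row u) ^+ m.+1)%:C * cpderiv i (cpderiv j phi) (row u)) =
  (2 * m.+1)%:R * cint mu (fun u => ((i == j)%:R * (sqnorm (row u) ^+ m)%:C +
      (2 * m)%:R * (row u ord0 i * row u ord0 j)%:C * (sqnorm (row u) ^+ m.-1)%:C) * phi (row u)).
Proof.
move=> sphi; have sj := schwartz_cpderiv j sphi.
have i1 := rapid_integrable (schwartz_rapid (schwartz_sqnorm m.+1 (schwartz_cpderiv i sj))).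
have i2 := rapid_integrable (schwartz_rapid (schwartz_coord i (schwartz_sqnorm m sj))).
have := cint_cpderiv i (schwartz_sqnorm m.+1 sj).
under eq_cint => u do rewrite cpderiv_sqnorm//= -!mulrA.
rewrite (cintD (cintegrableZ (2 * m.+1)%:R i2) i1) (cintZ _ i2) cint_coord_pderiv//.
by rewrite mulrN addrC => /eqP; rewrite subr_eq0 => /eqP.
Qed.

End integration_by_parts.

Section quadratic_forms.
Context {R : realType} {n : nat}.
Local Notation C := R[i].
Local Notation V := 'rV[R]_n.
Local Notation mu := (@lebesgue_tuple R n).
Local Notation row := (@row_of_tuple R n).
Implicit Types (phi psi : V -> C) (i j : 'I_n) (a : 'I_n -> 'I_n -> C).

Definition quad a (x : V) : C := \sum_i \sum_j a i j * (x ord0 i * x ord0 j)%:C.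

(** The minus sign makes [quad a] the symbol: multiplying the transform of phi by [quad a] amounts
    to applying this operator to phi. *)
Definition hess a phi (x : V) : C := - \sum_i \sum_j a i j * cpderiv i (cpderiv j phi) x.

Lemma normc_sum (J : Type) (s : seq J) (F : J -> C) :
  normc (\sum_(l <- s) F l) <= \sum_(l <- s) normc (F l).
Proof.
elim: s => [|l s ih]; first by rewrite !big_nil normc0.
by rewrite !big_cons; apply: le_trans (normcD _ _) _; rewrite lerD2l.
Qed.

Lemma normc_quad a x : normc (quad a x) <= (\sum_i \sum_j normc (a i j)) * sqnorm x.
Proof.
apply: le_trans (normc_sum _ _) _; rewrite mulr_suml; apply: ler_sum => i _.
apply: le_trans (normc_sum _ _) _; rewrite mulr_suml; apply: ler_sum => j _.
rewrite normcM normc_real; apply: ler_wpM2l; first exact: normc_ge0.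
have := sqr_coord_le x i; have := sqr_coord_le x j.
rewrite normrM -(real_normK (num_real (x ord0 i))) -(real_normK (num_real (x ord0 j))).
by move: `|_| `|_| (sqnorm x) => u v q; nra.
Qed.

Lemma schwartz_hess a phi : schwartz phi -> schwartz (hess a phi).
Proof.
move=> sphi; rewrite (_ : hess a phi = fun x => -1 * \sum_i \sum_j a i j * cpderiv i (cpderiv j phi) x).
  apply: schwartzZ; apply: (schwartz_sum _ sphi) => i; apply: (schwartz_sum _ sphi) => j.
  by apply: schwartzZ; do 2 apply: schwartz_cpderiv.
by apply/funext => x; rewrite mulN1r.
Qed.

Lemma fourier_hess a phi y : schwartz phi -> fourier (hess a phi) y = quad a y * fourier phi y.
Proof.
move=> sphi; have s2 i j := schwartz_cpderiv i (schwartz_cpderiv j sphi).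
have sj i := schwartz_sum (index_enum 'I_n) sphi (fun j => schwartzZ (a i j) (s2 i j)).
have si := schwartz_sum (index_enum 'I_n) sphi sj.
rewrite (_ : hess a phi = fun x => -1 * \sum_i \sum_j a i j * cpderiv i (cpderiv j phi) x); last first.
  by apply/funext => x; rewrite mulN1r.
rewrite fourierZ; last exact: schwartz_rapid.
rewrite fourier_sum => [|i]; last exact: schwartz_rapid.
rewrite mulN1r -sumrN /quad mulr_suml; apply: eq_bigr => i _.
rewrite fourier_sum => [|j]; last by apply: schwartz_rapid; exact: schwartzZ.
rewrite -sumrN mulr_suml; apply: eq_bigr => j _.
rewrite fourierZ; last exact: schwartz_rapid.
rewrite !fourier_cpderiv//; last exact: schwartz_cpderiv.
have -> : (y ord0 i * y ord0 j)%:C = - ((0 +i* y ord0 i) * (0 +i* y ord0 j)) :> C.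
  by apply: complex_eq; rewrite !reim /=; ring.
by move: (0 +i* _) (0 +i* _) => u v; ring.
Qed.

Lemma schwartz_quad a m phi : schwartz phi ->
  schwartz (fun x => quad a x * ((sqnorm x ^+ m)%:C * phi x)).
Proof.
move=> sphi; rewrite (_ : (fun x : V => _) = fun x : V => \sum_i \sum_j
    a i j * ((x ord0 i)%:C * ((x ord0 j)%:C * ((sqnorm x ^+ m)%:C * phi x)))).
  apply: (schwartz_sum _ sphi) => i; apply: (schwartz_sum _ sphi) => j.
  by apply: schwartzZ; do 2 apply: schwartz_coord; exact: schwartz_sqnorm.
apply/funext => x; rewrite /quad mulr_suml; apply: eq_bigr => i _.
rewrite mulr_suml; apply: eq_bigr => j _; rewrite rmorphM /=; ring.
Qed.

(** The constant collects (-1/4)^(m+1) / (m+1)! from [heat_weight], the sign of [hess] and the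
    2(m+1) of [cint_hessian]; the Kronecker term sums to the trace of a. *)
Lemma heat_moment_hess a m phi : schwartz phi ->
  heat_moment (hess a phi) m.+1 =
  ((-1) ^+ m / (2 * 4 ^+ m * m`!%:R))%:C * cint mu (fun u =>
    ((\sum_i a i i) * (sqnorm (row u) ^+ m)%:C +
     (2 * m)%:R * (quad a (row u) * (sqnorm (row u) ^+ m.-1)%:C)) * phi (row u)).
Proof.
move=> sphi.
pose H i j u := (sqnorm (row u) ^+ m.+1)%:C * cpderiv i (cpderiv j phi) (row u).
have iH i j : cintegrable mu (H i j).
  exact: (rapid_integrable (schwartz_rapid (schwartz_sqnorm m.+1 (schwartz_cpderiv i (schwartz_cpderiv j sphi))))).
pose T i j u : C := ((i == j)%:R * (sqnorm (row u) ^+ m)%:C +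
      (2 * m)%:R * (row u ord0 i * row u ord0 j)%:C * (sqnorm (row u) ^+ m.-1)%:C) * phi (row u).
have iT i j : cintegrable mu (T i j).
  have := rapid_integrable (schwartz_rapid (schwartzD (schwartzZ (i == j)%:R (schwartz_sqnorm m sphi))
    (schwartzZ (2 * m)%:R (schwartz_coord i (schwartz_coord j (schwartz_sqnorm m.-1 sphi)))))).
  by congr (cintegrable mu _); apply/funext => u; rewrite /comp /T rmorphM /=; ring.
pose c : C := ((-1) ^+ m.+1 / (4 ^+ m.+1 * m.+1`!%:R))%:C.
have -> : heat_moment (hess a phi) m.+1 = - c * \sum_i \sum_j a i j * cint mu (H i j).
  have -> : \sum_i \sum_j a i j * cint mu (H i j) = cint mu (fun u => \sum_i \sum_j a i j * H i j u).
    rewrite cint_sum => [|i]; last by apply: cintegrable_sum => j; exact: (cintegrableZ _ (iH i j)).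
    apply: eq_bigr => i _; rewrite cint_sum => [|j]; last exact: (cintegrableZ _ (iH i j)).
    by apply: eq_bigr => j _; rewrite (cintZ _ (iH i j)).
  rewrite -cintZ; last by apply: cintegrable_sum => i; apply: cintegrable_sum => j; exact: (cintegrableZ _ (iH i j)).
  apply: eq_cint => u; rewrite /hess /heat_weight mulNr mulNr; congr (- _).
  have -> : (- (sqnorm (row u) / 4)) ^+ m.+1 / m.+1`!%:R =
      (-1) ^+ m.+1 / (4 ^+ m.+1 * m.+1`!%:R) * sqnorm (row u) ^+ m.+1.
    by rewrite -mulNr exprMn exprVn -[- sqnorm _]mulN1r exprMn invfM; ring.
  rewrite rmorphM /= -/c mulrCA; congr (_ * _); rewrite mulr_suml; apply: eq_bigr => i _.
  by rewrite mulr_suml; apply: eq_bigr => j _; rewrite /H; ring.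
have -> : cint mu (fun u => ((\sum_i a i i) * (sqnorm (row u) ^+ m)%:C +
     (2 * m)%:R * (quad a (row u) * (sqnorm (row u) ^+ m.-1)%:C)) * phi (row u)) =
    \sum_i \sum_j a i j * cint mu (T i j).
  rewrite (_ : (fun u : n.-tuple R => _) = fun u : n.-tuple R => \sum_i \sum_j a i j * T i j u).
    rewrite cint_sum => [|i]; last by apply: cintegrable_sum => j; exact: (cintegrableZ _ (iT i j)).
    apply: eq_bigr => i _; rewrite cint_sum => [|j]; last exact: (cintegrableZ _ (iT i j)).
    by apply: eq_bigr => j _; rewrite (cintZ _ (iT i j)).
  apply/funext => u; rewrite /quad !mulr_suml mulr_sumr -big_split /= mulr_suml.
  apply: eq_bigr => i _; rewrite mulr_suml mulr_sumr /T.
  have -> : a i i * (sqnorm (row u) ^+ m)%:C = \sum_j a i j * ((i == j)%:R * (sqnorm (row u) ^+ m)%:C).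
    rewrite (bigD1 i)//= eqxx mul1r big1 ?addr0// => j ji.
    by rewrite eq_sym (negPf ji) mul0r mulr0.
  rewrite -big_split /= mulr_suml; apply: eq_bigr => j _; ring.
rewrite !mulr_sumr; apply: eq_bigr => i _; rewrite !mulr_sumr; apply: eq_bigr => j _.
rewrite /H cint_hessian// -/(T i j) mulrCA [RHS]mulrCA; congr (_ * _).
rewrite mulrA; congr (_ * _).
rewrite /c natrC -rmorphN -rmorphM; congr (_%:C).
have f0 : m`!%:R != 0 :> R by rewrite pnatr_eq0 -lt0n fact_gt0.
have m0 : m.+1%:R != 0 :> R by [].
rewrite factS !natrM !exprS; move: (m.+1%:R) (m`!%:R) f0 m0 => b f f0 b0.
have : 4 ^+ m != 0 :> R by rewrite expf_neq0.
move: (4 ^+ m) ((-1) ^+ m) => p q p0.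
by field; rewrite f0 b0 p0.
Qed.

End quadratic_forms.

(** * Pairings with the Riesz family as Mellin transforms *)

Section riesz_strip.
Context {R : realType} {n : nat}.
Local Notation C := R[i].
Local Notation V := 'rV[R]_n.
Local Notation mu := (@lebesgue_tuple R n).
Local Notation row := (@row_of_tuple R n).
Local Notation form := (cform R n).
Implicit Types (phi psi : V -> C) (i j : 'I_n) (a : 'I_n -> 'I_n -> C) (w : form).

Lemma cpow_cexp (q : R) (z : C) : 0 < q -> cpow q z = cexp (z * (ln q)%:C).
Proof.
move=> q0; rewrite /cpow /cexp !reim /= !mulr0 subr0 add0r /powR gt_eqF//.
Qed.

(** For fixed w and I the I-coefficient of i_x eps_x w is a quadratic form in x with these
    coefficients; likewise [ext_int_coef] for eps_x i_x w. *)
Definition int_ext_coef w I i j : C := contract_basis i (wedge_basis j w) I.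
Definition ext_int_coef w I i j : C := wedge_basis i (contract_basis j w) I.

Lemma quad_int_ext w I x : quad (int_ext_coef w I) x = int_ext x w I.
Proof.
rewrite int_extE sum_ffunE; apply: eq_bigr => i _; rewrite sum_ffunE; apply: eq_bigr => j _.
by rewrite [RHS]ffunE mulrC.
Qed.

Lemma quad_ext_int w I x : quad (ext_int_coef w I) x = ext_int x w I.
Proof.
rewrite ext_intE sum_ffunE; apply: eq_bigr => i _; rewrite sum_ffunE; apply: eq_bigr => j _.
by rewrite [RHS]ffunE mulrC.
Qed.

Section hess_mellin.
Variables (a : 'I_n -> 'I_n -> C) (phi : V -> C).
Hypothesis sphi : schwartz phi.
Let majorant x : C := (\sum_i \sum_j normc (a i j))%:C * fourier phi x.

Lemma hess_rapid : rapid (hess a phi).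
Proof. exact/schwartz_rapid/schwartz_hess. Qed.

Lemma fourier_hess_rapid : rapid (fourier (hess a phi)).
Proof. exact/schwartz_rapid/schwartz_fourier/schwartz_hess. Qed.

Lemma fourier_hess_dominated : exists2 psi, rapid psi &
  forall x, normc (fourier (hess a phi) x) <= sqnorm x * normc (psi x).
Proof.
exists majorant; first exact/schwartz_rapid/schwartzZ/schwartz_fourier.
move=> x; rewrite fourier_hess// !normcM normc_real ger0_norm; last first.
  by apply: sumr_ge0 => i _; apply: sumr_ge0 => j _; exact: normc_ge0.
rewrite mulrA; apply: ler_wpM2r; first exact: normc_ge0.
by rewrite mulrC; exact: normc_quad.
Qed.

Lemma hess_log_power_integrable s : 0 < Re s < n%:R / 2 + 1 ->
  cintegrable mu (log_power (fourier (hess a phi)) s \o row).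
Proof.
have [psi rpsi h] := fourier_hess_dominated.
exact: (log_power_integrable fourier_hess_rapid rpsi h).
Qed.

Lemma hess_mellin_continuation k : exists E : C -> C,
  (forall s, 0 < Re s < n%:R / 2 + k.+2%:R -> cdiff E s) /\
  forall s, 0 < Re s < n%:R / 2 + 1 ->
    cgamma s * cint mu (log_power (fourier (hess a phi)) s \o row) =
    E s - \sum_(l < k.+1) (Num.sqrt pi ^+ n)%:C * heat_moment (hess a phi) l.+1 /
      (s - (n%:R / 2 + l.+1%:R)%:C).
Proof.
have [psi rpsi h] := fourier_hess_dominated.
exact: (mellin_continuation hess_rapid fourier_hess_rapid rpsi h k).
Qed.

End hess_mellin.

(** Here r^(lam - 2) = |x|^(-2s) with s = 1 - lam/2. At the origin the conventions for the powers do
    not matter, as [quad a] vanishes there. *)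
Lemma quad_log_power a phi lam x : schwartz phi ->
  rpow (lam - 2) x * quad a x * fourier phi x =
  log_power (fourier (hess a phi)) (1 - lam / 2) x.
Proof.
move=> sphi; rewrite /log_power fourier_hess// -mulrA.
have [q0|q0] := eqVneq (sqnorm x) 0.
  have : normc (quad a x) <= 0 by have := normc_quad a x; rewrite q0 mulr0.
  by rewrite leNgt normc_gt0 => /negPn/eqP ->; rewrite !(mul0r, mulr0).
rewrite /rpow cpow_cexp; last by rewrite lt_neqAle eq_sym q0 sqnorm_ge0.
suff -> : (lam - 2) / 2 = - (1 - lam / 2) by [].
by rewrite mulrBl divff ?pnatr_eq0// opprB.
Qed.

(** Under s = 1 - lam/2 the strip -n < Re lam < 2 is exactly the strip 0 < Re s < n/2 + 1 of the
    Mellin identity. *)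
Lemma regular_riesz phi w I lam (a b : C) : schwartz phi -> - n%:R < Re lam < 2 ->
  regular_dist (riesz_fun lam a b) (fourier phi) w I =
  a * cint mu (log_power (fourier (hess (int_ext_coef w I) phi)) (1 - lam / 2) \o row) +
  b * cint mu (log_power (fourier (hess (ext_int_coef w I) phi)) (1 - lam / 2) \o row).
Proof.
move=> sphi hl.
have hs : 0 < Re (1 - lam / 2) < n%:R / 2 + 1.
  have -> : lam / 2 = lam * (2^-1)%:C by rewrite rmorphV ?unitfE// rmorph_nat.
  by rewrite !reim /= mulr0 subr0; lra.
have i1 := hess_log_power_integrable (int_ext_coef w I) sphi hs.
have i2 := hess_log_power_integrable (ext_int_coef w I) sphi hs.
rewrite -(cintZ a i1) -(cintZ b i2) -(cintD (cintegrableZ a i1) (cintegrableZ b i2)).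
rewrite /regular_dist ffunE; apply: eq_cint => u.
rewrite /comp -!quad_log_power// quad_int_ext quad_ext_int /riesz_fun !ffunE /GRing.scale /=.
by move: (rpow _ _) (int_ext _ _ _) (ext_int _ _ _) (fourier _ _) => u1 u2 u3 u4; ring.
Qed.

End riesz_strip.

(** * Continuation through the upper half-plane *)

Section upper_strip.
Context {R : realType}.
Local Notation C := R[i].
Implicit Types (z c : C).

Lemma ball_ReIm z c (r : R) : normc (z - c) < r ->
  [/\ Re c - r < Re z, Re z < Re c + r, Im c - r < Im z & Im z < Im c + r].
Proof.
move=> h; have h1 := le_lt_trans (ler_Re_normc (z - c)) h.
have h2 := le_lt_trans (ler_Im_normc (z - c)) h.
move: h1 h2; rewrite !reim !ltr_norml => /andP[a1 a2] /andP[b1 b2].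
by split; lra.
Qed.

Lemma square_ReIm z c (L : R) : in_square c L z ->
  [/\ Re c - L <= Re z, Re z <= Re c + L, Im c - L <= Im z & Im z <= Im c + L].
Proof.
case; rewrite !reim !ler_norml => /andP[a1 a2] /andP[b1 b2].
by split; lra.
Qed.

(* The poles of the Riesz family are real, so the upper half of the strip is free
   of them: discs of radius 1/2 reach every point with Im z > 1/2, and one more
   disc centred at x + i comes arbitrarily close to x. *)
Lemma upper_strip_continuation (D : C -> C) (lo t0 hi x t : R) : t0 + 1 <= hi ->
  (forall z, lo < Re z < hi -> 0 < Im z -> cdiff D z) ->
  (forall z, t0 < Re z < hi -> 0 < Im z -> D z = 0) ->
  lo + 1 < x -> x + 1 < hi -> 0 < t <= 1 -> D (x +i* t) = 0.
Proof.
move=> t0hi dD D0 lox xhi /andP[tpos t1].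
have steps m z : 2^-1 < Im z -> lo + 3 / 4 < Re z < hi -> t0 - m%:R / 8 < Re z -> D z = 0.
  elim: m z => [|m ih] z imz /andP[z1 z2] z3.
    by apply: D0; [apply/andP; split; lra|lra].
  have [h|h] := ltP (t0 - m%:R / 8) (Re z); first by apply: ih => //; apply/andP.
  have m0 : 0 <= m%:R / 8 :> R by rewrite divr_ge0.
  pose r := Num.min (1 / 8) (Im z - 2^-1).
  have r0 : 0 < r by rewrite lt_min subr_gt0 imz andbT divr_gt0.
  have r1 : r <= 1 / 8 by rewrite ge_min lexx.
  have r2 : r <= Im z - 2^-1 by rewrite ge_min lexx orbT.
  have l0 : 0 < (2^-1 : R) by rewrite invr_gt0.
  (* The disc of radius 1/2 about [c] contains z and stays above the real axis, while the r-disc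
     about [c] lies more than 1/8 to the right of the current bound, where D is already known to
     vanish. *)
  pose c := z + (1 / 4)%:C.
  have cR : Re c = Re z + 1 / 4 by rewrite /c reim.
  have cI : Im c = Im z by rewrite /c reim /= addr0.
  apply: (@unique_continuation_disc _ D c r 2^-1 r0 l0).
  - move=> y /square_ReIm; rewrite cR cI => -[y1 y2 y3 y4].
    by apply: dD; [apply/andP; split; lra|lra].
  - move=> y /ball_ReIm; rewrite cR cI => -[y1 y2 y3 y4].
    move: z3; rewrite -natr1 mulrDl => z3.
    by apply: ih; [lra|apply/andP; split; lra|lra].
  - rewrite /c opprD addrA subrr add0r -rmorphN normc_real normrN ger0_norm//; lra.
pose m := Num.bound (8 * (t0 - lo)).
have hm : t0 - m%:R / 8 < lo.
  have : 8 * (t0 - lo) < m%:R.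
    have [h|h] := leP 0 (8 * (t0 - lo)); first exact: archi_boundP.
    exact: lt_le_trans h _.
  lra.
have r0 : 0 < (4^-1 : R) by rewrite invr_gt0.
(* About x + i, a square of half-side 1 - t/2 stays at height at least t/2, and its inscribed disc
   contains x + it at distance 1 - t. *)
have L0 : 0 < 1 - t / 2 by lra.
apply: (@unique_continuation_disc _ D (x +i* 1) 4^-1 (1 - t / 2) r0 L0).
- move=> y /square_ReIm /= [y1 y2 y3 y4].
  by apply: dD; [apply/andP; split; lra|lra].
- move=> y /ball_ReIm /= [y1 y2 y3 y4].
  by apply: (steps m); [lra|apply/andP; split; lra|lra].
- rewrite (_ : _ - _ = 0 +i* (t - 1)); last by apply: complex_eq; rewrite !reim /= ?subrr.
  by rewrite normc_i ler0_norm; lra.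
Qed.

Lemma cdiff_zero_above (h : C -> C) z : cdiff h z ->
  (exists2 r : R, 0 < r & forall t, 0 < t < r -> h (z + (0 +i* t)) = 0) -> h z = 0.
Proof.
move=> dh [r r0 hr]; apply: (@normc_le_ball _ _ 1) => // e e0.
have [r' r'0 hr'] := cdiff_continuous dh e0.
pose t := Num.min r r' / 2.
have t0 : 0 < Num.min r r' by rewrite lt_min r0.
have tr : Num.min r r' <= r by rewrite ge_min lexx.
have tr' : Num.min r r' <= r' by rewrite ge_min lexx orbT.
have : normc (h (z + (0 +i* t)) - h z) < e.
  apply: hr'; rewrite addrC addKr normc_i ger0_norm /t; lra.
rewrite hr; last by rewrite /t; apply/andP; split; lra.
by rewrite sub0r normcN mul1r => /ltW.
Qed.

Lemma entire_cdiff (f : C -> C) z : entire f -> cdiff f z.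
Proof.
move=> hf; have /near_normcP [r r0 h] := hf z.
by apply/derivable_cdiff; apply: h; rewrite subrr normc0.
Qed.

Lemma holomorphic_cdiff (f : C -> C) z : holomorphic_at f z -> cdiff f z.
Proof.
move=> /near_normcP [r r0 h].
by apply/derivable_cdiff; apply: h; rewrite subrr normc0.
Qed.

End upper_strip.

Section mellin_variable.
Context {R : realType}.
Local Notation C := R[i].
Implicit Types (z : C).

Definition mellin_var z : C := 1 - z / 2.

Lemma Re_mellin_var z : Re (mellin_var z) = 1 - Re z / 2.
Proof.
rewrite /mellin_var (_ : z / 2 = z * (2^-1)%:C) ?reim /= ?mulr0 ?subr0//.
by rewrite rmorphV ?unitfE// rmorph_nat.
Qed.

Lemma Im_mellin_var z : Im (mellin_var z) = - (Im z / 2).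
Proof.
rewrite /mellin_var (_ : z / 2 = z * (2^-1)%:C) ?reim /= ?mulr0 ?add0r ?sub0r//.
by rewrite rmorphV ?unitfE// rmorph_nat.
Qed.

Lemma cdiff_mellin_var z : cdiff mellin_var z.
Proof.
apply: cdiffB; first exact: cdiff_cst.
by apply: cdiffM; [exact: cdiff_id|exact: cdiff_cst].
Qed.

Definition polar_sum (m : nat) (c d : nat -> C) z := \sum_(l < m) c l / (mellin_var z - d l).

Lemma cdiff_polar_sum m c d z : (forall l, (l < m)%N -> mellin_var z != d l) ->
  cdiff (polar_sum m c d) z.
Proof.
move=> h; apply: cdiff_sum => l; apply: cdiffM; first exact: cdiff_cst.
apply: cdiffV; first by rewrite subr_eq0 h.
by apply: cdiffB; [exact: cdiff_mellin_var|exact: cdiff_cst].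
Qed.

End mellin_variable.

(** * The residue of a pairing in terms of moments *)

Section riesz_residue.
Context {R : realType} {n : nat}.
Local Notation C := R[i].
Local Notation V := 'rV[R]_n.
Local Notation form := (cform R n).
Implicit Types (z : C).

Lemma mellin_var_pole k : mellin_var (riesz_pole R n k) = (n%:R / 2 + k.+1%:R)%:C.
Proof.
apply: complex_eq; rewrite ?Re_mellin_var ?Im_mellin_var /riesz_pole !reim !Re_natr !Im_natr /=.
  by rewrite -[k.+1%:R]natr1; lra.
by lra.
Qed.

Lemma riesz_poleE k : riesz_pole R n k = (- n%:R - 2 * k%:R)%:C.
Proof. by rewrite /riesz_pole rmorphB rmorphN rmorphM /= !natrC. Qed.

(** The origin of the factor 2: a polar term c / (s - s_k) becomes -2 c / (lambda - pole). *)
Lemma mellin_varB z k : mellin_var z - (n%:R / 2 + k.+1%:R)%:C = - (z - riesz_pole R n k) / 2.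
Proof. by rewrite -mellin_var_pole /mellin_var; move: (riesz_pole _ _ _) => y; field. Qed.

(** Both sides are limits at the pole of lambda - pole times the Gamma factor times the pairing: the
    left one uses the given principal part, the right one the Mellin continuation, where only the
    last polar term survives. *)
Lemma riesz_residue (p : nat) (A B : C -> C) (Rz : C -> form_dist R n) (phi : V -> C)
    (w : form) (I : {set 'I_n}) (k : nat) (a : nat -> C) : (0 < n)%N ->
  entire A -> entire B -> is_riesz_family p A B Rz -> schwartz phi -> is_pform p w ->
  let pole := riesz_pole R n k in
  principal_part (fun z => Rz z (fourier phi) w I) pole 1 a ->
  (Gamma (n%:R / 2 + k.+1%:R))%:C * a 0%N =
  2 * (Num.sqrt pi ^+ n)%:C *
    (A pole * heat_moment (hess (int_ext_coef w I) phi) k.+1 +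
     B pole * heat_moment (hess (ext_int_coef w I) phi) k.+1).
Proof.
move=> n0 hA hB [_ Rstrip Rhol _] sphi pw pole [g hg Fg].
have spsi := schwartz_fourier sphi.
pose F z := Rz z (fourier phi) w I.
have [E1 [dE1 eE1]] := hess_mellin_continuation (int_ext_coef w I) sphi k.
have [E2 [dE2 eE2]] := hess_mellin_continuation (ext_int_coef w I) sphi k.
pose c1 l : C := (Num.sqrt pi ^+ n)%:C * heat_moment (hess (int_ext_coef w I) phi) l.+1.
pose c2 l : C := (Num.sqrt pi ^+ n)%:C * heat_moment (hess (ext_int_coef w I) phi) l.+1.
pose d l : C := (n%:R / 2 + l.+1%:R)%:C.
pose M z := A z * (E1 (mellin_var z) - polar_sum k.+1 c1 d z) +
  B z * (E2 (mellin_var z) - polar_sum k.+1 c2 d z).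
(* The next pole to the left: between [lo] and 2 lie exactly the poles of index 0 to k, and
   [mellin_var] maps this strip onto the domain of E1 and E2. *)
pose lo : R := - n%:R - 2 * k.+1%:R.
have n1 : 1 <= n%:R :> R by rewrite ler1n.
have ksucc : k.+1%:R = k%:R + 1 :> R by rewrite natr1.
have k2 : k.+2%:R = k%:R + 2 :> R by rewrite -natr1 ksucc; lra.
have k0 : 0 <= k%:R :> R by [].
have hvar z : lo < Re z < 2 -> 0 < Re (mellin_var z) < n%:R / 2 + k.+2%:R.
  by rewrite Re_mellin_var /lo k2 ksucc => /andP[h1 h2]; apply/andP; split; lra.
have dME z E : (forall s, 0 < Re s < n%:R / 2 + k.+2%:R -> cdiff E s) -> lo < Re z < 2 ->
    cdiff (fun z => E (mellin_var z)) z.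
  move=> dE hz; apply: (@cdiff_comp _ mellin_var E); first exact: cdiff_mellin_var.
  by apply: dE; exact: hvar.
have dgam z : Re z < 2 -> cdiff (fun z => cgamma (mellin_var z)) z.
  move=> hz; apply: (@cdiff_comp _ mellin_var cgamma); first exact: cdiff_mellin_var.
  by apply: cdiff_cgamma; rewrite Re_mellin_var; lra.
have D0 x t : lo + 1 < x -> x + 1 < 2 -> 0 < t <= 1 ->
    cgamma (mellin_var (x +i* t)) * F (x +i* t) - M (x +i* t) = 0.
  apply: (@upper_strip_continuation _ (fun z => cgamma (mellin_var z) * F z - M z) lo (- n%:R) 2).
  - by lra.
  - move=> z hz imz; have /andP[hz1 hz2] := hz.
    have dpolar c : cdiff (polar_sum k.+1 c d) z.
      apply: cdiff_polar_sum => l _; apply/eqP => /(congr1 (@complex.Im R)).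
      by rewrite Im_mellin_var /= => h; move: imz; lra.
    apply: cdiffB; last first.
      by apply: cdiffD; (apply: cdiffM; [exact: entire_cdiff|apply: cdiffB; [exact: dME|exact: dpolar]]).
    apply: cdiffM; first exact: dgam.
    apply: holomorphic_cdiff; apply: Rhol => // l lE.
    by move: imz; rewrite lE riesz_poleE /= ltxx.
  - move=> z /andP[hz1 hz2] imz.
    rewrite /F Rstrip//.
    have hz : - n%:R < Re z < 2 by rewrite hz1.
    have hs : 0 < Re (mellin_var z) < n%:R / 2 + 1.
      by rewrite Re_mellin_var; apply/andP; split; lra.
    have e1 := eE1 _ hs; have e2 := eE2 _ hs.
    rewrite (regular_riesz w I (A z) (B z) sphi hz) /M /polar_sum.
    rewrite -/(mellin_var z) -/c1 -/c2 -/d -e1 -e2.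
    move: (cgamma _) (A z) (B z) (cint _ _) (cint _ _) => x1 x2 x3 x4 x5.
    by ring.
(* The two sides of the continued identity times z - pole, which are regular at the pole. *)
pose K1 z := cgamma (mellin_var z) * ((z - pole) * g z + a 0%N).
pose K2 z := (z - pole) * (A z * (E1 (mellin_var z) - polar_sum k c1 d z) +
   B z * (E2 (mellin_var z) - polar_sum k c2 d z)) + 2 * (A z * c1 k + B z * c2 k).
have Rp : Re pole = - n%:R - 2 * k%:R by rewrite /pole riesz_poleE.
have K0 : K1 pole - K2 pole = 0.
  apply: (@cdiff_zero_above _ (fun z => K1 z - K2 z)).
    have dp : cdiff (fun z => z - pole) pole.
      by apply: cdiffB; [exact: cdiff_id|exact: cdiff_cst].
    have hp : lo < Re pole < 2 by rewrite Rp /lo ksucc; apply/andP; split; lra.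
    have dpolar c : cdiff (polar_sum k c d) pole.
      apply: cdiff_polar_sum => l lk; rewrite mellin_var_pole; apply/eqP => -[] /addrI /eqP.
      by rewrite eqr_nat eqSS => /eqP h; move: lk; rewrite h ltnn.
    apply: cdiffB.
      apply: cdiffM; first by apply: dgam; have /andP[] := hp.
      apply: cdiffD; last exact: cdiff_cst.
      by apply: cdiffM => //; exact: holomorphic_cdiff.
    apply: cdiffD.
      apply: cdiffM => //.
      by apply: cdiffD; (apply: cdiffM; [exact: entire_cdiff|apply: cdiffB; [exact: dME|exact: dpolar]]).
    apply: cdiffM; first exact: cdiff_cst.
    by apply: cdiffD; apply: cdiffM; [exact: entire_cdiff|exact: cdiff_cst|exact: entire_cdiff|exact: cdiff_cst].
  have [r r0 hr] := (dnear_normcP _ _).1 Fg.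
  exists (Num.min r 1) => [|t /andP[t0 tr]]; first by rewrite lt_min r0 ltr01.
  move: tr; rewrite lt_min => /andP[tr t1].
  set z := pole + _.
  have zE : z = (- n%:R - 2 * k%:R) +i* t.
    by rewrite /z /pole riesz_poleE; apply: complex_eq; rewrite reim /= ?addr0 ?add0r.
  have zp : z - pole != 0.
    by rewrite /z addrC addKr eq_complex /= negb_and orbC gt_eqF.
  have Fz : F z = g z + a 0%N / (z - pole).
    rewrite /F hr ?big_ord1 ?expr1//; first by rewrite -subr_eq0.
    by rewrite /z addrC addKr normc_i gtr0_norm.
  have := D0 (- n%:R - 2 * k%:R) t; rewrite -zE => /(_ _ _ _)/eqP.
  rewrite subr_eq0 => H.
  have {}H : cgamma (mellin_var z) * F z = M z.
    by apply/eqP; apply: H; [rewrite /lo ksucc; lra|lra|rewrite t0 ltW].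
  have K1E : K1 z = (z - pole) * (cgamma (mellin_var z) * F z).
    by rewrite /K1 Fz; move: (z - pole) zp (cgamma _) (g z) (a _) => y y0 x1 x2 x3; field.
  (* The term of index k is singular at this pole; the remaining polar sum is regular there. *)
  have pE c : polar_sum k.+1 c d z = polar_sum k c d z - 2 * c k / (z - pole).
    rewrite /polar_sum big_ord_recr /= mellin_varB -/pole; congr (_ + _).
    by move: (z - pole) zp (c k) => y y0 x1; field.
  rewrite K1E H /M !pE /K2.
  move: (z - pole) zp (A z) (B z) (E1 _) (E2 _) (polar_sum _ _ _ _) (polar_sum _ _ _ _) (c1 k) (c2 k).
  by move=> y y0 x1 x2 x3 x4 x5 x6 x7 x8; field.
have sk : 0 < n%:R / 2 + k.+1%:R :> R by rewrite ksucc; lra.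
move: K0; rewrite /K1 /K2 subrr !mul0r !add0r mellin_var_pole cgamma_real// => /eqP.
rewrite subr_eq0 => /eqP ->; rewrite /c1 /c2; ring.
Qed.

End riesz_residue.

(** * Identification of the residue density *)

Lemma cint_null_set d (T : measurableType d) (R : realType) (mu : {measure set T -> \bar R})
    (N : set T) (f h : T -> R[i]) : measurable N -> mu N = 0%E -> cintegrable mu f ->
  (forall x, N x -> h x = 0) -> (forall x, ~ N x -> h x = f x) -> cint mu h = cint mu f.
Proof.
move=> mN N0 [i1 i2] h0 hf.
have E (F G : T -> R) : mu.-integrable setT (EFin \o F) -> (forall x, N x -> G x = 0) ->
    (forall x, ~ N x -> G x = F x) -> \int[mu]_x G x = \int[mu]_x F x.
  move=> iF G0 GF; rewrite /Rintegral (negligible_integral mN measurableT iF N0).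
  rewrite [in RHS]integral_mkcond; congr fine; apply: eq_integral => x _.
  rewrite /patch; case: ifPn; rewrite (inE, notin_setE) => /= hx.
    by rewrite GF//; case: hx.
  by rewrite G0//; apply: contrapT => nx; apply: hx.
rewrite /cint; congr (_ +i* _); apply: E => // x hx.
- by rewrite h0.
- by rewrite hf.
- by rewrite h0.
- by rewrite hf.
Qed.

Section residue_density.
Context {R : realType} {n : nat}.
Local Notation C := R[i].
Local Notation V := 'rV[R]_n.
Local Notation mu := (@lebesgue_tuple R n).
Local Notation row := (@row_of_tuple R n).
Local Notation form := (cform R n).
Implicit Types (x : V) (w : form).

(** The origin lies in a hyperplane. In dimension 0 it would have mass 1, whence the positivity of
    n. *)
Lemma sqnorm0_null : (0 < n)%N ->
  measurable [set u : n.-tuple R | sqnorm (row u) = 0] /\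
  mu [set u : n.-tuple R | sqnorm (row u) = 0] = 0%E.
Proof.
move=> n0.
have mN : measurable [set u : n.-tuple R | sqnorm (row u) = 0].
  have := @measurable_row_sqnorm R n measurableT [set 0] (measurable_set1 0).
  by rewrite setTI; congr measurable; apply/seteqP; split.
split => //; case: n n0 mN => // m _ mN.
apply: (@subset_measure0 _ _ _ (@lebesgue_tuple R m.+1) _ [set u : m.+1.-tuple R | thead u = 0] mN
  (measurable_thead_set1 0)) => [u /= u0|].
  have := sqr_coord_le (row_of_tuple u) ord0; rewrite u0 mxE => h.
  apply/eqP; rewrite -sqrf_eq0; apply/eqP/le_anti; rewrite sqr_ge0 andbT.
  exact: h.
exact: lebesgue_tuple_thead.
Qed.

Lemma cint_sqnorm_neq0 (f h : n.-tuple R -> C) : (0 < n)%N -> cintegrable mu f ->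
  (forall u, sqnorm (row u) = 0 -> h u = 0) -> (forall u, sqnorm (row u) != 0 -> h u = f u) ->
  cint mu h = cint mu f.
Proof.
move=> /sqnorm0_null [mN N0] iF h0 hf.
apply: (@cint_null_set _ _ R mu [set u : n.-tuple R | sqnorm (row u) = 0] f h mN N0 iF) => // u hu.
by apply: hf; apply/eqP.
Qed.

Lemma coord_sqnorm0 x i : sqnorm x = 0 -> x ord0 i = 0.
Proof.
move=> q0; have := sqr_coord_le x i; rewrite q0 => h.
by apply/eqP; rewrite -sqrf_eq0; apply/eqP/le_anti; rewrite sqr_ge0 andbT.
Qed.

Lemma int_ext_sqnorm0 x w : sqnorm x = 0 -> int_ext x w = 0.
Proof.
move=> q0; rewrite /int_ext /int_mul big1// => i _.
by rewrite coord_sqnorm0// scale0r.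
Qed.

Lemma ext_int_sqnorm0 x w : sqnorm x = 0 -> ext_int x w = 0.
Proof.
move=> q0; rewrite /ext_int /ext_mul big1// => i _.
by rewrite coord_sqnorm0// scale0r.
Qed.

Lemma endo_pow_sqnorm0 T k x w : (forall v, T x v = 0) -> endo_pow T k x w = 0.
Proof. by move=> T0; case: k => [|k] /=; rewrite T0 ?scaler0. Qed.

(** u is an eigenvector of T x for |x|^2 and u' is killed, so a power of T x extracts the
    u-component times |x|^(2k). For k = 0 the projection convention of [endo_pow] makes the same
    formula hold. *)
Lemma endo_pow_eigen (T : V -> form -> form) k x (u u' : form) (r c c' : C) :
  sqnorm x != 0 -> (forall v v', T x (v + v') = T x v + T x v') ->
  (forall c v, T x (c *: v) = c *: T x v) -> T x u = (sqnorm x)%:C *: u -> T x u' = 0 ->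
  endo_pow T k x (r *: (c *: u + c' *: u')) = (r * c * (sqnorm x ^+ k)%:C) *: u.
Proof.
move=> q0 TD TZ Tu Tu'; have TuZ e : T x (e *: u) = (e * (sqnorm x)%:C) *: u.
  by rewrite TZ Tu scalerA.
have Tv : T x (r *: (c *: u + c' *: u')) = (r * c * (sqnorm x)%:C) *: u.
  by rewrite TZ TD !TZ Tu' scaler0 addr0 Tu !scalerA.
case: k => [|k].
  rewrite /= Tv scalerA expr0 mulr1 rmorphV ?unitfE//; congr (_ *: _).
  by rewrite mulrC mulfK// fmorph_eq0.
rewrite /endo_pow iterSr Tv; elim: k => [|k ih]; first by rewrite expr1.
rewrite iterS ih TuZ; congr (_ *: _); rewrite [in RHS]exprSr rmorphM; ring.
Qed.

Lemma endo_pow_eigen_r (T : V -> form -> form) k x (u u' : form) (r c c' : C) :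
  sqnorm x != 0 -> (forall v v', T x (v + v') = T x v + T x v') ->
  (forall c v, T x (c *: v) = c *: T x v) -> T x u = (sqnorm x)%:C *: u -> T x u' = 0 ->
  endo_pow T k x (r *: (c' *: u' + c *: u)) = (r * c * (sqnorm x ^+ k)%:C) *: u.
Proof. by rewrite addrC; exact: endo_pow_eigen. Qed.

Lemma scale_combination2 (u u' : form) (s s' e r r' : C) : s = e * r -> s' = e * r' ->
  s *: u + s' *: u' = e *: (r *: u + r' *: u').
Proof. by move=> -> ->; rewrite scalerDr !scalerA. Qed.

Lemma rpow_m2 x : sqnorm x != 0 -> rpow (0 - 2) x = (sqnorm x)^-1%:C.
Proof.
move=> q0; rewrite /rpow (_ : (0 - 2) / 2 = -1); last by rewrite sub0r mulNr divff.
rewrite /cpow /= oppr0 mul0r cis0 mulr1 powR_inv1//; exact: sqnorm_ge0.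
Qed.

Lemma rpow_even k x : rpow (2 * k)%:R x = (sqnorm x ^+ k)%:C.
Proof.
rewrite /rpow (_ : (2 * k)%:R / 2 = k%:R); last by rewrite natrM mulrC mulKf ?pnatr_eq0.
by rewrite /cpow Re_natr Im_natr mul0r cis0 mulr1 powR_mulrn// sqnorm_ge0.
Qed.

(** The powers separate the components of R^0, whose coefficients c and d then cancel against the
    denominators; c' and d' remain, with the weight |x|^(2k-2). *)
Lemma residue_integrand k x w (c d c' d' : C) : sqnorm x != 0 -> c != 0 -> d != 0 ->
  let v := riesz_fun 0 c d x w in
  (c' / c) *: endo_pow int_ext k x v + (d' / d) *: endo_pow ext_int k x v =
  (sqnorm x ^+ k / sqnorm x)%:C *: (c' *: int_ext x w + d' *: ext_int x w).
Proof.
move=> q0 c0 d0 v; set q := sqnorm x in q0 *.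
have q0' : q%:C != 0 :> C by rewrite fmorph_eq0.
have e1 : endo_pow int_ext k x v = ((q^-1)%:C * c * (q ^+ k)%:C) *: int_ext x w.
  rewrite /v /riesz_fun (rpow_m2 q0); apply: endo_pow_eigen.
  - exact: q0.
  - exact: int_extD.
  - exact: int_extZ.
  - exact: int_ext_sqr.
  - exact: int_ext_ext_int0.
have e2 : endo_pow ext_int k x v = ((q^-1)%:C * d * (q ^+ k)%:C) *: ext_int x w.
  rewrite /v /riesz_fun (rpow_m2 q0); apply: endo_pow_eigen_r.
  - exact: q0.
  - exact: ext_intD.
  - exact: ext_intZ.
  - exact: ext_int_sqr.
  - exact: ext_int_int_ext0.
have E (e e' : C) : e != 0 -> e' / e * ((q^-1)%:C * e * (q ^+ k)%:C) = (q ^+ k / q)%:C * e'.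
  move=> ne; have -> : (q ^+ k / q)%:C = (q ^+ k)%:C * (q^-1)%:C :> C by rewrite rmorphM.
  by move: (q^-1)%:C (q ^+ k)%:C => y1 y2; field.
rewrite e1 e2; move: (int_ext x w) (ext_int x w) => u1 u2.
rewrite 2!scalerA; apply: scale_combination2.
- exact: E.
- exact: E.
Qed.

End residue_density.

Section residue_value.
Context {R : realType} {n : nat}.
Local Notation C := R[i].
Local Notation V := 'rV[R]_n.
Local Notation mu := (@lebesgue_tuple R n).
Local Notation row := (@row_of_tuple R n).
Local Notation form := (cform R n).
Variables (p k : nat) (A B : C -> C) (w : form) (I : {set 'I_n}).
Hypothesis pw : is_pform p w.
Local Notation pole := (riesz_pole R n k).

(* For k = 0 the terms with sqnorm x ^+ k.-1 are killed by the factor 2 k. *)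
Definition residue_density (x : V) : C :=
  - (A pole * ((n%:R - p%:R) * (w I : C) * (sqnorm x ^+ k)%:C +
       (2 * k)%:R * ((int_ext x w I : C) * (sqnorm x ^+ k.-1)%:C)) +
     B pole * (p%:R * (w I : C) * (sqnorm x ^+ k)%:C +
       (2 * k)%:R * ((ext_int x w I : C) * (sqnorm x ^+ k.-1)%:C))).

Section pairing.
Variable phi : V -> C.
Hypothesis sphi : schwartz phi.

Let quad_part (t : C) a x := (t * (sqnorm x ^+ k)%:C + (2 * k)%:R * (quad a x * (sqnorm x ^+ k.-1)%:C)) * phi x.

Let quad_part_integrable t a : cintegrable mu (quad_part t a \o row).
Proof.
have := rapid_integrable (schwartz_rapid (schwartzD (schwartzZ t (schwartz_sqnorm k sphi))
  (schwartzZ (2 * k)%:R (schwartz_quad a k.-1 sphi)))).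
by congr (cintegrable mu _); apply/funext => u; rewrite /comp /quad_part; ring.
Qed.

Let densityE x : residue_density x * phi x =
  - A pole * quad_part ((n%:R - p%:R) * (w I : C)) (int_ext_coef w I) x +
  - B pole * quad_part (p%:R * (w I : C)) (ext_int_coef w I) x.
Proof.
rewrite /residue_density /quad_part quad_int_ext quad_ext_int.
by move: (A _) (B _) (int_ext _ _ _) (ext_int _ _ _) => a b c d; ring.
Qed.

Lemma residue_density_integrable : cintegrable mu (fun u => residue_density (row u) * phi (row u)).
Proof.
rewrite (funext (fun u => densityE (row u))).
by apply: cintegrableD; apply: cintegrableZ; exact: quad_part_integrable.
Qed.

Lemma cint_residue_density : cint mu (fun u => residue_density (row u) * phi (row u)) =
  - A pole * cint mu (quad_part ((n%:R - p%:R) * (w I : C)) (int_ext_coef w I) \o row) +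
  - B pole * cint mu (quad_part (p%:R * (w I : C)) (ext_int_coef w I) \o row).
Proof.
rewrite (funext (fun u => densityE (row u))).
have i1 := quad_part_integrable ((n%:R - p%:R) * (w I : C)) (int_ext_coef w I).
have i2 := quad_part_integrable (p%:R * (w I : C)) (ext_int_coef w I).
by rewrite (cintD (cintegrableZ (- A pole) i1) (cintegrableZ (- B pole) i2)) (cintZ _ i1) (cintZ _ i2).
Qed.

Lemma riesz_residueE (Rz : C -> form_dist R n) (a : nat -> C) : (0 < n)%N ->
  entire A -> entire B -> is_riesz_family p A B Rz ->
  principal_part (fun z => Rz z (fourier phi) w I) pole 1 a ->
  a 0%N = (res_factor n k)%:C * cint mu (fun u => residue_density (row u) * phi (row u)).
Proof.
move=> n0 hA hB hR ha; have := riesz_residue n0 hA hB hR sphi pw ha.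
have t1 : \sum_i int_ext_coef w I i i = (n%:R - p%:R) * (w I : C) by exact: sum_contract_wedge.
have t2 : \sum_i ext_int_coef w I i i = p%:R * (w I : C) by exact: sum_wedge_contract.
rewrite !heat_moment_hess// t1 t2 cint_residue_density /quad_part /comp.
set x1 := cint mu _; set x2 := cint mu _.
have sk : 0 < n%:R / 2 + k.+1%:R :> R.
  by rewrite ltr_wpDl// divr_ge0.
have -> : (Num.sqrt pi ^+ n = pi `^ (n%:R / 2) :> R).
  by rewrite -powR12_sqrt ?pi_ge0// -powR_mulrn ?powR_ge0// -powRrM mulrC.
rewrite /res_factor (_ : (n + 2 * k + 2)%N%:R / 2 = n%:R / 2 + k.+1%:R :> R); last first.
  by rewrite -[k.+1%:R]natr1 !natrD; field.
have := Gamma_gt0 sk; move: (Gamma _) => G /lt0r_neq0 G0 h.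
have G0' : G%:C != 0 :> C by rewrite fmorph_eq0.
apply: (mulfI G0'); rewrite h.
have f0 : k`!%:R != 0 :> R by rewrite pnatr_eq0 -lt0n fact_gt0.
have p0 : 4 ^+ k != 0 :> R by rewrite expf_neq0.
(* The 2 from the change of variable meets the 1/2 of [heat_moment_hess]; the sign is the one put
   into [residue_density]. *)
have -> : ((-1) ^+ k.+1 * pi `^ (n%:R / 2) / (4 ^+ k * k`!%:R * G))%:C =
  - (2 * (pi `^ (n%:R / 2))%:C * ((-1) ^+ k / (2 * 4 ^+ k * k`!%:R))%:C) / G%:C :> C.
  rewrite (_ : 2 = (2 : R)%:C :> C); last by rewrite rmorph_nat.
  rewrite -fmorphV -!rmorphM -rmorphN -rmorphM; congr (_%:C); rewrite exprS.
  move: (_ `^ _) ((-1) ^+ k) (4 ^+ k) (k`!%:R) p0 f0 => y1 y2 y3 y4 y30 y40.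
  by field; rewrite G0 y30 y40.
move: (A _) (B _) (_%:C) ((_ `^ _)%:C) (_%:C) G0' => a1 b1 g1 g2 g3 g0.
by field.
Qed.

End pairing.
End residue_value.

(** Both claims rewrite one formula, the residue as [res_factor] times the integral against
    [residue_density]: the first outside the origin, by splitting w into its two components, the
    second at every point, since eps_x i_x kills 0-forms. *)
Theorem theorem3p4 (R : realType) (n p : nat) (n_gt0 : (0 < n)%N)
    (p_le_n : (p <= n)%N) (A B : R[i] -> R[i])
    (A_hol : entire A) (B_hol : entire B)
    (Rz : R[i] -> form_dist R n) (Rz_riesz : is_riesz_family p A B Rz)
    (k : nat) :
  let Cl := riesz_C p A B in
  let Dl := riesz_D n p A B in
  let ln := riesz_pole R n 0 in
  let lk := riesz_pole R n k in
  (Cl ln != 0 -> Dl ln != 0 ->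
   is_dist_residue p (fun lam => fourier_dist (Rz lam)) lk
     (regular_dist (fun xi w =>
        let v := riesz_fun 0 (Cl ln) (Dl ln) xi w in
        (res_factor n k)%:C *:
          ((Cl lk / Cl ln) *: endo_pow int_ext k xi v +
           (Dl lk / Dl ln) *: endo_pow ext_int k xi v)))) /\
  (p = 0%N ->
   is_dist_residue p (fun lam => fourier_dist (Rz lam)) lk
     (regular_dist (fun xi w =>
        ((res_factor n k)%:C * Cl lk * rpow (2 * k)%N%:R xi) *: w))).
Proof.
move=> Cl Dl ln lk.
have pw_residue (U : form_dist R n) : (forall phi w I, schwartz phi -> is_pform p w ->
    U phi w I = (res_factor n k)%:C * cint (lebesgue_tuple n)
      (fun u => residue_density p k A B w I (row_of_tuple u) * phi (row_of_tuple u))) ->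
    is_dist_residue p (fun lam => fourier_dist (Rz lam)) lk U.
  move=> hU phi w I sphi pw; have [_ _ _ Rpole] := Rz_riesz.
  have [a ha] := Rpole _ _ I k (schwartz_fourier sphi) pw.
  exists 0%N, a; split => //.
  by rewrite hU//; exact: (riesz_residueE pw sphi n_gt0 A_hol B_hol Rz_riesz ha).
have lkE : lk = - (n%:R + 2 * k%:R) by rewrite /lk /riesz_pole opprD.
split=> [C0 D0|p0]; apply: pw_residue => phi w I sphi pw.
  rewrite /regular_dist ffunE.
  have iG := residue_density_integrable p k A B w I sphi.
  (* At the origin the claimed integrand is 0, whereas for k = 0 the density need not vanish there;
     hence a comparison off a null set. *)
  rewrite -(cintZ _ iG); apply: (cint_sqnorm_neq0 n_gt0 (cintegrableZ _ iG)) => u /= hu.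
    rewrite [X in X * _](_ : _ = 0) ?mul0r// !ffunE.
    rewrite !endo_pow_sqnorm0 => [|v|v]; rewrite ?int_ext_sqnorm0 ?ext_int_sqnorm0//.
    by rewrite !ffunE !scaler0 addr0 scaler0.
  set x := row_of_tuple u in hu *; have q0 : sqnorm x != 0 by [].
  rewrite residue_integrand// mulrA; congr (_ * _).
  have q0' : (sqnorm x)%:C != 0 :> R[i] by rewrite fmorph_eq0.
  have := congr1 (fun v : cform R n => v I : R[i]) (int_ext_ext_int x w).
  rewrite !ffunE /GRing.scale /= => hw.
  have {}hw : (w I : R[i]) = ((int_ext x w I : R[i]) + ext_int x w I) / (sqnorm x)%:C.
    by rewrite hw mulrC mulKf.
  (* With lambda = -n - 2k, the coefficients regroup through -(n - p) - 2k = lambda + p and -p - 2k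
     = lambda + n - p into C and D. *)
  congr (_ * _); rewrite /residue_density hw -/lk /Cl /Dl /riesz_C /riesz_D lkE.
  move: (A _) (B _) (int_ext x w I) (ext_int x w I) => a1 b1 x1 x2.
  clear -q0 q0'; case: k => [|j].
    rewrite expr0 mul1r muln0 fmorphV /=.
    by move: (_%:C) q0' => q q1; field.
  rewrite exprSr mulfK// rmorphM /= natrM.
  by move: ((sqnorm x)%:C) q0' (_%:C) => q q1 y; field.
have iG := residue_density_integrable p k A B w I sphi.
rewrite /regular_dist ffunE -(cintZ _ iG); apply: eq_cint => u.
rewrite mulrA; congr (_ * _); rewrite !ffunE rpow_even /GRing.scale /= -!mulrA; congr (_ * _).
set x := row_of_tuple u.
have e0 : ext_int x w = 0 by apply: ext_int_0form; rewrite -p0.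
have := congr1 (fun v : cform R n => v I : R[i]) (int_ext_ext_int x w).
rewrite e0 addr0 !ffunE /GRing.scale /= => hw.
rewrite /residue_density e0 hw /Cl /riesz_C -/lk lkE p0 ffunE.
move: (A _) (B _) (w I : R[i]) => a1 b1 w1.
clear; case: k => [|j]; first by rewrite muln0 expr0; ring.
by rewrite exprS rmorphM /= natrM; ring.
Qed.
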